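(* Let $m$ be a positive integer, let $p$ be a prime with $p \equiv 7 \pmod 8$, and suppose $q = 4^m+1$ is a prime such that $\left(\frac{p}{q}\right) = 1$ (Legendre symbol). Let $E$ be the elliptic curve over $\mathbb{Q}$ given by $$E : y^2 = x(x-4^m p)(x+p).$$ If $m=1$, then the $2$-Selmer rank $s(E)$ of $E$ is equal to $1$. If $m \geq 2$, then the $2$-Selmer rank satisfies $1 \leq s(E) \leq 3$.
   Context: $\mathrm{Sel}_2(E/\mathbb{Q})$ denotes the $2$-Selmer group of $E$ over $\mathbb{Q}$, which fits in the exact sequence $0 \to E(\mathbb{Q})/2E(\mathbb{Q}) \to \mathrm{Sel}_2(E/\mathbb{Q}) \to \mathrm{Sha}(E/\mathbb{Q})[2] \to 0$, where $\mathrm{Sha}$ denotes the Shafarevich-Tate group. The $2$-Selmer rank $s(E)$ is defined by $\#\mathrm{Sel}_2(E/\mathbb{Q}) = 2^{2+s(E)}$ (so the contribution of the full rational $2$-torsion is removed). *)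

(* Defs.v *)
From HB Require Import structures.
From mathcomp Require Import all_boot all_order all_algebra all_field.
From mathcomp Require Import boolp classical_sets cardinality reals Rstruct.
From Stdlib Require Rdefinitions.

Set Implicit Arguments.
Unset Strict Implicit.
Unset Printing Implicit Defensive.

Import Order.TTheory GRing.Theory Num.Theory.
Local Open Scope ring_scope.

Local Notation R := Rdefinitions.R.

Definition legendre (a q : nat) : int :=
  if (q %| a)%N then 0
  else if [exists x : 'I_q, (x ^ 2 == a %[mod q])%N] then 1 else -1.

(* An elliptic curve over Q is given here by a monic separable cubic
   f : {poly rat}, standing for the curve y^2 = f(x).  Its base change
   to an extension L of Q is given by map_poly ratr f : {poly L}. *)
Inductive ecpoint (L : Type) : Type := Infty | Aff of L & L.
Arguments Infty {L}.

Definition point_map (L M : Type) (s : L -> M) (P : ecpoint L) : ecpoint M :=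
  if P is Aff x y then Aff (s x) (s y) else Infty.

Section Points.

Variables (L : fieldType) (f : {poly L}).

Definition on_curve (P : ecpoint L) : Prop :=
  if P is Aff x y then y ^+ 2 = f.[x] else True.

Definition point_opp (P : ecpoint L) : ecpoint L :=
  if P is Aff x y then Aff x (- y) else Infty.

(* Chord and tangent law on y^2 = f(x) = x^3 + f`_2 x^2 + f`_1 x + f`_0: the line
   y = l x + n meets the curve in points whose x-coordinates add up to l^2 - f`_2. *)
Definition point_add (P Q : ecpoint L) : ecpoint L :=
  match P, Q with
  | Infty, _ => Q
  | _, Infty => P
  | Aff x1 y1, Aff x2 y2 =>
      if (x1 == x2) && (y1 == - y2) then Infty
      else
        let l := if x1 == x2 then f^`().[x1] / (2 * y1)
                 else (y2 - y1) / (x2 - x1) in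
        let x3 := l ^+ 2 - f`_2 - x1 - x2 in
        Aff x3 (l * (x1 - x3) - y1)
  end.

Definition point_sub (P Q : ecpoint L) : ecpoint L := point_add P (point_opp Q).

Definition two_torsion (P : ecpoint L) : Prop :=
  on_curve P /\ point_add P P = Infty.

End Points.

(* The absolute Galois group of Q: algC is an algebraic closure of Q, so each of
   its ring endomorphisms fixes Q and is bijective. *)
Definition galQ : Type := {rmorphism algC -> algC}.

Section H1.

Variable f : {poly rat}.

Let fC : {poly algC} := map_poly ratr f.

(* For the Krull topology on galQ and the discrete topology on points. *)
Definition krull_continuous (c : galQ -> ecpoint algC) : Prop :=
  forall s : galQ, exists A : seq algC,
    forall t : galQ, {in A, t =1 s} -> c t = c s.

(* Continuous 1-cocycles galQ -> E[2]. *)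
Definition cocycle2 (c : galQ -> ecpoint algC) : Prop :=
  [/\ forall s, two_torsion fC (c s),
      forall s t : galQ,
        c (s \o t : {rmorphism algC -> algC}) =
          point_add fC (c s) (point_map s (c t))
    & krull_continuous c].

Definition cohomologous2 (c c' : galQ -> ecpoint algC) : Prop :=
  exists2 T : ecpoint algC, two_torsion fC T &
    forall s : galQ, c' s = point_add fC (c s) (point_sub fC (point_map s T) T).

(* The class of c in H^1(Q, E[2]). *)
Definition H1_class (c : galQ -> ecpoint algC) : set (galQ -> ecpoint algC) :=
  [set c' | cocycle2 c' /\ cohomologous2 c c']%classic.

End H1.

Inductive place : Type := Infinite | Finite (p : nat) of prime p.

Definition padic_abs (p : nat) (x : rat) : R :=
  if x == 0 then 0
  else p%:R ^+ logn p `|denq x|%N / p%:R ^+ logn p `|numq x|%N.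

Definition place_abs (v : place) (x : rat) : R :=
  match v with
  | Infinite => `|ratr x|
  | @Finite p _ => padic_abs p x
  end.

(* The completion Q_v, characterized up to unique isomorphism. *)
Record completion (v : place) : Type := Completion {
  compl_field :> fieldType;
  compl_abs : compl_field -> R;
  compl_abs_ge0 : forall x, 0 <= compl_abs x;
  compl_abs_eq0 : forall x, compl_abs x = 0 -> x = 0;
  compl_absM : forall x y, compl_abs (x * y) = compl_abs x * compl_abs y;
  compl_absD : forall x y, compl_abs (x + y) <= compl_abs x + compl_abs y;
  compl_abs_rat : forall r : rat, compl_abs (ratr r) = place_abs v r;
  compl_dense : forall (x : compl_field) (e : R), 0 < e ->
    exists r : rat, compl_abs (x - ratr r) < e;
  compl_complete : forall u : nat -> compl_field,
    (forall e : R, 0 < e -> exists N : nat, forall i j : nat,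
       (N <= i)%N -> (N <= j)%N -> compl_abs (u i - u j) < e) ->
    exists l : compl_field, forall e : R, 0 < e -> exists N : nat,
      forall i : nat, (N <= i)%N -> compl_abs (u i - l) < e
}.

Record algebraic_closure (K : fieldType) : Type := AlgebraicClosure {
  aclos_field :> closedFieldType;
  aclos_inj : {rmorphism K -> aclos_field};
  aclos_algebraic : forall x : aclos_field, algebraicOver aclos_inj x
}.

Section Selmer.

Variable f : {poly rat}.

(* The image of the class of c in H^1(Q_v, E) is zero: along an embedding iota of
   algC in an algebraic closure L of Q_v, an automorphism s of L over Q_v
   restricts to some t in galQ, and s |-> iota (c t) has to be the coboundary of
   a point P of E(L).  This does not depend on the choice of K = Q_v, L and iota,
   hence the universal quantification. *)
Definition locally_trivial (v : place) (c : galQ -> ecpoint algC) : Prop :=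
  forall (K : completion v) (L : algebraic_closure K)
         (iota : {rmorphism algC -> L}),
  let fL : {poly L} := map_poly ratr f in
  exists2 P : ecpoint L, on_curve fL P &
    forall (s : {rmorphism L -> L}) (t : galQ),
      (forall x : K, s (aclos_inj L x) = aclos_inj L x) ->
      (forall z : algC, s (iota z) = iota (t z)) ->
      point_map iota (c t) = point_sub fL (point_map s P) P.

(* Sel_2(E/Q), the kernel of H^1(Q, E[2]) -> prod_v H^1(Q_v, E). *)
Definition Sel2 : set (set (galQ -> ecpoint algC)) :=
  [set H1_class f c | c in
     [set c | cocycle2 f c /\ forall v, locally_trivial v c]]%classic.

Definition Selmer_rank (s : nat) : Prop := (Sel2 #= `I_(2 ^ (2 + s)))%card.

End Selmer.

Definition E_cubic (m p : nat) : {poly rat} :=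
  'X * ('X - ((4 ^ m * p)%N%:R)%:P) * ('X + (p%:R)%:P).

(* Main.v *)
Require Import Defs.
From HB Require Import structures.
From mathcomp Require Import all_boot all_order all_algebra all_field.
From mathcomp Require Import boolp classical_sets filter cardinality reals Rstruct.
From mathcomp Require Import ring lra zify.
From Stdlib Require Rdefinitions Rcomplete.

(** Since E[2] is rational, Kummer theory turns a 2-cocycle into a pair (d1, d3)
    of rational square classes, and its local triviality at v into solubility
    over Q_v of the covering x = d1 u1^2, x - 4^m p = d1 d3 u2^2, x + p = d3 u3^2.
    As the differences of the roots are 4^m p, p and p q, solubility at the other
    primes forces d1 into <-1, 2, p> and d3 into <-1, p, q>.  Translating by the
    2-torsion reduces d3 to a sign, and solubility at p then leaves d3 = 1 and
    d1 = (-p)^b 2^a.  These pairs are soluble everywhere, except that for m = 1,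
    where q = 5 and 2 is not a square modulo q, solubility at 5 requires a = 0.
    Hence s(E) = 1 if m = 1 and s(E) = 2 if m >= 2.

    Solubility is tested at good odd primes by a quadratic character sum that
    produces a point modulo l, and elsewhere by explicit points and Hensel lifting.
    Local triviality quantifies over all models of Q_v, its algebraic closure and
    an embedding of the algebraic numbers, so extracting the solubility conditions
    requires one such model to exist: completions are Cauchy sequences modulo null
    sequences, algebraic closures and extensions of embeddings come from
    ultraproducts over finite sets of polynomials or elements. *)

Set Implicit Arguments.
Unset Strict Implicit.
Unset Printing Implicit Defensive.

Import Order.TTheory GRing.Theory Num.Theory.
Local Open Scope ring_scope.

Local Notation R := Rdefinitions.R.

(** * Residue fields and ultraproducts *)

(** The Galois group acts trivially on E[2], so coboundaries vanish, every class is a single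
    homomorphism, and counting Selmer elements means counting pairs of square classes. The factor 4
    in the order 2^(2+s) is the image of E[2], spanned by (-1, p) and (-p, q).

    A few residue symbols decide the local conditions. Modulo p, the numbers 2 and q are squares and
    -1 is not, the claim on q being quadratic reciprocity. Modulo q, the numbers -1 and p are
    squares, and 2 is one exactly when m >= 2. The sign of d3 is excluded at p, so the upper bound
    uses finite places alone.

    At a good prime l where d1 is a nonsquare, the covering is a curve of genus one and the Hasse
    bound would give a point modulo l. Instead, the sum over F_l of (1 - A)(1 - B)(1 + C), with A,
    B, C the quadratic character at x minus each of the three roots, is shown to be positive by
    evaluating its linear and quadratic parts exactly and bounding the cubic part term by term. *)

Section ResidueField.
Variables (A : comNzRingType) (I : A -> Prop).
Hypothesis I0 : I 0.
Hypothesis I1 : ~ I 1.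
Hypothesis IB : forall x y, I x -> I y -> I (x - y).
Hypothesis IM : forall x y, I y -> I (x * y).
Hypothesis Imax : forall x, ~ I x -> exists y, I (x * y - 1).

Definition ideal_pred : A -> bool := fun x => `[< I x >].

Fact ideal_predP : idealr_closed ideal_pred.
Proof.
split; first by apply/asboolP.
  by apply/asboolP.
move=> a u v /asboolP Iu /asboolP Iv; apply/asboolP.
rewrite -[v]opprK; apply: IB; first exact: IM.
by rewrite -[- v]add0r; apply: IB.
Qed.

Definition residue_ideal : idealr A :=
  HB.pack ideal_pred (isIdealr.Build A ideal_pred ideal_predP).

Definition residue_ring : comNzRingType := {ideal_quot residue_ideal}.

Definition residue : {rmorphism A -> residue_ring} :=
  \pi_({ideal_quot residue_ideal})%qT.

Lemma residue_eq0 (x : A) : residue x = 0 <-> I x.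
Proof.
rewrite -(rmorph0 residue); split => [/eqP|Ix].
  by rewrite /residue /= -Quotient.idealrBE subr0 => /asboolP.
by apply/eqP; rewrite -Quotient.idealrBE subr0; apply/asboolP.
Qed.

Lemma residue_surj (y : residue_ring) : exists x, residue x = y.
Proof. by exists (repr y); rewrite /residue /= reprK. Qed.

Fact residue_inv_ex (y : residue_ring) :
  exists z, (y != 0 -> z * y = 1) /\ (y = 0 -> z = 0).
Proof.
have [->|] := eqVneq y 0; first by exists 0; split=> // /eqP.
have [x <-] := residue_surj y.
move=> nx; have /Imax [z Iz] : ~ I x.
  by move=> /residue_eq0 /eqP; apply/negP.
exists (residue z); split=> [_|/eqP]; last by rewrite (negPf nx).
rewrite -rmorphM mulrC; apply/eqP; rewrite -subr_eq0.
by rewrite -(rmorph1 residue) -rmorphB; apply/eqP/residue_eq0.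
Qed.

Definition residue_inv (y : residue_ring) : residue_ring :=
  projT1 (cid (residue_inv_ex y)).

Fact residue_mulV (y : residue_ring) : y != 0 -> residue_inv y * y = 1.
Proof. by rewrite /residue_inv; case: cid => z []. Qed.

Fact residue_inv0 : residue_inv 0 = 0.
Proof. rewrite /residue_inv; by case: cid => z [_ /= z0]; exact: z0. Qed.

(** [Imax] says that [I] is maximal. The quotient is used only through this presentation, a
    surjection with kernel [I]: for ultraproducts, for [F[X]/(p)], and for Cauchy sequences modulo
    null sequences. *)
Lemma residue_fieldP : exists (K : fieldType) (pi : {rmorphism A -> K}),
  (forall x, pi x = 0 <-> I x) /\ (forall y, exists x, pi x = y).
Proof.
pose R1 := HB.pack_for fieldType residue_ring
  (GRing.ComNzRing_isField.Build residue_ring residue_mulV residue_inv0).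
exists R1; exists residue; split; [exact: residue_eq0 | exact: residue_surj].
Qed.
End ResidueField.

(** * Products of rings over an arbitrary index type *)

Section DependentProduct.
Variables (J : Type) (j0 : J) (K : J -> comNzRingType).

(** A point of [J] is kept in the type because the ring instances below need it to prove that 1
    differs from 0. *)
Definition dprod (_ : J) : Type := forall j, K j.
Local Notation P := (dprod j0).

HB.instance Definition _ := gen_eqMixin P.
HB.instance Definition _ := gen_choiceMixin P.

Let dadd (x y : P) : P := fun j => x j + y j.
Let dopp (x : P) : P := fun j => - x j.
Let dmul (x y : P) : P := fun j => x j * y j.

Fact daddA : associative dadd.
Proof. by move=> x y z; apply: functional_extensionality_dep => j; exact: addrA. Qed.
Fact daddC : commutative dadd.
Proof. by move=> x y; apply: functional_extensionality_dep => j; exact: addrC. Qed.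
Fact dadd0 : left_id ((fun=> 0) : P) dadd.
Proof. by move=> x; apply: functional_extensionality_dep => j; exact: add0r. Qed.
Fact daddN : left_inverse ((fun=> 0) : P) dopp dadd.
Proof. by move=> x; apply: functional_extensionality_dep => j; exact: addNr. Qed.
HB.instance Definition _ := GRing.isZmodule.Build P daddA daddC dadd0 daddN.

Fact dmulA : associative dmul.
Proof. by move=> x y z; apply: functional_extensionality_dep => j; exact: mulrA. Qed.
Fact dmulC : commutative dmul.
Proof. by move=> x y; apply: functional_extensionality_dep => j; exact: mulrC. Qed.
Fact dmul1 : left_id ((fun=> 1) : P) dmul.
Proof. by move=> x; apply: functional_extensionality_dep => j; exact: mul1r. Qed.
Fact dmulD : left_distributive dmul dadd.
Proof. by move=> x y z; apply: functional_extensionality_dep => j; exact: mulrDl. Qed.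
Fact d1n0 : ((fun=> 1) : P) != 0.
Proof.
apply/eqP => /(congr1 (fun f : P => f j0)) /eqP.
by apply/negP; exact: oner_neq0.
Qed.
HB.instance Definition _ :=
  GRing.Zmodule_isComNzRing.Build P dmulA dmulC dmul1 dmulD d1n0.

Lemma dprodB (x y : P) j : (x - y) j = x j - y j. Proof. by []. Qed.
Lemma dprodM (x y : P) j : (x * y) j = x j * y j. Proof. by []. Qed.
Lemma dprod1 j : (1 : P) j = 1. Proof. by []. Qed.
End DependentProduct.

Definition mk_rmorphism (R S : nzRingType) (f : R -> S)
    (fB : zmod_morphism f) (fM : monoid_morphism f) : {rmorphism R -> S} :=
  HB.pack f (GRing.isZmodMorphism.Build R S f fB)
            (GRing.isMonoidMorphism.Build R S f fM).

(** * Splitting fields of single polynomials *)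

Lemma irreducible_dvd (F : fieldType) (p : {poly F}) :
  (1 < size p)%N -> exists2 d, irreducible_poly d & d %| p.
Proof.
have [n] := ubnP (size p); elim: n p => // n IHn p le_pn p1.
have [irr_p|] := pselect (irreducible_poly p); first by exists p.
move=> /not_andP[//|/existsNP[d /not_implyP[d1 /not_implyP[dp /negP ndp]]]].
have p0 : p != 0 by rewrite -size_poly_gt0 (ltn_trans _ p1).
have d0 : d != 0 by apply: contraTneq dp => ->; rewrite dvd0p.
have ltdp : (size d < size p)%N.
  rewrite ltn_neqAle dvdp_leq // andbT; apply: contraNneq ndp => e.
  by rewrite -dvdp_size_eqp // e.
have [||e irr_e ed] := IHn d; first exact: leq_trans ltdp le_pn.
  by rewrite ltn_neqAle eq_sym d1 size_poly_gt0.
by exists e => //; exact: dvdp_trans dp.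
Qed.

Lemma root_extension (F : fieldType) (p : {poly F}) : (1 < size p)%N ->
  exists (F' : fieldType) (i : {rmorphism F -> F'}) (r : F'),
    root (map_poly i p) r.
Proof.
move=> /irreducible_dvd[d /irredp_FAdjoin[L _ [z rz _]] dp].
exists L, (in_alg L), z.
move: rz; rewrite -!dvdp_XsubCl => /dvdp_trans; apply; rewrite dvdp_map.
exact: dp.
Qed.

Definition splits_in (F F' : fieldType) (i : F -> F') (p : {poly F}) :=
  exists rs : seq F', map_poly i p = i (lead_coef p) *: \prod_(r <- rs) ('X - r%:P).

Lemma splitting_extension (F : fieldType) (p : {poly F}) :
  exists (F' : fieldType) (i : {rmorphism F -> F'}), splits_in i p.
Proof.
have [n] := ubnP (size p); elim: n F p => // n IHn F p le_pn.
have [p1|] := ltnP 1 (size p); last first.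
  move=> /size1_polyC ->; exists F, idfun, [::].
  by rewrite big_nil alg_polyC map_polyC /= lead_coefC.
have [F1 [i [r /factor_theorem[q Dp]]]] := root_extension p1.
have q0 : q != 0.
  apply: contraTneq p1 => q0; move: Dp; rewrite q0 mul0r => /eqP.
  by rewrite map_poly_eq0 => /eqP ->; rewrite size_poly0.
have sq : size (map_poly i p) = (size q).+1 by rewrite Dp size_Mmonic ?monicXsubC // size_XsubC addn2.
have [|F2 [j [rs Dq]]] := IHn F1 q.
  by rewrite -ltnS -sq size_map_poly.
exists F2, (j \o i : {rmorphism F -> F2}), (j r :: rs).
rewrite map_poly_comp Dp rmorphM /= Dq big_cons map_polyXsubC mulrC -scalerAr /=.
congr (j _ *: _); have /eqP := congr1 lead_coef Dp.
by rewrite lead_coef_map lead_coef_Mmonic ?monicXsubC // => /eqP.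
Qed.

Lemma splits_in_dvd (F F' : fieldType) (i : {rmorphism F -> F'}) (p q : {poly F}) :
  q != 0 -> p %| q -> splits_in i q -> splits_in i p.
Proof.
move=> q0 pq [rs Dq].
have : map_poly i p %| \prod_(r <- rs) ('X - r%:P).
  by move: pq; rewrite -(dvdp_map i) Dq dvdpZr // fmorph_eq0 lead_coef_eq0.
move=> /dvdp_prod_XsubC[m Dp]; exists (mask m rs).
move/eqpP: Dp => [[c1 c2] /= /andP[c10 c20] e].
have Dlc : i (lead_coef p) = c1^-1 * c2.
  have := congr1 lead_coef e; rewrite !lead_coefZ lead_coef_map.
  have /monicP -> : \prod_(r <- mask m rs) ('X - r%:P) \is monic.
    exact: monic_prod_XsubC.
  rewrite mulr1 => <-.
  by rewrite mulKf.
by rewrite Dlc -scalerA -e scalerA mulVf // scale1r.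
Qed.

(** The factorisation over [F'] already lists every root that [p] can have in a larger field. This
    is what will make the field of algebraic elements algebraically closed. *)
Lemma splits_in_root (F F' F'' : fieldType) (i : {rmorphism F -> F'})
    (j : {rmorphism F' -> F''}) (p : {poly F}) (x : F'') :
  p != 0 -> splits_in i p -> root (map_poly (j \o i) p) x ->
  exists2 y, x = j y & root (map_poly i p) y.
Proof.
move=> p0 [rs Dp]; rewrite map_poly_comp Dp map_polyZ rmorph_prod rootZ; last first.
  by rewrite !fmorph_eq0 lead_coef_eq0.
rewrite (eq_bigr (fun r => 'X - (j r)%:P)); last by move=> r _; rewrite /= map_polyXsubC.
rewrite -(big_map j xpredT (fun r => 'X - r%:P)) root_prod_XsubC => /mapP[y yrs ->].
exists y => //; rewrite rootZ ?fmorph_eq0 ?lead_coef_eq0 //.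
by rewrite root_prod_XsubC.
Qed.

(** * A field over which all polynomials split *)

Section SplittingUltraproduct.
Variable F : fieldType.

(** Take an ultraproduct of splitting fields [E j], indexed by the nonzero polynomials. A fixed [p]
    splits in [E j] for all multiples [j] of [p], a large set of indices, and its splitting involves
    only [n] roots, so it passes to the ultraproduct. *)
Lemma split_all : exists (M : fieldType) (i : {rmorphism F -> M}),
  forall p : {poly F}, splits_in i p.
Proof.
pose J := {p : {poly F} | p != 0}.
pose mkJ (p : {poly F}) (h : p != 0) : J := exist _ p h.
pose j1 : J := mkJ 1 (oner_neq0 _).
have ext (j : J) := cid (splitting_extension (val j)).
pose E j : fieldType := projT1 (ext j).
pose i j : {rmorphism F -> E j} := projT1 (cid (projT2 (ext j))).
have iP j : splits_in (i j) (val j) := projT2 (cid (projT2 (ext j))).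
(* Large sets contain all multiples of some polynomial; two of them meet because the product of the
   two polynomials is a common multiple. *)
pose B : set (set J) := [set A : set J | exists p : J, forall q : J, val p %| val q -> A q]%classic.
have FB : ProperFilter B.
  split=> [[p /(_ p)]|]; first by rewrite dvdpp => /(_ isT).
  split.
  - by exists j1.
  - move=> A A' [p pA] [p' pA'].
    have pp0 : val p * val p' != 0 by rewrite mulf_neq0 // (valP p, valP p').
    exists (mkJ _ pp0) => q /= pq; split.
      by apply: pA; apply: dvdp_trans pq; rewrite dvdp_mulr.
    by apply: pA'; apply: dvdp_trans pq; rewrite dvdp_mull.
  - by move=> A A' AA' [p pA]; exists p => q /pA /AA'.
have [U [FU BU]] := ultraFilterLemma FB.
pose P : comNzRingType := dprod (fun j => E j : comNzRingType) j1.
pose I (x : P) := U [set j | x j = 0]%classic.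
have [||||| M [pi [pi0 _]]] := @residue_fieldP P I.
- by rewrite /I; apply: filterS filterT => j _.
- move=> I1; apply: (@filter_not_empty _ U _); apply: filterS I1 => j /= /eqP.
  by rewrite dprod1 oner_eq0.
- move=> x y Ix Iy; apply: filterS2 Ix Iy => j /= xj yj.
  by rewrite dprodB xj yj subr0.
- move=> x y; apply: filterS => j /= yj; by rewrite dprodM yj mulr0.
(* Where [x] vanishes this is [0^-1 = 0], but the complement of that zero set is large. *)
- move=> x nx; exists (fun j => (x j)^-1 : E j).
  have [//|] := in_ultra_setVsetC [set j | x j = 0]%classic FU.
  apply: filterS => j /= /eqP xj.
  by rewrite dprodB dprodM dprod1 mulfV // subrr.
have dB : zmod_morphism ((fun x j => i j x) : F -> P).
  by move=> x y; apply: functional_extensionality_dep => j; rewrite rmorphB.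
have dM : monoid_morphism ((fun x j => i j x) : F -> P).
  split=> [|x y]; apply: functional_extensionality_dep => j.
    by rewrite rmorph1.
  by rewrite rmorphM.
pose diag := mk_rmorphism dB dM.
exists M, (pi \o diag) => p.
have [->|p0] := eqVneq p 0.
  by exists [::]; rewrite map_poly0 lead_coef0 rmorph0 scale0r.
pose n := (size p).-1.
(* The roots are numbered by the same [n] indices in every factor, so that each number defines an
   element [R k] of the product. *)
have rsP j : exists s : seq (E j), p %| val j ->
    map_poly (i j) p = i j (lead_coef p) *: \prod_(k < n) ('X - (s`_k)%:P).
  have [pj|] := boolP (p %| val j); last by exists [::].
  have [rs Dp] := splits_in_dvd (valP j) pj (iP j).
  exists rs => _; rewrite {1}Dp (big_nth 0) big_mkord; congr (_ *: _).
  suff -> : size rs = n by [].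
  have := congr1 (fun p : {poly _} => size p) Dp.
  rewrite size_map_poly size_scale ?fmorph_eq0 ?lead_coef_eq0 //.
  by rewrite size_prod_XsubC /n => ->.
pose rs j := projT1 (cid (rsP j)).
pose R (k : 'I_n) : P := fun j => (rs j)`_k.
exists [seq pi (R k) | k <- enum 'I_n].
rewrite big_map big_enum map_poly_comp /=.
(* The defect of the factorisation: its coefficients vanish in every factor indexed by a multiple of
   [p], hence in the ultraproduct. *)
pose G : {poly P} := map_poly diag p - diag (lead_coef p) *: \prod_(k < n) ('X - (R k)%:P).
suff G0 : map_poly pi G = 0.
  apply/eqP; rewrite -subr_eq0 -{}G0 rmorphB /= map_polyZ rmorph_prod /=.
  apply/eqP; congr (_ - _ *: _); apply: eq_bigr => k _.
  by rewrite map_polyXsubC.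
apply/polyP => m; rewrite coef_map coef0 /=; apply/pi0.
apply: BU; exists (mkJ _ p0) => j /= /(projT2 (cid (rsP j))) Dp.
have eB : zmod_morphism ((fun x => x j) : P -> E j) by [].
have eM : monoid_morphism ((fun x => x j) : P -> E j) by [].
pose ev := mk_rmorphism eB eM.
have G0 : map_poly ev G = 0.
  rewrite /G rmorphB.
  rewrite [X in _ - X](map_polyZ ev) rmorph_prod.
  rewrite [X in X - _](_ : _ = map_poly (i j) p); last first.
    by apply/polyP => k; rewrite [LHS](coef_map ev) (coef_map diag) [RHS]coef_map.
  rewrite {1}Dp; apply/eqP; rewrite subr_eq0; apply/eqP; congr (_ *: _).
  by apply: eq_bigr => k _; rewrite [RHS](map_polyXsubC ev).
by have := congr1 (fun g : {poly _} => g`_m) G0; rewrite coef_map coef0.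
Qed.
End SplittingUltraproduct.

(** * Algebraic closures and their automorphisms *)

Section AlgebraicElements.
Variables (F M : fieldType) (i : {rmorphism F -> M}).

Definition alg_pred : {pred M} := fun x => `[< algebraicOver i x >].

Fact alg_pred_divring : divring_closed alg_pred.
Proof.
split; first by apply/asboolP; exact: algebraic1.
  by move=> x y /asboolP ax /asboolP ay; apply/asboolP; exact: algebraic_sub.
by move=> x y /asboolP ax /asboolP ay; apply/asboolP; exact: algebraic_div.
Qed.

HB.instance Definition _ := GRing.isDivringClosed.Build M alg_pred alg_pred_divring.

Record alg_elt : Type := AlgElt { alg_val :> M; _ : alg_pred alg_val }.
HB.instance Definition _ := [isSub for alg_val].
HB.instance Definition _ := [Choice of alg_elt by <:].
HB.instance Definition _ := [SubChoice_isSubIntegralDomain of alg_elt by <:].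
HB.instance Definition _ := [SubIntegralDomain_isSubField of alg_elt by <:].

Fact alg_inj_proof x : alg_pred (i x).
Proof. by apply/asboolP; exact: algebraic_id. Qed.
Let inj x : alg_elt := AlgElt (alg_inj_proof x).
Fact alg_injB : zmod_morphism inj.
Proof. by move=> x y; apply: val_inj; rewrite /= rmorphB. Qed.
Fact alg_injM : monoid_morphism inj.
Proof. by split=> [|x y]; apply: val_inj; rewrite /= ?rmorph1 ?rmorphM. Qed.
Definition alg_inj : {rmorphism F -> alg_elt} := mk_rmorphism alg_injB alg_injM.

Fact alg_valB : zmod_morphism alg_val. Proof. by []. Qed.
Fact alg_valM : monoid_morphism alg_val. Proof. by []. Qed.
Definition alg_out : {rmorphism alg_elt -> M} := mk_rmorphism alg_valB alg_valM.

Lemma alg_elt_algebraic x : algebraicOver alg_inj x.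
Proof.
have /asboolP[p p0 rp] : alg_pred x by case: x.
exists p => //; rewrite -(fmorph_root alg_out) -map_poly_comp.
by rewrite (eq_map_poly (g := i)).
Qed.

Hypothesis splits : forall p : {poly F}, splits_in i p.

Lemma alg_elt_splits p : splits_in alg_inj p.
Proof.
have [->|p0] := eqVneq p 0.
  by exists [::]; rewrite map_poly0 lead_coef0 rmorph0 scale0r.
have [rs Dp] := splits p.
have rsP (x : M) : exists y : alg_elt, x \in rs -> alg_val y = x.
  have [xrs|] := boolP (x \in rs); last by exists 0.
  have ax : alg_pred x.
    apply/asboolP; exists p => //; rewrite Dp rootZ ?fmorph_eq0 ?lead_coef_eq0 //.
    by rewrite root_prod_XsubC.
  by exists (AlgElt ax).
pose f x := projT1 (cid (rsP x)).
exists (map f rs); apply: (@map_poly_inj _ _ alg_out).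
rewrite -map_poly_comp (eq_map_poly (g := i)) // {}Dp.
rewrite [RHS]map_polyZ; congr (_ *: _).
rewrite [RHS](rmorph_prod (map_poly alg_out)) big_map; apply: eq_big_seq => x xrs.
rewrite [RHS](map_polyXsubC alg_out); congr ('X - _%:P); symmetry; exact: (projT2 (cid (rsP x))).
Qed.

(** A root taken in some extension is algebraic over [F] by transitivity. It is thus a root of a
    polynomial over [F], which splits among the algebraic elements, so the root lies there. *)
Lemma alg_elt_closed : GRing.closed_field_axiom alg_elt.
Proof.
move=> n P n0.
pose p : {poly alg_elt} := 'X^n - \poly_(k < n) P k.
have sp : size p = n.+1.
  rewrite size_polyDl size_polyXn // size_polyN.
  by rewrite ltnS size_poly.
have p0 : p != 0 by rewrite -size_poly_gt0 sp.
have [M' [j [r rr]]] : exists (M' : fieldType) (j : {rmorphism alg_elt -> M'})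
    (r : M'), root (map_poly j p) r.
  by apply: root_extension; rewrite sp.
have [q q0 rq] : algebraicOver (j \o alg_inj : {rmorphism F -> M'}) r.
  apply/integral_algebraic; apply: integral_root rr _; first by rewrite map_poly_eq0.
  move=> _ /(nthP 0)[k _ <-]; rewrite coef_map; apply: integral_rmorph.
  by apply/integral_algebraic; exact: alg_elt_algebraic.
have [y Dr _] := splits_in_root q0 (alg_elt_splits q) rq.
exists y; move: rr; rewrite Dr fmorph_root /root /p hornerD hornerN hornerXn horner_poly.
by rewrite subr_eq0 => /eqP.
Qed.
End AlgebraicElements.

Lemma algebraic_closure_exists (F : fieldType) : inhabited (algebraic_closure F).
Proof.
have [M [i Hi]] := split_all F.
pose L : closedFieldType := HB.pack_for closedFieldType (alg_elt i)
  (Field_isAlgClosed.Build (alg_elt i) (alg_elt_closed Hi)).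
by constructor; exists L (alg_inj i) => x; exact: alg_elt_algebraic.
Qed.

(** * Extension of embeddings and Galois descent *)

Lemma factor_hom (R S T : nzRingType) (pi : {rmorphism R -> S})
    (h : {rmorphism R -> T}) :
  (forall y, exists x, pi x = y) -> (forall x, pi x = 0 -> h x = 0) ->
  exists h' : {rmorphism S -> T}, forall x, h' (pi x) = h x.
Proof.
move=> sur ker.
pose s y := projT1 (cid (sur y)).
have sK y : pi (s y) = y := projT2 (cid (sur y)).
have hs x y : pi x = pi y -> h x = h y.
  by move=> e; apply/eqP; rewrite -subr_eq0 -rmorphB ker // rmorphB e subrr.
have hB : zmod_morphism (h \o s).
  by move=> x y; rewrite /= -rmorphB; apply: hs; rewrite rmorphB !sK.
have hM : monoid_morphism (h \o s).
  split=> [|x y] /=; first by rewrite -(rmorph1 h); apply: hs; rewrite sK rmorph1.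
  by rewrite -rmorphM; apply: hs; rewrite rmorphM !sK.
exists (mk_rmorphism hB hM) => x /=; apply: hs; exact: sK.
Qed.

(** [F1] is [F[X]/(p)] for the polynomial [p] of least size that vanishes at [a]. Keeping the
    quotient map [pi] in view lets any other root of [p] define an embedding of [F1]. *)
Lemma simple_extension (F E : fieldType) (j : {rmorphism F -> E}) (a : E) :
  algebraicOver j a ->
  exists (p : {poly F}) (F1 : fieldType) (pi : {rmorphism {poly F} -> F1})
    (j1 : {rmorphism F1 -> E}),
  [/\ irreducible_poly p, forall y, exists q, pi q = y,
      forall q, pi q = 0 <-> p %| q &
      forall q, j1 (pi q) = (map_poly j q).[a]].
Proof.
move=> alg_a.
have : exists n, `[< exists p : {poly F}, [/\ p != 0, root (map_poly j p) a & size p = n] >].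
  by case: alg_a => p p0 rp; exists (size p); apply/asboolP; exists p.
case/ex_minnP => n /asboolP[p [p0 rp <-]] min_p {n}.
have minP q : root (map_poly j q) a <-> p %| q.
  split; last by move=> pq; move: rp; rewrite -!dvdp_XsubCl => /dvdp_trans; apply; rewrite dvdp_map.
  move=> rq; apply: contraT => npq.
  have /min_p : `[< exists p' : {poly F}, [/\ p' != 0, root (map_poly j p') a & size p' = size (q %% p)] >].
    apply/asboolP; exists (q %% p); split=> //.
    move: rq; rewrite {1}(divp_eq q p) rmorphD rmorphM rootE hornerD hornerM.
    by rewrite (rootP rp) mulr0 add0r.
  by rewrite leqNgt ltn_modp p0.
have irr : irreducible_poly p.
  split=> [|d sd dp].
    rewrite ltn_neqAle size_poly_gt0 p0 andbT eq_sym.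
    apply: contraL rp => /size_poly1P[c c0 ->].
    by rewrite map_polyC rootC fmorph_eq0.
  have De := divpK dp.
  have : root (map_poly j (p %/ d * d)) a by rewrite De.
  rewrite rmorphM rootM => /orP[] /minP pd; last by rewrite /eqp dp pd.
  have e0 : p %/ d != 0 by apply: contraNneq p0 => e0; rewrite -De e0 mul0r.
  have d0 : d != 0 by apply: contraNneq p0 => d0; rewrite -De d0 mulr0.
  have := dvdp_leq e0 pd; rewrite -{1}De size_mul // => le1.
  have : (0 < size (p %/ d)%R)%N by rewrite size_poly_gt0.
  have : (0 < size d)%N by rewrite size_poly_gt0.
  by move: sd le1 => /eqP; lia.
have [||||| F1 [pi [pi0 sur]]] := @residue_fieldP {poly F} (fun q => p %| q).
- exact: dvdp0.
- by rewrite dvdp1 => /eqP s1; case: irr; rewrite s1.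
- by move=> x y px py; exact: dvdp_sub.
- by move=> x y; exact: dvdp_mull.
- move=> x /negP; rewrite -(irreducible_poly_coprime _ irr) coprimep_sym.
  move=> /Bezout_eq1_coprimepP[[u v] /= e]; exists u.
  have -> : x * u - 1 = (- v) * p by rewrite -e; ring.
  exact: dvdp_mulIr.
pose h : {rmorphism {poly F} -> E} := horner_eval a \o map_poly j.
have [|j1 Hj1] := factor_hom (h := h) sur.
  by move=> q /pi0 /minP /rootP.
by exists p, F1, pi, j1; split.
Qed.

Lemma extend_step (F E O : fieldType) (j : {rmorphism F -> E})
    (phi : {rmorphism F -> O}) (p : {poly F}) (F1 : fieldType)
    (pi : {rmorphism {poly F} -> F1}) (w : O) :
  (forall y, exists q, pi q = y) -> (forall q, pi q = 0 <-> p %| q) ->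
  root (map_poly phi p) w ->
  exists phi1 : {rmorphism F1 -> O}, forall q, phi1 (pi q) = (map_poly phi q).[w].
Proof.
move=> sur pi0 rw.
pose h : {rmorphism {poly F} -> O} := horner_eval w \o map_poly phi.
have [|phi1 H] := factor_hom (h := h) sur; last by exists phi1.
move=> q /pi0 pq; apply/rootP; move: rw; rewrite -!dvdp_XsubCl => /dvdp_trans.
by apply; rewrite dvdp_map.
Qed.

(** The elements of [s] are adjoined one at a time; each new generator is sent to a root in [O] of
    the image of its minimal polynomial. *)
Lemma finite_extension (F E : fieldType) (O : closedFieldType)
    (j : {rmorphism F -> E}) (phi : {rmorphism F -> O}) (s : seq E) :
  (forall a, algebraicOver j a) ->
  exists (F1 : fieldType) (k : {rmorphism F -> F1}) (j1 : {rmorphism F1 -> E})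
    (phi1 : {rmorphism F1 -> O}),
  [/\ forall x, j1 (k x) = j x, forall x, phi1 (k x) = phi x &
      forall a, a \in s -> exists b, j1 b = a].
Proof.
move=> alg; elim: s => [|a s [F1 [k [j1 [phi1 [jk phik ims]]]]]].
  by exists F, idfun, j, phi; split.
have alg1 : algebraicOver j1 a.
  have [p p0 rp] := alg a; exists (map_poly k p); first by rewrite map_poly_eq0.
  by rewrite -map_poly_comp (eq_map_poly (g := j)).
have [p [F2 [pi [j2 [irr sur pi0 Hj2]]]]] := simple_extension alg1.
have [w rw] : exists w, root (map_poly phi1 p) w.
  by apply/closed_rootP; rewrite size_map_poly; case: irr => p1 _; rewrite neq_ltn p1 orbT.
have [phi2 Hphi2] := extend_step j1 sur pi0 rw.
exists F2, (pi \o polyC \o k : {rmorphism F -> F2}), j2, phi2; split=> [x|x|b].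
- by rewrite /= Hj2 map_polyC hornerC; exact: jk.
- by rewrite /= Hphi2 map_polyC hornerC; exact: phik.
rewrite inE => /orP[/eqP ->|/ims[c <-]].
  by exists (pi 'X); rewrite Hj2 map_polyX hornerX.
by exists (pi c%:P); rewrite Hj2 map_polyC hornerC.
Qed.

Lemma ultra_pigeonhole (T : Type) (V : eqType) (U : set_system T)
    (f : T -> V) (vs : seq V) : UltraFilter U ->
  U [set t | f t \in vs]%classic -> exists v, U [set t | f t = v]%classic.
Proof.
move=> FU; elim: vs => [|v vs IH].
  move=> H; exfalso; apply: (@filter_not_empty _ U _).
  by apply: filterS H => t /=; rewrite in_nil.
move=> H; have [|H'] := in_ultra_setVsetC [set t | f t = v]%classic FU.
  by exists v.
apply: IH; apply: filterS2 H H' => t /=.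
by rewrite inE => /orP[/eqP|].
Qed.

(** Every finite list [s] admits a partial embedding [g s]. For lists containing [a], the value
    [g s a] is a root of one fixed polynomial, so an ultrafilter on lists selects a single value.
    The limit is a morphism because each ring identity involves finitely many elements and so holds
    in some [g s]. *)
Theorem extend_embedding (F E : fieldType) (O : closedFieldType)
    (j : {rmorphism F -> E}) (phi : {rmorphism F -> O}) :
  (forall a, algebraicOver j a) ->
  exists psi : {rmorphism E -> O}, forall x, psi (j x) = phi x.
Proof.
move=> alg.
have fin (s : seq E) : exists g : E -> O, exists (F1 : fieldType)
    (k : {rmorphism F -> F1}) (j1 : {rmorphism F1 -> E})
    (phi1 : {rmorphism F1 -> O}),
  [/\ forall x, j1 (k x) = j x, forall x, phi1 (k x) = phi x,
      forall a, a \in s -> exists b, j1 b = a & forall b, g (j1 b) = phi1 b].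
  have [F1 [k [j1 [phi1 [jk phik ims]]]]] := finite_extension phi s alg.
  (* Outside the image of [j1] the preimage defaults to 0; only lists that contain the argument will
     count. *)
  have inv a : exists b, forall c, j1 c = a -> b = c.
    have [[c <-]|nc] := pselect (exists c, j1 c = a).
      by exists c => c' /fmorph_inj.
    by exists 0 => c jc; case: nc; exists c.
  exists (fun a => phi1 (projT1 (cid (inv a)))), F1, k, j1, phi1; split=> // b.
  by case: cid => c /= /(_ b erefl) ->.
pose g s := projT1 (cid (fin s)).
have gP s := projT2 (cid (fin s)).
pose B : set (set (seq E)) :=
  [set A : set (seq E) | exists s0 : seq E, forall s : seq E, {subset s0 <= s} -> A s]%classic.
have FB : ProperFilter B.
  split=> [[s /(_ s)]|]; first by apply.
  split.
  - by exists [::].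
  - move=> A A' [s sA] [s' sA']; exists (s ++ s') => t st; split.
      by apply: sA => x xs; apply: st; rewrite mem_cat xs.
    by apply: sA' => x xs; apply: st; rewrite mem_cat xs orbT.
  - by move=> A A' AA' [s sA]; exists s => t /sA /AA'.
have [U [FU BU]] := ultraFilterLemma FB.
have lim a : exists v, U [set s | g s a = v]%classic.
  have [p p0 rp] := alg a.
  have [rs Dp] := closed_field_poly_normal (map_poly phi p).
  apply: (@ultra_pigeonhole _ _ _ _ rs); apply: BU.
  exists [:: a] => s /(_ a (mem_head _ _)) as_.
  have [F1 [k [j1 [phi1 [jk phik /(_ a as_)[b Db] gb]]]]] := gP s.
  have : root (map_poly phi p) (g s a).
    rewrite -Db /g gb -(eq_map_poly phik) (map_poly_comp phi1 k) fmorph_root.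
    by rewrite -(fmorph_root j1) -map_poly_comp (eq_map_poly jk) Db.
  by rewrite Dp rootZ ?lead_coef_eq0 ?map_poly_eq0 // root_prod_XsubC.
pose psi a := projT1 (cid (lim a)).
have psiP a : U [set s | g s a = psi a]%classic := projT2 (cid (lim a)).
have ev (A : set (seq E)) : U A -> exists s, A s.
  by move=> UA; apply: contrapT => /forallNP nA; apply: (@filter_not_empty _ U _); apply: filterS UA => s /nA.
have cone (s0 : seq E) : U [set s : seq E | {subset s0 <= s}]%classic by apply: BU; exists s0.
have psiB : zmod_morphism psi.
  move=> a b.
  have [s /= [[[ea eb] eab] sub]] := ev _ (filterI (filterI (filterI (psiP a) (psiP b)) (psiP (a - b))) (cone [:: a; b])).
  have [F1 [k [j1 [phi1 [jk phik im gb]]]]] := gP s.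
  have [|a' Da] := im a; first by apply: sub; rewrite !inE eqxx.
  have [|b' Db] := im b; first by apply: sub; rewrite !inE eqxx orbT.
  by rewrite -ea -eb -eab -Da -Db -rmorphB /g !gb rmorphB.
have psiM : monoid_morphism psi.
  split=> [|a b].
    have [s /= e] := ev _ (psiP 1); have [F1 [k [j1 [phi1 [jk phik im gb]]]]] := gP s.
    by rewrite -e -(rmorph1 j1) /g gb rmorph1.
  have [s /= [[[ea eb] eab] sub]] := ev _ (filterI (filterI (filterI (psiP a) (psiP b)) (psiP (a * b))) (cone [:: a; b])).
  have [F1 [k [j1 [phi1 [jk phik im gb]]]]] := gP s.
  have [|a' Da] := im a; first by apply: sub; rewrite !inE eqxx.
  have [|b' Db] := im b; first by apply: sub; rewrite !inE eqxx orbT.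
  by rewrite -ea -eb -eab -Da -Db -rmorphM /g !gb rmorphM.
exists (mk_rmorphism psiB psiM) => x /=.
have [s /= <-] := ev _ (psiP (j x)); have [F1 [k [j1 [phi1 [jk phik im gb]]]]] := gP s.
by rewrite -jk /g gb phik.
Qed.

(* If [a] is not in [F], separability gives it a second conjugate, and an
   embedding sending [a] there extends to an automorphism. *)
Theorem fixed_by_automorphisms (F : fieldType) (E : closedFieldType)
    (j : {rmorphism F -> E}) (a : E) :
  [pchar F] =i pred0 -> (forall x, algebraicOver j x) ->
  (forall s : {rmorphism E -> E}, (forall x, s (j x) = j x) -> s a = a) ->
  exists x, a = j x.
Proof.
move=> ch alg fix_a.
have [p [F1 [pi [j1 [irr sur pi0 Hj1]]]]] := simple_extension (alg a).
have Da : a = j1 (pi 'X) by rewrite Hj1 map_polyX hornerX.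
have rootp w : root (map_poly j p) w -> w = a.
  move=> rw.
  have [phi1 Hphi1] := extend_step j sur pi0 rw.
  have alg1 x : algebraicOver j1 x.
    have [q q0 rq] := alg x; exists (map_poly (pi \o polyC) q).
      by rewrite map_poly_eq0.
    rewrite -map_poly_comp (eq_map_poly (g := j)) // => y.
    by rewrite /= Hj1 map_polyC hornerC.
  have [s Hs] := extend_embedding phi1 alg1.
  rewrite -[RHS](fix_a s); last first.
    move=> x; have -> : j x = j1 (pi x%:P) by rewrite Hj1 map_polyC hornerC.
    by rewrite Hs Hphi1 map_polyC hornerC Hj1 map_polyC hornerC.
  by rewrite Da Hs Hphi1 map_polyX hornerX.
have [rs Dp] := closed_field_poly_normal (map_poly j p).
have p0 : p != 0 by case: irr => p1 _; rewrite -size_poly_gt0 (ltn_trans _ p1).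
have lc0 : j (lead_coef p) != 0 by rewrite fmorph_eq0 lead_coef_eq0.
rewrite lead_coef_map in Dp.
have rsa x : x \in rs -> x = a.
  by move=> xrs; apply: rootp; rewrite Dp rootZ // root_prod_XsubC.
have sp : size p = (size rs).+1.
  by rewrite -(size_map_poly j) Dp size_scale // size_prod_XsubC.
have srs : size rs != 0%N.
  by apply/eqP => s0; case: irr => p1 _; move: p1; rewrite sp s0.
(* All roots equal [a], so the coefficient below the leading one is [- n a] times the leading one,
   with [n] the degree. Dividing by [n], which is nonzero in characteristic 0, puts [a] in [F]. *)
have := congr1 (fun q : {poly E} => q`_(size rs).-1) Dp.
rewrite coef_map coefZ coefPn_prod_XsubC // (eq_big_seq (fun=> a) rsa).
rewrite big_const_seq count_predT iter_addr_0 => e.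
have n0 : ((size rs)%:R : F) != 0 by have /pcharf0P -> := ch.
exists (- (p`_(size rs).-1 / lead_coef p / (size rs)%:R)).
have nE : ((size rs)%:R : E) != 0 by rewrite -(rmorph_nat j) fmorph_eq0.
rewrite rmorphN !fmorph_div e rmorph_nat -[a *+ _]mulr_natr mulrN mulrAC.
by rewrite mulrAC mulNr [_ / j _]mulrAC mulfV // mul1r mulNr mulfK // opprK.
Qed.

(** * Completions of the rationals *)

Definition eventually_nat (P : nat -> Prop) := exists N, forall i, (N <= i)%N -> P i.

Lemma eventually_nat2 (P Q S : nat -> Prop) :
  (forall i, P i -> Q i -> S i) -> eventually_nat P -> eventually_nat Q -> eventually_nat S.
Proof.
move=> PQS [M PM] [N QN]; exists (maxn M N) => i.
by rewrite geq_max => /andP[Mi Ni]; apply: PQS; [exact: PM | exact: QN].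
Qed.

Lemma eventually_nat_ex (P : nat -> Prop) : eventually_nat P -> exists i, P i.
Proof. by move=> [N PN]; exists N; exact: PN. Qed.

Definition tends (u : nat -> R) (r : R) :=
  forall e : R, 0 < e -> eventually_nat (fun i => `|u i - r| < e).

Lemma tends_cauchy (u : nat -> R) :
  (forall e : R, 0 < e -> exists N, forall i j, (N <= i)%N -> (N <= j)%N -> `|u i - u j| < e) ->
  exists r, tends u r.
Proof.
move=> cu; have [|r Hr] := @Rcomplete.R_complete u.
  move=> e /RltP e0; have [N HN] := cu e e0; exists N => i j /ssrnat.leP Ni /ssrnat.leP Nj.
  by apply/RltP; rewrite /Rfunctions.Rdist RabsE RminusE; exact: HN.
exists r => e /RltP e0; have [N HN] := Hr e e0; exists N => i /ssrnat.leP Ni.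
by have /RltP := HN i Ni; rewrite /Rfunctions.Rdist RabsE RminusE.
Qed.

Lemma small_inv (e : R) : 0 < e -> eventually_nat (fun i => i.+1%:R^-1 < e :> R).
Proof.
move=> e0; exists (Num.bound e^-1) => i Ni.
rewrite invf_plt ?posrE // ?ltr0Sn //.
have e1 : 0 <= e^-1 by rewrite invr_ge0 ltW.
by apply: (lt_le_trans (archi_boundP e1)); rewrite ler_nat ltnW.
Qed.

Lemma tends_le (u w : nat -> R) (a b : R) : tends u a -> tends w b ->
  (forall i, u i <= w i) -> a <= b.
Proof.
move=> ua wb uw; rewrite leNgt; apply/negP => ba.
have e0 : 0 < (a - b) / 2 by rewrite divr_gt0 // subr_gt0.
have [i [h1 h2]] := eventually_nat_ex (eventually_nat2 (fun i => @conj _ _) (ua _ e0) (wb _ e0)).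
have := uw i; move: h1 h2; rewrite !ltr_norml => /andP[h1 h2] /andP[h3 h4]; lra.
Qed.

Lemma tendsD (u w : nat -> R) (a b : R) :
  tends u a -> tends w b -> tends (fun i => u i + w i) (a + b).
Proof.
move=> ua wb e e0; have e2 : 0 < e / 2 by rewrite divr_gt0.
apply: eventually_nat2 (ua _ e2) (wb _ e2) => i h1 h2.
have -> : u i + w i - (a + b) = (u i - a) + (w i - b) by ring.
by apply: (le_lt_trans (ler_normD _ _)); rewrite [e]splitr ltrD.
Qed.

Lemma tendsM (u w : nat -> R) (a b : R) :
  tends u a -> tends w b -> tends (fun i => u i * w i) (a * b).
Proof.
move=> ua wb e e0.
pose M := `|a| + `|b| + 1.
have M0 : 0 < M by rewrite /M; have := normr_ge0 a; have := normr_ge0 b; lra.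
pose d := Num.min 1 (e / (2 * M)).
have eM : 0 < e / (2 * M) by rewrite divr_gt0 // mulr_gt0.
have d0 : 0 < d by rewrite lt_min ltr01 eM.
have dM : d * M * 2 <= e.
  have : d <= e / (2 * M) by rewrite ge_min lexx orbT.
  by rewrite ler_pdivlMr ?mulr_gt0 // => h; rewrite -mulrA [M * 2]mulrC.
have d1 : d <= 1 by rewrite ge_min lexx.
apply: eventually_nat2 (ua _ d0) (wb _ d0) => i h1 h2.
have -> : u i * w i - a * b = (u i - a) * (w i - b) + a * (w i - b) + b * (u i - a) by ring.
apply: (le_lt_trans (ler_normD _ _)); apply: (le_lt_trans (lerD (ler_normD _ _) (lexx _))).
rewrite !normrM.
have := normr_ge0 a; have := normr_ge0 b; have := normr_ge0 (u i - a); have := normr_ge0 (w i - b).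
move: h1 h2; move: dM; rewrite /M.
move: `|u i - a| `|w i - b| `|a| `|b| => x y A B dM xd yd y0 x0 B0 A0.
have h1 : x * y <= d * 1 by apply: ler_pM => //; lra.
have h2 : A * y <= A * d by rewrite ler_wpM2l // ltW.
have h3 : B * x <= B * d by rewrite ler_wpM2l // ltW.
nra.
Qed.

Lemma tends_cst (a : R) : tends (fun=> a) a.
Proof. by move=> e e0; exists 0%N => i _; rewrite subrr normr0. Qed.

Section Completion.
Variable v : rat -> R.
Hypothesis v_ge0 : forall x, 0 <= v x.
Hypothesis v_eq0 : forall x, v x = 0 -> x = 0.
Hypothesis v0 : v 0 = 0.
Hypothesis vM : forall x y, v (x * y) = v x * v y.
Hypothesis vD : forall x y, v (x + y) <= v x + v y.

Lemma absval1 : v 1 = 1.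
Proof.
have := vM 1 1; rewrite mul1r => e.
have n0 : v 1 != 0 by apply/eqP => /v_eq0 /eqP; rewrite oner_eq0.
by apply: (mulIf n0); rewrite -e mul1r.
Qed.

Lemma absvalN x : v (- x) = v x.
Proof.
suff e : v (-1) = 1 by rewrite -mulN1r vM e mul1r.
have := vM (-1) (-1); rewrite mulrNN mul1r absval1 => /esym/eqP.
rewrite -expr2 sqrf_eq1 => /orP[/eqP //|/eqP e].
by have := v_ge0 (-1); rewrite e; lra.
Qed.

Lemma absvalB x y : v (x - y) <= v x + v y.
Proof. by apply: (le_trans (vD _ _)); rewrite absvalN. Qed.

Lemma absvalBC x y : v (x - y) = v (y - x).
Proof. by rewrite -absvalN opprB. Qed.

Lemma absval_dist x y : `|v x - v y| <= v (x - y).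
Proof.
rewrite ler_norml; apply/andP; split.
  have := vD (y - x) x; rewrite subrK [v (y - x)]absvalBC; lra.
by have := vD (x - y) y; rewrite subrK; lra.
Qed.

Lemma absvalV x : v x^-1 = (v x)^-1.
Proof.
have [->|x0] := eqVneq x 0; first by rewrite invr0 v0 invr0.
have n0 : v x != 0 by apply: contraNneq x0 => /v_eq0 ->.
by apply: (mulfI n0); rewrite -vM !mulfV // absval1.
Qed.

Definition seqQ : comNzRingType := dprod (fun _ : nat => rat : comNzRingType) 0%N.

Definition cauchy_seq (u : seqQ) := forall e : R, 0 < e ->
  exists N, forall i j, (N <= i)%N -> (N <= j)%N -> v (u i - u j) < e.

Definition null_seq (u : seqQ) := tends (fun i => v (u i)) 0.

Lemma null_seqP (u : seqQ) :
  null_seq u <-> forall e : R, 0 < e -> eventually_nat (fun i => v (u i) < e).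
Proof.
split=> H e e0; have [N HN] := H e e0; exists N => i /HN;
  by rewrite subr0 ger0_norm ?v_ge0.
Qed.

Lemma cauchy_lim u : cauchy_seq u -> exists r, tends (fun i => v (u i)) r.
Proof.
move=> cu; apply: tends_cauchy => e e0; have [N HN] := cu e e0.
by exists N => i j Ni Nj; apply: (le_lt_trans (absval_dist _ _)); exact: HN.
Qed.

Lemma cauchy_bounded u : cauchy_seq u ->
  exists2 M : R, 0 < M & eventually_nat (fun i => v (u i) < M).
Proof.
move=> cu; have [r ur] := cauchy_lim cu; exists (`|r| + 1).
  by have := normr_ge0 r; lra.
have [N HN] := ur 1 ltr01; exists N => i /HN.
by rewrite ltr_norml => /andP[_]; have := ler_norm r; lra.
Qed.

Definition cauchy_pred : {pred seqQ} := fun u => `[< cauchy_seq u >].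

Fact cauchy_subring : subring_closed cauchy_pred.
Proof.
split.
- by apply/asboolP => e e0; exists 0%N => i j _ _; rewrite subrr v0.
- move=> x y /asboolP cx /asboolP cy; apply/asboolP => e e0.
  have e2 : 0 < e / 2 by rewrite divr_gt0.
  have [N HN] := cx _ e2; have [M HM] := cy _ e2; exists (maxn N M) => i j.
  rewrite !geq_max => /andP[Ni Mi] /andP[Nj Mj].
  have -> : (x - y) i - (x - y) j = (x i - x j) - (y i - y j) by rewrite !dprodB; ring.
  by apply: (le_lt_trans (absvalB _ _)); rewrite [e]splitr ltrD ?HN ?HM.
move=> x y /asboolP cx /asboolP cy; apply/asboolP => e e0.
have [A A0 [N1 HA]] := cauchy_bounded cx; have [B B0 [N2 HB]] := cauchy_bounded cy.
have e1 : 0 < e / (2 * A) by rewrite divr_gt0 // mulr_gt0.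
have e2 : 0 < e / (2 * B) by rewrite divr_gt0 // mulr_gt0.
have [N3 H3] := cx _ e2; have [N4 H4] := cy _ e1.
exists (maxn (maxn N1 N2) (maxn N3 N4)) => i j.
rewrite !geq_max => /andP[/andP[i1 i2] /andP[i3 i4]] /andP[/andP[j1 j2] /andP[j3 j4]].
have -> : (x * y) i - (x * y) j = x i * (y i - y j) + y j * (x i - x j) by rewrite !dprodM; ring.
apply: (le_lt_trans (vD _ _)); rewrite !vM.
have h1 : v (x i) * v (y i - y j) < A * (e / (2 * A)).
  by apply: ltr_pM => //; [exact: HA | exact: H4].
have h2 : v (y j) * v (x i - x j) < B * (e / (2 * B)).
  by apply: ltr_pM => //; [exact: HB | exact: H3].
have E1 : A * (e / (2 * A)) = e / 2 by field; rewrite gt_eqF.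
have E2 : B * (e / (2 * B)) = e / 2 by field; rewrite gt_eqF.
by rewrite [e]splitr -{1}E1 -E2 ltrD.
Qed.

HB.instance Definition _ := GRing.isSubringClosed.Build seqQ cauchy_pred cauchy_subring.

Record cauchy_ring : Type := CauchySeq { cseq :> seqQ; _ : cauchy_pred cseq }.
HB.instance Definition _ := [isSub for cseq].
HB.instance Definition _ := [Choice of cauchy_ring by <:].
HB.instance Definition _ := [SubChoice_isSubComNzRing of cauchy_ring by <:].

Lemma cseqP (u : cauchy_ring) : cauchy_seq u.
Proof. by have /asboolP := valP u. Qed.

Lemma cseqB (x y : cauchy_ring) i : cseq (x - y) i = cseq x i - cseq y i. Proof. by []. Qed.
Lemma cseqM (x y : cauchy_ring) i : cseq (x * y) i = cseq x i * cseq y i. Proof. by []. Qed.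
Lemma cseq1 i : cseq 1 i = 1. Proof. by []. Qed.

(** The absolute values converge to some [r > 0], so they eventually exceed [r / 2]. From there on
    the termwise inverse is a true inverse, and it is Cauchy because [1/x - 1/y = (y - x)/(x y)]. *)
Lemma cauchy_inv (u : cauchy_ring) : ~ null_seq u ->
  exists w : cauchy_ring, null_seq (cseq (u * w - 1)).
Proof.
move=> nu; have [r ur] := cauchy_lim (cseqP u).
have r0 : 0 < r.
  have r_ge0 : 0 <= r by apply: tends_le (tends_cst 0) ur _.
  rewrite lt_neqAle r_ge0 andbT; apply/eqP => r0; apply: nu; rewrite /null_seq.
  by rewrite r0.
have r2 : 0 < r / 2 by rewrite divr_gt0.
have [N HN] : eventually_nat (fun i => r / 2 < v (cseq u i)).
  have [N HN] := ur _ r2; exists N => i /HN; rewrite ltr_norml => /andP[h _]; lra.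
have cw : cauchy_seq (fun i => (cseq u i)^-1).
  move=> e e0; have e1 : 0 < e * (r / 2) ^+ 2 by rewrite mulr_gt0 // exprn_gt0.
  have [M HM] := cseqP u e1; exists (maxn N M) => i j.
  rewrite !geq_max => /andP[Ni Mi] /andP[Nj Mj].
  have ui := HN i Ni; have uj := HN j Nj.
  have u0 k : r / 2 < v (cseq u k) -> cseq u k != 0.
    by move=> h; apply: contraTneq h => ->; rewrite v0 -leNgt ltW.
  have -> : (cseq u i)^-1 - (cseq u j)^-1 = (cseq u j - cseq u i) * ((cseq u i)^-1 * (cseq u j)^-1).
    by field; rewrite !u0.
  rewrite !vM !absvalV -invfM ltr_pdivrMr; last by rewrite mulr_gt0 // (lt_trans r2).
  apply: (lt_le_trans (HM j i Mj Mi)); rewrite ler_wpM2l ?(ltW e0) // expr2.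
  by apply: ler_pM; rewrite ltW.
exists (CauchySeq (asboolT cw)); apply/null_seqP => e e0; exists N => i Ni.
rewrite cseqB cseqM cseq1 /= mulfV ?subrr ?v0 //.
by apply: contraTneq (HN i Ni) => ->; rewrite v0 -leNgt ltW.
Qed.

(** [K] is the ring of Cauchy sequences modulo null sequences, and [abs] of a class is the limit of
    the absolute values of its terms. *)
Lemma completion_exists : exists (K : fieldType) (abs : K -> R),
  [/\ (forall x, 0 <= abs x) /\ (forall x, abs x = 0 -> x = 0),
      (forall x y, abs (x * y) = abs x * abs y) /\
        (forall x y, abs (x + y) <= abs x + abs y),
      (forall q : rat, abs (ratr q) = v q),
      (forall (x : K) (e : R), 0 < e -> exists r : rat, abs (x - ratr r) < e) &
      (forall u : nat -> K,
        (forall e : R, 0 < e -> exists N : nat, forall i j : nat,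
          (N <= i)%N -> (N <= j)%N -> abs (u i - u j) < e) ->
        exists l : K, forall e : R, 0 < e -> exists N : nat,
          forall i : nat, (N <= i)%N -> abs (u i - l) < e)].
Proof.
have [||||| K [pi [pi0 sur]]] := @residue_fieldP cauchy_ring (fun u => null_seq u).
- by apply/null_seqP => e e0; exists 0%N => i _; rewrite v0.
- move=> /null_seqP /(_ 1 ltr01) /eventually_nat_ex[i].
  by rewrite cseq1 absval1 ltxx.
- move=> x y /null_seqP nx /null_seqP ny; apply/null_seqP => e e0.
  have e2 : 0 < e / 2 by rewrite divr_gt0.
  apply: eventually_nat2 (nx _ e2) (ny _ e2) => i xi yi; rewrite cseqB.
  by apply: (le_lt_trans (absvalB _ _)); rewrite [e]splitr ltrD.
- move=> x y ny; rewrite /null_seq; have [r xr] := cauchy_lim (cseqP x).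
  have := tendsM xr ny; rewrite mulr0 => H e e0; have [N HN] := H e e0.
  by exists N => i /HN; rewrite cseqM vM.
- exact: cauchy_inv.
have absP (x : K) : exists r, exists2 u, pi u = x & tends (fun i => v (cseq u i)) r.
  have [u Du] := sur x; have [r ur] := cauchy_lim (cseqP u); by exists r, u.
pose abs x := projT1 (cid (absP x)).
(* Any representative computes [abs], since two of them differ by a null sequence. *)
have absE u r : tends (fun i => v (cseq u i)) r -> abs (pi u) = r.
  rewrite /abs; case: cid => r' [w Dw wr'] ur /=.
  have : null_seq (cseq (w - u)) by apply/pi0; rewrite rmorphB Dw subrr.
  move=> n; have h1 := tendsD wr' n; have h2 := tendsD ur n.
  rewrite !addr0 in h1 h2; apply/eqP; rewrite eq_le; apply/andP; split.
    apply: tends_le wr' h2 _ => i; apply: le_trans (vD _ _).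
    by rewrite cseqB addrC subrK.
  apply: tends_le ur h1 _ => i; rewrite cseqB absvalBC.
  by apply: le_trans (vD _ _); rewrite addrC subrK.
have absP' u : tends (fun i => v (cseq u i)) (abs (pi u)).
  by have [r ur] := cauchy_lim (cseqP u); rewrite (absE _ _ ur).
have cc (q : rat) : cauchy_seq (fun=> q).
  by move=> e e0; exists 0%N => i j _ _; rewrite subrr v0.
pose cst q : cauchy_ring := CauchySeq (asboolT (cc q)).
have cstB : zmod_morphism cst by move=> x y; apply: val_inj.
have cstM : monoid_morphism cst by split=> [|x y]; apply: val_inj.
pose phi : {rmorphism rat -> K} := pi \o mk_rmorphism cstB cstM.
(* There is only one morphism from the rationals, so [ratr] is the embedding by constant
   sequences. *)
have ratE' q : ratr q = phi q by rewrite -(fmorph_eq_rat phi).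
have ratE q : ratr q = pi (cst q) by rewrite ratE'.
have absM x y : abs (x * y) = abs x * abs y.
  have [u <-] := sur x; have [w <-] := sur y; rewrite -rmorphM; apply: absE.
  have := tendsM (absP' u) (absP' w) => H e e0; have [N HN] := H e e0.
  by exists N => i /HN; rewrite cseqM vM.
have absD x y : abs (x + y) <= abs x + abs y.
  have [u <-] := sur x; have [w <-] := sur y; rewrite -rmorphD.
  by apply: tends_le (absP' _) (tendsD (absP' u) (absP' w)) _ => i; exact: vD.
have abs_le (u : cauchy_ring) (e : R) : eventually_nat (fun i => v (cseq u i) <= e) -> abs (pi u) <= e.
  move=> [N HN]; rewrite leNgt; apply/negP => h.
  have h0 : 0 < abs (pi u) - e by rewrite subr_gt0.
  have [M HM] := absP' u _ h0.
  have := HM (maxn N M) (leq_maxr _ _); have := HN (maxn N M) (leq_maxl _ _).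
  by rewrite ltr_norml => h1 /andP[h2 _]; move: h1 h2; lra.
have dense (x : K) (e : R) : 0 < e -> exists r : rat, abs (x - ratr r) < e.
  move=> e0; have [u <-] := sur x; have e2 : 0 < e / 2 by rewrite divr_gt0.
  have [N HN] := cseqP u e2; exists (cseq u N); rewrite ratE -rmorphB.
  apply: (@le_lt_trans _ _ (e / 2)); last by lra.
  by apply: abs_le; exists N => i Ni; rewrite cseqB ltW // HN.
exists K, abs; split=> //; last 1 first.
- move=> u cu.
  (* Completeness: replace each [u i] by a rational [r i] at distance below [1/(i+1)]. The sequence
     [r] is Cauchy, and its class is the limit of [u]. *)
  have appr i : exists r : rat, abs (u i - ratr r) < i.+1%:R^-1.
    by apply: dense; rewrite invr_gt0 ltr0Sn.
  pose r i := projT1 (cid (appr i)).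
  have rP i : abs (u i - ratr (r i)) < i.+1%:R^-1 := projT2 (cid (appr i)).
  have absrat q : abs (ratr q) = v q.
    by rewrite ratE; apply: absE; have := tends_cst (v q); apply.
  have absC x y : abs (x - y) = abs (y - x).
    have -> : x - y = ratr (-1) * (y - x) by rewrite ratE' rmorphN1; ring.
    by rewrite absM absrat absvalN absval1 mul1r.
  have cr : cauchy_seq r.
    move=> e e0; have e3 : 0 < e / 3 by rewrite divr_gt0.
    have [N HN] := cu _ e3; have [M HM] := small_inv e3.
    exists (maxn N M) => i j; rewrite !geq_max => /andP[Ni Mi] /andP[Nj Mj].
    rewrite -absrat ratE' rmorphB -!ratE'.
    have -> : ratr (r i) - ratr (r j) = (ratr (r i) - u i) + (u i - u j) + (u j - ratr (r j)).
      by ring.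
    have h1 := lt_trans (rP i) (HM i Mi); have h2 := lt_trans (rP j) (HM j Mj).
    have h3 := HN i j Ni Nj; rewrite absC in h1.
    apply: (le_lt_trans (absD _ _)); have := absD (ratr (r i) - u i) (u i - u j).
    move: h1 h2 h3; lra.
  pose l := pi (CauchySeq (asboolT cr)).
  exists l => e e0; have e2 : 0 < e / 2 by rewrite divr_gt0.
  have e4 : 0 < e / 4 by rewrite divr_gt0.
  have [M HM] := small_inv e2; have [N HN] := cr _ e4.
  exists (maxn N M) => i; rewrite geq_max => /andP[Ni Mi].
  have -> : u i - l = (u i - ratr (r i)) + (ratr (r i) - l) by ring.
  apply: (le_lt_trans (absD _ _)); have h1 := lt_trans (rP i) (HM i Mi).
  suff h2 : abs (ratr (r i) - l) <= e / 4 by move: h1 h2; lra.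
  rewrite ratE -rmorphB; apply: abs_le; exists N => j Nj.
  by rewrite cseqB ltW //; exact: HN.
- split=> x; have [u <-] := sur x.
    by apply: tends_le (tends_cst 0) (absP' u) _.
  by move=> e; apply/pi0; rewrite /null_seq -e.
- move=> q; rewrite ratE; apply: absE. have := tends_cst (v q); apply.
Qed.
End Completion.

(** * The rationals inside fields of characteristic zero *)

Section RatrChar0.
Variable F : fieldType.
Hypothesis ch0 : forall n, (n%:R == 0 :> F) = (n == 0)%N.

Lemma intr_eq0_char0 (z : int) : (z%:~R == 0 :> F) = (z == 0).
Proof.
case: z => n; first by rewrite -pmulrn ch0.
by rewrite NegzE mulrNz oppr_eq0 -pmulrn ch0 oppr_eq0.
Qed.

Lemma ratr_frac (n d : int) : d != 0 ->
  ratr (n%:~R / d%:~R) = n%:~R / d%:~R :> F.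
Proof.
move=> d0; set x := _ / _ : rat.
have dQ : d%:~R != 0 :> rat by rewrite intr_eq0.
have e : numq x * d = n * denq x.
  apply: (@intr_inj rat); rewrite !rmorphM /= numqE /x; field; exact: dQ.
have dx : (denq x)%:~R != 0 :> F by rewrite intr_eq0_char0 denq_neq0.
have d0' : d%:~R != 0 :> F by rewrite intr_eq0_char0.
rewrite /ratr; apply/eqP; rewrite eqr_div // -!rmorphM /=.
by rewrite e.
Qed.

Lemma rat_fracP (x : rat) : exists n d : int, d != 0 /\ x = n%:~R / d%:~R.
Proof. by exists (numq x), (denq x); split; rewrite ?denq_neq0 ?divq_num_den. Qed.

Fact ratr_zmod : zmod_morphism (ratr : rat -> F).
Proof.
move=> x y; have [n [d [d0 ->]]] := rat_fracP x; have [m [e [e0 ->]]] := rat_fracP y.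
have dQ : d%:~R != 0 :> rat by rewrite intr_eq0.
have eQ : e%:~R != 0 :> rat by rewrite intr_eq0.
have dF : d%:~R != 0 :> F by rewrite intr_eq0_char0.
have eF : e%:~R != 0 :> F by rewrite intr_eq0_char0.
have -> : n%:~R / d%:~R - m%:~R / e%:~R = (n * e - m * d)%:~R / (d * e)%:~R :> rat.
  by rewrite !rmorphB !rmorphM /=; field; rewrite dQ eQ.
rewrite !ratr_frac ?mulf_neq0 // !rmorphB !rmorphM /=.
by field; rewrite dF eF.
Qed.

Fact ratr_monoid : monoid_morphism (ratr : rat -> F).
Proof.
split=> [|x y]; first by rewrite /ratr /= divr1.
have [n [d [d0 ->]]] := rat_fracP x; have [m [e [e0 ->]]] := rat_fracP y.
have dQ : d%:~R != 0 :> rat by rewrite intr_eq0.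
have eQ : e%:~R != 0 :> rat by rewrite intr_eq0.
have dF : d%:~R != 0 :> F by rewrite intr_eq0_char0.
have eF : e%:~R != 0 :> F by rewrite intr_eq0_char0.
have -> : (n%:~R / d%:~R) * (m%:~R / e%:~R) = (n * m)%:~R / (d * e)%:~R :> rat.
  by rewrite !rmorphM /=; field; rewrite dQ eQ.
rewrite !ratr_frac ?mulf_neq0 // !rmorphM /=.
by field; rewrite dF eF.
Qed.

(** This makes [ratr] a morphism into completions and their algebraic closures, which carry no
    order. *)
Definition ratr_char0 : {rmorphism rat -> F} := mk_rmorphism ratr_zmod ratr_monoid.
End RatrChar0.

(** * The p-adic absolute value on the rationals *)

Section PadicAbs.
Variable p : nat.
Hypothesis p_pr : prime p.

Lemma padic0 : padic_abs p 0 = 0. Proof. by rewrite /padic_abs eqxx. Qed.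

Let P0 : (p%:R : R) != 0. Proof. by rewrite pnatr_eq0 -lt0n prime_gt0. Qed.
Let P1 : 1 < (p%:R : R). Proof. by rewrite ltr1n prime_gt1. Qed.
(** [padic_abs] reads the reduced fraction, whereas products and sums are computed on unreduced
    ones. *)
Lemma padic_frac (n d : int) : n != 0 -> d != 0 ->
  padic_abs p (n%:~R / d%:~R) = p%:R ^+ logn p `|d|%N / p%:R ^+ logn p `|n|%N.
Proof.
move=> n0 d0; set x := _ / _ : rat.
have nQ : n%:~R != 0 :> rat by rewrite intr_eq0.
have dQ : d%:~R != 0 :> rat by rewrite intr_eq0.
have x0 : x != 0 by rewrite mulf_neq0 // invr_eq0.
have e : numq x * d = n * denq x.
  apply: (@intr_inj rat); rewrite !rmorphM /= numqE /x; field; exact: dQ.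
rewrite /padic_abs (negPf x0).
have nx0 : numq x != 0 by rewrite numq_eq0.
have := congr1 (fun z : int => logn p `|z|%N) e.
rewrite !abszM !lognM ?absz_gt0 ?denq_neq0 // => El.
apply/eqP; rewrite eqr_div ?expf_neq0 // -!exprD; apply/eqP; congr (_ ^+ _); lia.
Qed.

Lemma padicM x y : padic_abs p (x * y) = padic_abs p x * padic_abs p y.
Proof.
have [->|x0] := eqVneq x 0; first by rewrite mul0r padic0 mul0r.
have [->|y0] := eqVneq y 0; first by rewrite mulr0 padic0 mulr0.
have [n [d [d0 Dx]]] := rat_fracP x; have [m [e [e0 Dy]]] := rat_fracP y.
have n0 : n != 0 by apply: contraNneq x0 => z; rewrite Dx z mul0r.
have m0 : m != 0 by apply: contraNneq y0 => z; rewrite Dy z mul0r.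
have dQ : d%:~R != 0 :> rat by rewrite intr_eq0.
have eQ : e%:~R != 0 :> rat by rewrite intr_eq0.
have -> : x * y = (n * m)%:~R / (d * e)%:~R :> rat.
  by rewrite Dx Dy !rmorphM /=; field; rewrite dQ eQ.
rewrite Dx Dy !padic_frac ?mulf_neq0 // !abszM !lognM ?absz_gt0 // !exprD.
by field; rewrite !expf_neq0.
Qed.

Lemma padic_ge0 x : 0 <= padic_abs p x.
Proof.
rewrite /padic_abs; case: ifP => // _.
by rewrite divr_ge0 // exprn_ge0 // ler0n.
Qed.

Lemma padic_eq0 x : padic_abs p x = 0 -> x = 0.
Proof.
rewrite /padic_abs; case: eqP => // _ /eqP.
by rewrite mulf_eq0 invr_eq0 !expf_eq0 (negPf P0) !andbF.
Qed.

Lemma padic_int (n : int) : n != 0 -> padic_abs p n%:~R = p%:R ^- logn p `|n|%N.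
Proof. by move=> n0; rewrite -[n%:~R]divr1 (@padic_frac n 1) // logn1 expr0 mul1r. Qed.

Lemma padic_int_dvd (n : int) k : (padic_abs p n%:~R <= p%:R ^- k) = (p ^ k %| `|n|)%N.
Proof.
have [->|n0] := eqVneq n 0.
  by rewrite mulr0z padic0 dvdn0 invr_ge0 exprn_ge0 // ler0n.
rewrite padic_int // lef_pV2 ?posrE ?exprn_gt0 ?ltr0n ?prime_gt0 //.
by rewrite ler_eXn2l // -pfactor_dvdn // absz_gt0.
Qed.

(** Over a common denominator the claim concerns two integers, where it says that a power of [p]
    dividing both divides their sum. *)
Lemma padicD_max x y :
  padic_abs p (x + y) <= Num.max (padic_abs p x) (padic_abs p y).
Proof.
have [n [d [d0 Dx]]] := rat_fracP x; have [m [e [e0 Dy]]] := rat_fracP y.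
have dQ : d%:~R != 0 :> rat by rewrite intr_eq0.
have eQ : e%:~R != 0 :> rat by rewrite intr_eq0.
pose c : rat := (d * e)%:~R.
have cQ : c != 0 by rewrite intr_eq0 mulf_neq0.
pose a := n * e; pose b := m * d.
have Ex : x = a%:~R * c^-1 by rewrite Dx /a /c !rmorphM /=; field; rewrite dQ eQ.
have Ey : y = b%:~R * c^-1 by rewrite Dy /b /c !rmorphM /=; field; rewrite dQ eQ.
rewrite Ex Ey -mulrDl !padicM -rmorphD /= -maxr_pMl ?padic_ge0 //.
rewrite ler_wpM2r ?padic_ge0 //.
have main k : padic_abs p a%:~R <= p%:R ^- k -> padic_abs p b%:~R <= p%:R ^- k ->
    padic_abs p (a + b)%:~R <= p%:R ^- k.
  have dv (z : int) : (p ^ k %| `|z|)%N = ((p ^ k)%:Z %| z)%Z by rewrite dvdzE.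
  by rewrite !padic_int_dvd !dv; exact: rpredD.
have key (z w : int) : z + w = a + b -> z != 0 ->
    padic_abs p a%:~R <= padic_abs p z%:~R ->
    padic_abs p b%:~R <= padic_abs p z%:~R ->
    padic_abs p (a + b)%:~R <= padic_abs p z%:~R.
  by move=> _ z0; rewrite [padic_abs p z%:~R]padic_int //; exact: main.
rewrite le_max; have [a0|a0] := eqVneq a 0; first by rewrite a0 add0r lexx orbT.
have [b0|b0] := eqVneq b 0; first by rewrite b0 addr0 lexx.
have [le|/ltW le] := leP (padic_abs p b%:~R) (padic_abs p a%:~R).
  by rewrite (key a b).
by apply/orP; right; rewrite (key b a) // addrC.
Qed.

Lemma padicD x y : padic_abs p (x + y) <= padic_abs p x + padic_abs p y.
Proof.
apply: le_trans (padicD_max _ _) _; rewrite ge_max.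
by rewrite lerDl lerDr !padic_ge0.
Qed.
End PadicAbs.

Lemma padic_completion_exists (p : nat) (p_pr : prime p) :
  inhabited (completion (Defs.Finite p_pr)).
Proof.
have [K [abs [[h1 h2] [h3 h4] h5 h6 h7]]] := completion_exists
  (padic_ge0 p) (padic_eq0 p_pr) (padic0 p) (padicM p_pr) (padicD p_pr).
by constructor; exact: (@Completion (Defs.Finite p_pr) K abs).
Qed.

Lemma place_abs_eq0 (v : place) x : place_abs v x = 0 -> x = 0.
Proof.
case: v => [|p p_pr] /=; last exact: padic_eq0.
by move/eqP; rewrite normr_eq0 fmorph_eq0 => /eqP.
Qed.

Section CompletionChar0.
Variables (v : place) (K : completion v).

(** The axiom [compl_abs_rat] fixes the absolute value of [n] in [K], so a nonzero [n] cannot vanish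
    there. *)
Lemma completion_char0 n : (n%:R == 0 :> K) = (n == 0)%N.
Proof.
apply/eqP/eqP => [n0|-> //].
have r0 : (0 : K) = ratr 0 by rewrite /ratr mul0r.
have rn : (n%:R : K) = ratr n%:R by rewrite ratr_nat.
have : place_abs v n%:R = 0.
  rewrite -(compl_abs_rat K) -rn n0 r0 compl_abs_rat.
  by case: (v) => [|p p_pr] /=; rewrite ?padic0 // rmorph0 normr0.
by move/place_abs_eq0/eqP; rewrite pnatr_eq0 => /eqP.
Qed.

Lemma completion_pchar : [pchar K] =i pred0.
Proof. by apply/pcharf0P => n; exact: completion_char0. Qed.

Definition rat_compl : {rmorphism rat -> K} := ratr_char0 completion_char0.
Lemma rat_complE x : rat_compl x = ratr x. Proof. by []. Qed.
End CompletionChar0.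

Lemma algC_algebraic (x : algC) : algebraicOver (ratr : rat -> algC) x.
Proof.
have [p [Dp mon_p _]] := minCpolyP x; exists p; first exact: monic_neq0.
by rewrite -Dp root_minCpoly.
Qed.

Lemma embed_algC (O : closedFieldType) (phi : {rmorphism rat -> O}) :
  inhabited {rmorphism algC -> O}.
Proof.
by have [psi _] := extend_embedding phi algC_algebraic; constructor.
Qed.

Lemma algC_fixed (x : algC) :
  (forall s : {rmorphism algC -> algC}, s x = x) -> exists r : rat, x = ratr r.
Proof.
move=> fx; have [||r Dr] := fixed_by_automorphisms _ algC_algebraic (a := x).
- by apply/pcharf0P => n; rewrite pnatr_eq0.
- by move=> s _; exact: fx.
by exists r.
Qed.

Lemma local_model (p : nat) (p_pr : prime p) :
  exists (K : completion (Defs.Finite p_pr)) (L : algebraic_closure K),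
    inhabited {rmorphism algC -> L}.
Proof.
have [K] := padic_completion_exists p_pr; exists K.
have [L] := algebraic_closure_exists K; exists L.
exact: (embed_algC (aclos_inj L \o rat_compl K : {rmorphism rat -> L})).
Qed.

(** * Halving points on a split cubic *)

Definition cubic (F : fieldType) (a b c : F) : {poly F} :=
  ('X - a%:P) * ('X - b%:P) * ('X - c%:P).

Lemma cubicC (F : fieldType) (a b c : F) : cubic a b c = cubic b a c.
Proof. by rewrite /cubic [X in X * _]mulrC. Qed.

Lemma cubicCA (F : fieldType) (a b c : F) : cubic a b c = cubic c a b.
Proof. by rewrite /cubic mulrC mulrA. Qed.

Section Halving.
Variable F : fieldType.
Hypothesis two_neq0 : (2 : F) != 0.
Implicit Types a b c x y w : F.

Lemma cubic_horner a b c x : (cubic a b c).[x] = (x - a) * (x - b) * (x - c).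
Proof. by rewrite /cubic !hornerE. Qed.

Lemma cubic_coef2 a b c : (cubic a b c)`_2 = - (a + b + c).
Proof.
have -> : cubic a b c = 'X^3 - (a + b + c) *: 'X^2 + (a * b + a * c + b * c) *: 'X - (a * b * c)%:P.
  rewrite /cubic -!mul_polyC !polyCD !polyCM.
  by move: (a%:P) (b%:P) (c%:P) ('X : {poly F}) => A B C X; ring.
rewrite !(coefD, coefB, coefN, coefZ, coefXn, coefX, coefC) /=; ring.
Qed.

Lemma cubic_deriv a b c x :
  (cubic a b c)^`().[x] = (x - b) * (x - c) + (x - a) * (x - c) + (x - a) * (x - b).
Proof.
by rewrite /cubic !derivM !derivXsubC !(mul1r, mulr1) !(hornerM, hornerD, hornerN, hornerX, hornerC); ring.
Qed.

(* Square root of [x(2P) - a] for [P = (x, y)]. *)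
Definition half_root a b c x y : F := ((x - a) ^+ 2 - (a - b) * (a - c)) / (2 * y).

(** Both sides are the abscissa of [2P]. *)
Lemma half_root_sqr a b c x y : y != 0 -> y ^+ 2 = (cubic a b c).[x] ->
  half_root a b c x y ^+ 2 + a = half_root b a c x y ^+ 2 + b.
Proof.
rewrite cubic_horner /half_root => y0 e.
have e2 : (x - a) * (x - b) * (x - c) != 0 by rewrite -e expf_neq0.
have four : (4 : F) != 0 by rewrite (_ : 4 = 2 * 2) ?mulf_neq0 //; ring.
have h (u : F) : (u / (2 * y)) ^+ 2 = u ^+ 2 / (4 * ((x - a) * (x - b) * (x - c))).
  by rewrite -e; field; rewrite y0 four two_neq0.
rewrite !h; field.
rewrite four; by move: e2; rewrite !mulf_eq0 !negb_or => /andP[/andP[-> ->] ->].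
Qed.

Lemma half_rootC a b c x y : half_root a b c x y = half_root a c b x y.
Proof. by rewrite /half_root [(a - b) * _]mulrC. Qed.

Lemma point_sub_eq_infty (f : {poly F}) (P Q : ecpoint F) :
  point_sub f P Q = Infty -> P = Q.
Proof.
rewrite /point_sub; case: P => [|x1 y1]; case: Q => [|x2 y2] //=.
by rewrite opprK; case: eqP => [->|_] //=; case: eqP => [->|].
Qed.

Lemma point_sub_self (f : {poly F}) (P : ecpoint F) : point_sub f P P = Infty.
Proof. by rewrite /point_sub; case: P => [|x y] //=; rewrite opprK !eqxx. Qed.

(** Translating [P] by a 2-torsion point keeps [2P], so each half root changes at most by a sign.
    The sign is the Weil pairing: trivial at [a] itself, -1 at the other roots. *)
Lemma half_root_translate a b c x1 y1 x2 y2 :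
  b != a -> c != a ->
  y1 != 0 -> y2 != 0 ->
  y1 ^+ 2 = (cubic a b c).[x1] -> y2 ^+ 2 = (cubic a b c).[x2] ->
  point_sub (cubic a b c) (Aff x1 y1) (Aff x2 y2) = Aff a 0 ->
  half_root a b c x1 y1 = half_root a b c x2 y2 /\
  half_root b a c x1 y1 = - half_root b a c x2 y2.
Proof.
move=> ab ac y10 y20; rewrite !cubic_horner => e1 e2.
rewrite /point_sub /= opprK cubic_coef2 cubic_deriv.
pose u1 := x1 - a; pose u2 := x2 - a; pose B := b - a; pose C := c - a.
have E1 : y1 ^+ 2 = u1 * (u1 - B) * (u1 - C) by rewrite e1 /u1 /B /C; ring.
have E2 : y2 ^+ 2 = u2 * (u2 - B) * (u2 - C) by rewrite e2 /u2 /B /C; ring.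
have u10 : u1 != 0 by apply: contraNneq y10 => z; rewrite -sqrf_eq0 E1 z !mul0r.
have u20 : u2 != 0 by apply: contraNneq y20 => z; rewrite -sqrf_eq0 E2 z !mul0r.
have Ra x y : half_root a b c x y = ((x - a) ^+ 2 - B * C) / (2 * y).
  by rewrite /half_root /B /C; congr (_ / _); ring.
have Rb x y : half_root b a c x y = ((x - a) ^+ 2 - 2 * B * (x - a) + B * C) / (2 * y).
  by rewrite /half_root /B /C; congr (_ / _); ring.
rewrite !Ra !Rb -/u1 -/u2.
(* With equal abscissas the two points are opposite, so [2 (x1, y1) = (a, 0)]. This forces
   [u1 ^+ 2 = B * C], and the half root at [a] vanishes on both sides. *)
have [ex|nx] := eqVneq x1 x2 => /=.
  have [//|ny] := eqVneq y1 y2 => /= [[H1 H2]].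
  have ey : y1 = - y2.
    apply/eqP; rewrite -addr_eq0; have : (y1 - y2) * (y1 + y2) = 0.
      by rewrite -subr_sqr e1 e2 ex subrr.
    by move/eqP; rewrite mulf_eq0 subr_eq0 (negPf ny).
  have eu : u2 = u1 by rewrite /u1 /u2 ex.
  move: H2; rewrite H1 => /eqP; rewrite subr_eq0 => /eqP H2.
  have {}H2 : ((u1 - B) * (u1 - C) + u1 * (u1 - C) + u1 * (u1 - B)) * u1 = 2 * y1 ^+ 2.
    transitivity ((2 * y1) * y1); last by ring.
    by rewrite -{2}H2 /u1 /B /C; field; rewrite y10 two_neq0.
  have DBC : u1 ^+ 2 = B * C.
    apply: (mulfI u10); apply/eqP; rewrite -subr_eq0; apply/eqP.
    transitivity (((u1 - B) * (u1 - C) + u1 * (u1 - C) + u1 * (u1 - B)) * u1 - 2 * y1 ^+ 2).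
      by rewrite E1; ring.
    by rewrite H2 subrr.
  rewrite eu ey DBC subrr !mul0r; split=> //.
  by field; rewrite oppr_eq0 y20 two_neq0.
case=> H1; rewrite H1 => /eqP; rewrite subr_eq0 -/u1.
set l := (- y2 - y1) / (x2 - x1) => /eqP H2.
have l0 : l != 0 by apply: contraNneq y10 => z; rewrite -H2 z mul0r.
have nu : u1 - u2 != 0 by rewrite /u1 /u2 opprB addrA subrK subr_eq0.
have H3 : l * u2 = - y2.
  have : l * (u2 - u1) = - y2 - y1.
    by rewrite /l /u1 /u2; field; rewrite subr_eq0 eq_sym.
  by rewrite mulrBr H2 => /addIr.
have F1 : l ^+ 2 * u1 = (u1 - B) * (u1 - C).
  apply: (mulfI u10); transitivity (y1 ^+ 2); last by rewrite E1; ring.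
  by rewrite -H2; ring.
have F2 : l ^+ 2 * u2 = (u2 - B) * (u2 - C).
  apply: (mulfI u20); transitivity (y2 ^+ 2); last by rewrite E2; ring.
  by rewrite -[y2]opprK -H3; ring.
have F3 : l ^+ 2 = u1 + u2 - B - C.
  by apply: (mulIf nu); rewrite mulrBr F1 F2; ring.
(* Translation by [(a, 0)] is the involution [u -> B C / u] of the coordinate [u = x - a]. *)
have F4 : u1 * u2 = B * C.
  apply/eqP; rewrite -subr_eq0; apply/eqP.
  by transitivity (l ^+ 2 * u1 - (u1 - B) * (u1 - C)); [rewrite F3; ring|rewrite F1 subrr].
have -> : y2 = - (l * u2) by rewrite H3 opprK.
by rewrite -H2 -F4; split; field; rewrite oppr_eq0 (mulf_neq0 l0 u20) u10 l0 two_neq0.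
Qed.

(** Coordinates of a half of a point with abscissa [x], given square roots [w1], [w2], [w3] of the
    three differences of [x] with the roots of the cubic. *)
Definition half_x x w1 w2 w3 := x + w1 * w2 + w1 * w3 + w2 * w3.
Definition half_y w1 w2 w3 := (w1 + w2) * (w1 + w3) * (w2 + w3).

Section HalfPoint.
Variables (a b c x w1 w2 w3 : F).
Hypotheses (ab : a != b) (ac : a != c) (bc : b != c).
Hypotheses (e1 : x - a = w1 ^+ 2) (e2 : x - b = w2 ^+ 2) (e3 : x - c = w3 ^+ 2).

Lemma half_on_curve :
  on_curve (cubic a b c) (Aff (half_x x w1 w2 w3) (half_y w1 w2 w3)).
Proof.
rewrite /= cubic_horner /half_x /half_y.
have -> : x + w1 * w2 + w1 * w3 + w2 * w3 - a = (x - a) + w1 * w2 + w1 * w3 + w2 * w3 by ring.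
have -> : x + w1 * w2 + w1 * w3 + w2 * w3 - b = (x - b) + w1 * w2 + w1 * w3 + w2 * w3 by ring.
have -> : x + w1 * w2 + w1 * w3 + w2 * w3 - c = (x - c) + w1 * w2 + w1 * w3 + w2 * w3 by ring.
by rewrite e1 e2 e3; ring.
Qed.

(** Changing the signs of [w2] and [w3] preserves the double, so the two halves differ by 2-torsion.
    The connecting line has slope [- (w2 + w3)], which identifies the torsion point. *)
Lemma half_translate :
  point_sub (cubic a b c) (Aff (half_x x w1 (- w2) (- w3)) (half_y w1 (- w2) (- w3)))
     (Aff (half_x x w1 w2 w3) (half_y w1 w2 w3)) = Aff a 0.
Proof.
have Da : a = x - w1 ^+ 2 by rewrite -e1; ring.
have Db : b = x - w2 ^+ 2 by rewrite -e2; ring.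
have Dc : c = x - w3 ^+ 2 by rewrite -e3; ring.
have w23 : w2 + w3 != 0.
  apply: contraNneq bc => z; have e : w2 = - w3 by apply/eqP; rewrite -addr_eq0 z.
  by rewrite Db Dc e sqrrN.
have w0 : w1 = 0 -> w2 * w3 != 0.
  move=> z; rewrite mulf_neq0 //.
    by apply: contraNneq ab => z'; rewrite Da Db z z'.
  by apply: contraNneq ac => z'; rewrite Da Dc z z'.
rewrite /point_sub /= opprK cubic_coef2 cubic_deriv /half_x /half_y.
(* The two abscissas differ by [2 w1 (w2 + w3)], where [w2 + w3] is nonzero; [w1 = 0] is exactly the
   tangent case of the addition. *)
have [z|w10] := eqVneq w1 0.
  rewrite z !mul0r !add0r mulrNN addr0 eqxx /=.
  have -> : (w2 * w3 * (- w2 - w3) == w2 * w3 * (w2 + w3)) = false.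
    apply/negbTE; rewrite -subr_eq0.
    have -> : w2 * w3 * (- w2 - w3) - w2 * w3 * (w2 + w3) = - (2 * (w2 * w3) * (w2 + w3)) by ring.
    by rewrite oppr_eq0; apply: mulf_neq0 => //; apply: mulf_neq0 => //; exact: w0.
  have := w0 z; rewrite mulf_eq0 negb_or => /andP[w20 w30].
  set l := (_ / _).
  have -> : l = - (w2 + w3).
    rewrite /l Da Db Dc z; field.
    by rewrite two_neq0 w20 w30 -opprD oppr_eq0 w23.
  by congr (Aff _ _); rewrite Da Db Dc z; ring.
have -> : (x + w1 * - w2 + w1 * - w3 + - w2 * - w3 == x + w1 * w2 + w1 * w3 + w2 * w3) = false.
  apply/negbTE; rewrite -subr_eq0.
  have -> : x + w1 * - w2 + w1 * - w3 + - w2 * - w3 - (x + w1 * w2 + w1 * w3 + w2 * w3)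
     = - (2 * w1 * (w2 + w3)) by ring.
  by rewrite oppr_eq0 !mulf_neq0.
rewrite /=; set l := (_ / _).
have -> : l = - (w2 + w3).
  have d0 : 2 * w1 * (w2 + w3) != 0 by rewrite !mulf_neq0.
  apply: (mulIf d0); rewrite /l.
  have -> : x + w1 * w2 + w1 * w3 + w2 * w3 - (x + w1 * - w2 + w1 * - w3 + - w2 * - w3)
     = 2 * w1 * (w2 + w3) by ring.
  by rewrite mulfVK //; ring.
by congr (Aff _ _); rewrite Da Db Dc; ring.
Qed.
End HalfPoint.
End Halving.

(** * The local criterion *)

Lemma rmorph_ratr (F F' : fieldType) (ch0 : forall n, (n%:R == 0 :> F) = (n == 0)%N)
    (g : {rmorphism F -> F'}) (r : rat) : g (ratr r) = ratr r.
Proof. exact: (fmorph_eq_rat (g \o ratr_char0 ch0 : {rmorphism rat -> F'}) r). Qed.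

Lemma algC_char0 n : (n%:R == 0 :> algC) = (n == 0)%N.
Proof. exact: pnatr_eq0. Qed.

Lemma sqr_rat_aut (b : algC) (d : rat) (s : {rmorphism algC -> algC}) :
  b ^+ 2 = ratr d -> s b = b \/ s b = - b.
Proof.
move=> e; have : s b ^+ 2 == b ^+ 2.
  by rewrite -rmorphXn e /= (rmorph_ratr algC_char0).
by rewrite eqf_sqr => /orP[/eqP|/eqP]; [left|right].
Qed.

(* The 2-torsion point [T] with given Weil pairings against (e1, 0) and (e3, 0). *)
Definition torsion_pt (L : fieldType) (e1 e2 e3 : L) (f1 f3 : bool) : ecpoint L :=
  match f1, f3 with
  | false, false => Infty
  | false, true => Aff e1 0
  | true, true => Aff e2 0
  | true, false => Aff e3 0
  end.

Definition kummer_cocycle (e1 e2 e3 : rat) (b1 b3 : algC) (s : galQ) : ecpoint algC :=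
  torsion_pt (ratr e1) (ratr e2) (ratr e3) (s b1 != b1) (s b3 != b3).

(* The first alternative stands for the points at infinity of the 2-covering. *)
Definition covering_soluble (e1 e2 e3 d1 d3 : rat) (K : fieldType) : Prop :=
  ((exists u : K, ratr d1 = u ^+ 2) /\ (exists u : K, ratr d3 = u ^+ 2)) \/
  exists X u1 u2 u3 : K,
    [/\ X - ratr e1 = ratr d1 * u1 ^+ 2,
        X - ratr e2 = ratr d1 * ratr d3 * u2 ^+ 2 &
        X - ratr e3 = ratr d3 * u3 ^+ 2].

Section LocalCriterion.
Variables (v : place) (K : completion v) (L : algebraic_closure K).
Variable iota : {rmorphism algC -> L}.

Let inj := aclos_inj L.

Lemma aclos_char0 n : (n%:R == 0 :> L) = (n == 0)%N.
Proof. by rewrite -(rmorph_nat inj) fmorph_eq0 completion_char0. Qed.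

Lemma aclos_ratr r : inj (ratr r) = ratr r.
Proof. exact: (rmorph_ratr (@completion_char0 v K)). Qed.

Lemma iota_ratr r : iota (ratr r) = ratr r.
Proof. exact: (rmorph_ratr algC_char0). Qed.

Definition local_aut (s : {rmorphism L -> L}) := forall x : K, s (inj x) = inj x.

(** The image under [s] of an algebraic number is a root of the same rational polynomial, all of
    whose roots already come from [algC]. *)
Lemma local_aut_restrict (s : {rmorphism L -> L}) :
  exists t : galQ, forall z, s (iota z) = iota (t z).
Proof.
have ex z : exists y, s (iota z) = iota y.
  have [p p0 rp] := algC_algebraic z.
  have [rs Dp] := closed_field_poly_normal (map_poly (ratr : rat -> algC) p).
  have : root (map_poly iota (map_poly (ratr : rat -> algC) p)) (s (iota z)).
    have -> : map_poly iota (map_poly (ratr : rat -> algC) p) =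
        map_poly s (map_poly iota (map_poly (ratr : rat -> algC) p)).
      rewrite -!map_poly_comp; apply: eq_map_poly => r /=.
      by rewrite iota_ratr (rmorph_ratr aclos_char0).
    by rewrite !fmorph_root.
  rewrite {1}Dp map_polyZ rootZ ?fmorph_eq0 ?lead_coef_eq0 ?map_poly_eq0 //.
  rewrite rmorph_prod (eq_bigr (fun r => 'X - (iota r)%:P)); last first.
    by move=> r _; rewrite /= map_polyXsubC.
  rewrite -(big_map iota xpredT (fun r => 'X - r%:P)) root_prod_XsubC.
  by move=> /mapP[y _ ->]; exists y.
pose t z := projT1 (cid (ex z)).
have tP z : s (iota z) = iota (t z) := projT2 (cid (ex z)).
have tB : zmod_morphism t.
  by move=> x y; apply: (fmorph_inj iota); rewrite -tP !rmorphB !tP.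
have tM : monoid_morphism t.
  split=> [|x y]; apply: (fmorph_inj iota); first by rewrite -tP !rmorph1.
  by rewrite -tP !rmorphM !tP.
by exists (mk_rmorphism tB tM).
Qed.

Lemma local_aut_fixed (y : L) :
  (forall s, local_aut s -> s y = y) -> exists x, y = inj x.
Proof.
move=> fy; apply: fixed_by_automorphisms => //; first exact: completion_pchar.
exact: aclos_algebraic.
Qed.

Variables (e1 e2 e3 : rat).
Hypotheses (e12 : e1 != e2) (e13 : e1 != e3) (e23 : e2 != e3).
Variables (d1 d3 : rat) (b1 b3 : algC).
Hypotheses (Db1 : b1 ^+ 2 = ratr d1) (Db3 : b3 ^+ 2 = ratr d3).
Hypotheses (d10 : d1 != 0) (d30 : d3 != 0).

Let fL : {poly L} := map_poly ratr (cubic e1 e2 e3).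
Let a1 : L := ratr e1.
Let a2 : L := ratr e2.
Let a3 : L := ratr e3.

Let rL := ratr_char0 aclos_char0.

Let two0 : (2 : L) != 0. Proof. by rewrite aclos_char0. Qed.
Let a12 : a1 != a2. Proof. by rewrite /a1 /a2 (inj_eq (fmorph_inj rL)). Qed.
Let a13 : a1 != a3. Proof. by rewrite /a1 /a3 (inj_eq (fmorph_inj rL)). Qed.
Let a23 : a2 != a3. Proof. by rewrite /a2 /a3 (inj_eq (fmorph_inj rL)). Qed.

Lemma map_cubic : fL = cubic a1 a2 a3.
Proof.
transitivity (map_poly rL (cubic e1 e2 e3)) => //.
rewrite /cubic 2!(rmorphM (map_poly rL)).
by congr (_ * _ * _); exact: (map_polyXsubC rL).
Qed.

Lemma point_map_torsion (f1 f3 : bool) :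
  point_map iota (torsion_pt (ratr e1) (ratr e2) (ratr e3) f1 f3) =
  torsion_pt a1 a2 a3 f1 f3.
Proof. by case: f1; case: f3 => //=; rewrite iota_ratr rmorph0. Qed.

Definition coboundary_of (c : galQ -> ecpoint algC) (P : ecpoint L) :=
  forall (s : {rmorphism L -> L}) (t : galQ), local_aut s ->
    (forall z, s (iota z) = iota (t z)) ->
    point_map iota (c t) = point_sub fL (point_map s P) P.

Let b10 : iota b1 != 0.
Proof.
by rewrite fmorph_eq0; apply: contraNneq d10 => z; have := Db1; rewrite z expr0n /= => /esym/eqP; rewrite fmorph_eq0.
Qed.
Let b30 : iota b3 != 0.
Proof.
by rewrite fmorph_eq0; apply: contraNneq d30 => z; have := Db3; rewrite z expr0n /= => /esym/eqP; rewrite fmorph_eq0.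
Qed.

Let Eb1 : iota b1 ^+ 2 = ratr d1. Proof. by rewrite -rmorphXn Db1 /= iota_ratr. Qed.
Let Eb3 : iota b3 ^+ 2 = ratr d3. Proof. by rewrite -rmorphXn Db3 /= iota_ratr. Qed.

Lemma aut_sqrt (s : {rmorphism L -> L}) (t : galQ) (b : algC) (d : rat) :
  b ^+ 2 = ratr d -> (forall z, s (iota z) = iota (t z)) ->
  s (iota b) = (-1) ^+ (t b != b) * iota b.
Proof.
move=> Db st; rewrite st; have [->|nb] := eqVneq (t b) b.
  by rewrite expr0 mul1r.
by have [e|->] := sqr_rat_aut t Db; [rewrite e eqxx in nb | rewrite expr1 mulN1r rmorphN].
Qed.

Lemma half_root_aut (s : {rmorphism L -> L}) (x y : L) (i j k : rat) :
  s (half_root (ratr i) (ratr j) (ratr k) x y) =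
  half_root (ratr i) (ratr j) (ratr k) (s x) (s y).
Proof.
have E (a b c : L) : s (half_root a b c x y) = half_root (s a) (s b) (s c) (s x) (s y).
  by rewrite /half_root fmorph_div !(rmorphB, rmorphM, rmorphXn, rmorph_nat).
by rewrite E !(rmorph_ratr aclos_char0).
Qed.

(** If [s] translates [P] by the torsion point [T], it multiplies the half root at each root [a_i]
    by the Weil pairing of [T] with [(a_i, 0)]. These are the signs that a Kummer cocycle records
    for [b1], [b1 b3] and [b3]. *)
Lemma half_root_flip (x y : L) (s : {rmorphism L -> L}) (f1 f3 : bool) :
  on_curve fL (Aff x y) -> y != 0 ->
  torsion_pt a1 a2 a3 f1 f3 = point_sub fL (point_map s (Aff x y)) (Aff x y) ->
  [/\ s (half_root a1 a2 a3 x y) = (-1) ^+ f1 * half_root a1 a2 a3 x y,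
      s (half_root a2 a1 a3 x y) = (-1) ^+ f1 * (-1) ^+ f3 * half_root a2 a1 a3 x y &
      s (half_root a3 a1 a2 x y) = (-1) ^+ f3 * half_root a3 a1 a2 x y].
Proof.
rewrite !half_root_aut -/a1 -/a2 -/a3 map_cubic => cP y0.
have sy0 : s y != 0 by rewrite fmorph_eq0.
have csP : s y ^+ 2 = (cubic a1 a2 a3).[s x].
  rewrite -rmorphXn /= cP -horner_map /=; congr (_.[_]).
  rewrite -map_cubic /fL -map_poly_comp; apply: eq_map_poly => r /=.
  by rewrite (rmorph_ratr aclos_char0).
have cP' : y ^+ 2 = (cubic a1 a2 a3).[x] by [].
have T1 : point_sub (cubic a1 a2 a3) (Aff (s x) (s y)) (Aff x y) = Aff a1 0 ->
    [/\ half_root a1 a2 a3 (s x) (s y) = half_root a1 a2 a3 x y,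
        half_root a2 a1 a3 (s x) (s y) = - half_root a2 a1 a3 x y &
        half_root a3 a1 a2 (s x) (s y) = - half_root a3 a1 a2 x y].
  move=> H; have b12 : a2 != a1 by rewrite eq_sym.
  have b13 : a3 != a1 by rewrite eq_sym.
  have [h1 h2] := half_root_translate two0 b12 b13 sy0 y0 csP cP' H.
  have E : cubic a1 a2 a3 = cubic a1 a3 a2 by rewrite cubicCA cubicC.
  move: csP cP' H; rewrite E => csP cP' H.
  by have [_ h3] := half_root_translate two0 b13 b12 sy0 y0 csP cP' H.
have T2 : point_sub (cubic a1 a2 a3) (Aff (s x) (s y)) (Aff x y) = Aff a2 0 ->
    [/\ half_root a1 a2 a3 (s x) (s y) = - half_root a1 a2 a3 x y,
        half_root a2 a1 a3 (s x) (s y) = half_root a2 a1 a3 x y &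
        half_root a3 a1 a2 (s x) (s y) = - half_root a3 a1 a2 x y].
  move=> H; have b12 : a3 != a2 by rewrite eq_sym.
  have E : cubic a1 a2 a3 = cubic a2 a1 a3 by rewrite cubicC.
  have E' : cubic a2 a1 a3 = cubic a2 a3 a1 by rewrite cubicCA cubicC.
  move: csP cP' H; rewrite E => csP cP' H.
  have [h1 h2] := half_root_translate two0 a12 b12 sy0 y0 csP cP' H.
  move: csP cP' H; rewrite E' => csP cP' H.
  have [_ h3] := half_root_translate two0 b12 a12 sy0 y0 csP cP' H.
  by split; rewrite // ![half_root a3 a1 _ _ _]half_rootC.
have T3 : point_sub (cubic a1 a2 a3) (Aff (s x) (s y)) (Aff x y) = Aff a3 0 ->
    [/\ half_root a1 a2 a3 (s x) (s y) = - half_root a1 a2 a3 x y,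
        half_root a2 a1 a3 (s x) (s y) = - half_root a2 a1 a3 x y &
        half_root a3 a1 a2 (s x) (s y) = half_root a3 a1 a2 x y].
  move=> H.
  have E : cubic a1 a2 a3 = cubic a3 a1 a2 by rewrite cubicCA.
  have E' : cubic a3 a1 a2 = cubic a3 a2 a1 by rewrite cubicCA cubicC.
  move: csP cP' H; rewrite E => csP cP' H.
  have [h1 h2] := half_root_translate two0 a13 a23 sy0 y0 csP cP' H.
  move: csP cP' H; rewrite E' => csP cP' H.
  have [_ h3] := half_root_translate two0 a23 a13 sy0 y0 csP cP' H.
  by split; rewrite // ![half_root _ _ a3 _ _]half_rootC.
case: f1; case: f3 => /esym H; rewrite ?expr0 ?expr1 ?mulrNN ?mulN1r ?mulr1 ?mul1r ?mulN1r ?opprK.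
- exact: T2 H.
- exact: T3 H.
- exact: T1 H.
- have H' : point_sub (cubic a1 a2 a3) (Aff (s x) (s y)) (Aff x y) = Infty := H.
  by have [-> ->] := point_sub_eq_infty H'.
Qed.

(** An automorphism flips the half root [w1] exactly when it flips [b1], and likewise for the other
    two. The quotients are therefore fixed, lie in [K], and solve the covering with [X] the abscissa
    of [2P]. *)
Lemma covering_soluble_of_coboundary (P : ecpoint L) :
  on_curve fL P -> coboundary_of (kummer_cocycle e1 e2 e3 b1 b3) P ->
  covering_soluble e1 e2 e3 d1 d3 K.
Proof.
move=> cP HP.
(* If [2P] is the point at infinity then [P] is fixed, so the cocycle vanishes locally and both [d1]
   and [d3] become squares in [K]. *)
have triv : (forall s, local_aut s -> point_map s P = P) -> covering_soluble e1 e2 e3 d1 d3 K.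
  move=> sP; left.
  have fixed s : local_aut s -> s (iota b1) = iota b1 /\ s (iota b3) = iota b3.
    move=> ls; have [t st] := local_aut_restrict s; have := HP s t ls st.
    rewrite sP // point_sub_self point_map_torsion !st.
    have [-> | _] := eqVneq (t b1) b1; first by have [-> | _] := eqVneq (t b3) b3.
    by case: (t b3 != b3).
  have sq b d : iota b ^+ 2 = ratr d -> (forall s, local_aut s -> s (iota b) = iota b) ->
      exists u : K, ratr d = u ^+ 2.
    move=> Eb /local_aut_fixed[u Du]; exists u; apply: (fmorph_inj inj).
    by rewrite rmorphXn /= -Du Eb aclos_ratr.
  by split; [apply: sq Eb1 _ | apply: sq Eb3 _] => s /fixed[].
case: P cP HP triv => [|x y] cP HP triv; first exact: triv.
have [y0|y0] := eqVneq y 0.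
  apply: triv => s _ /=; rewrite y0 rmorph0; congr (Aff _ _).
  move: cP; rewrite map_cubic /= cubic_horner y0 expr0n /= => /esym/eqP.
  rewrite !mulf_eq0 !subr_eq0 => /orP[/orP[]|] /eqP ->;
    exact: (rmorph_ratr aclos_char0).
pose w1 := half_root a1 a2 a3 x y; pose w2 := half_root a2 a1 a3 x y.
pose w3 := half_root a3 a1 a2 x y.
have flip s : local_aut s -> exists f1 f3 : bool,
    [/\ s (iota b1) = (-1) ^+ f1 * iota b1, s (iota b3) = (-1) ^+ f3 * iota b3,
        s w1 = (-1) ^+ f1 * w1, s w2 = (-1) ^+ f1 * (-1) ^+ f3 * w2 & s w3 = (-1) ^+ f3 * w3].
  move=> ls; have [t st] := local_aut_restrict s; exists (t b1 != b1), (t b3 != b3).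
  have := HP s t ls st; rewrite point_map_torsion => /(half_root_flip cP y0)[h1 h2 h3].
  by split=> //; [apply: aut_sqrt Db1 st | apply: aut_sqrt Db3 st].
have sg (f : bool) : ((-1) ^+ f : L) != 0 by rewrite signr_eq0.
have [u1 Du1] : exists u, w1 / iota b1 = inj u.
  apply: local_aut_fixed => s /flip[f1 [f3 [h1 h2 h3 h4 h5]]].
  by rewrite fmorph_div h1 h3; field; rewrite b10 sg.
have [u3 Du3] : exists u, w3 / iota b3 = inj u.
  apply: local_aut_fixed => s /flip[f1 [f3 [h1 h2 h3 h4 h5]]].
  by rewrite fmorph_div h2 h5; field; rewrite b30 sg.
have [u2 Du2] : exists u, w2 / (iota b1 * iota b3) = inj u.
  apply: local_aut_fixed => s /flip[f1 [f3 [h1 h2 h3 h4 h5]]].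
  by rewrite fmorph_div (rmorphM s (iota b1)) h1 h2 h4; field; rewrite b30 b10 !sg.
have W1 : w1 ^+ 2 = ratr d1 * inj u1 ^+ 2 by rewrite -Du1 -Eb1; field.
have W3 : w3 ^+ 2 = ratr d3 * inj u3 ^+ 2 by rewrite -Du3 -Eb3; field.
have W2 : w2 ^+ 2 = ratr d1 * ratr d3 * inj u2 ^+ 2.
  by rewrite -Du2 -Eb1 -Eb3; field; rewrite b10 b30.
have cP' : y ^+ 2 = (cubic a1 a2 a3).[x] by rewrite -map_cubic.
have X12 := half_root_sqr two0 y0 cP'.
have X13 : w1 ^+ 2 + a1 = w3 ^+ 2 + a3.
  have E : cubic a1 a2 a3 = cubic a1 a3 a2 by rewrite cubicCA cubicC.
  move: cP'; rewrite E => cP'; have := half_root_sqr two0 y0 cP'.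
  by rewrite (half_rootC a1 a3 a2).
have injE (a b c u : K) : inj (a + b * u ^+ 2 - c) = inj a + inj b * inj u ^+ 2 - inj c.
  by rewrite rmorphB rmorphD rmorphM rmorphXn.
right; exists (ratr e1 + ratr d1 * u1 ^+ 2), u1, u2, u3; split; first by ring.
- apply: (fmorph_inj inj); rewrite injE !aclos_ratr (rmorphM inj) (rmorphM inj (ratr d1)) !aclos_ratr (rmorphXn inj).
  rewrite -/w1 -/w2 in X12.
  by rewrite -W1 -W2 -/a1 -/a2 [a1 + _]addrC X12 addrK.
- apply: (fmorph_inj inj); rewrite injE !aclos_ratr (rmorphM inj) !aclos_ratr (rmorphXn inj).
  by rewrite -W1 -W3 -/a1 -/a3 [a1 + _]addrC X13 addrK.
Qed.

(** Conversely, halve a point with abscissa [X] using [w1 = b1 u1], [w3 = b3 u3] and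
    [w2 = b1 b3 u2]: automorphisms flip these as they flip [b1] and [b3]. *)
Lemma coboundary_of_covering_soluble : covering_soluble e1 e2 e3 d1 d3 K ->
  exists2 P : ecpoint L, on_curve fL P &
    coboundary_of (kummer_cocycle e1 e2 e3 b1 b3) P.
Proof.
case=> [[[u1 E1] [u3 E3]]|[X [u1 [u2 [u3 [E1 E2 E3]]]]]].
  exists Infty => // s t ls st; rewrite point_map_torsion /=.
  have fixed (b : algC) (u : K) : iota b ^+ 2 = inj (u ^+ 2) -> t b = b.
    move=> e; apply: (fmorph_inj iota); rewrite -st.
    have : iota b ^+ 2 == inj u ^+ 2 by rewrite e rmorphXn.
    by rewrite eqf_sqr => /orP[] /eqP ->; rewrite ?rmorphN ls.
  by rewrite (fixed _ u1) ?(fixed _ u3) ?eqxx // -?E1 -?E3 aclos_ratr.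
pose w1 := iota b1 * inj u1; pose w3 := iota b3 * inj u3.
pose w2 := iota b1 * iota b3 * inj u2; pose x := inj X.
have W1 : x - a1 = w1 ^+ 2.
  by rewrite exprMn Eb1 -(rmorphXn inj) -aclos_ratr -(rmorphM inj) -E1 (rmorphB inj) aclos_ratr.
have W3 : x - a3 = w3 ^+ 2.
  by rewrite exprMn Eb3 -(rmorphXn inj) -aclos_ratr -(rmorphM inj) -E3 (rmorphB inj) aclos_ratr.
have W2 : x - a2 = w2 ^+ 2.
  by rewrite !exprMn Eb1 Eb3 -(rmorphXn inj) -!aclos_ratr -!(rmorphM inj) -E2 (rmorphB inj) aclos_ratr.
exists (Aff (half_x x w1 w2 w3) (half_y w1 w2 w3)).
  by rewrite map_cubic; exact: half_on_curve.
move=> s t ls st; rewrite point_map_torsion map_cubic.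
have hx (a b c d : L) : s (half_x a b c d) = half_x (s a) (s b) (s c) (s d).
  by rewrite /half_x !(rmorphD, rmorphM).
have hy (a b c : L) : s (half_y a b c) = half_y (s a) (s b) (s c).
  by rewrite /half_y !(rmorphD, rmorphM).
have ex : s x = x by exact: ls.
have h1 : s w1 = (-1) ^+ (t b1 != b1) * w1.
  by rewrite (rmorphM s) ls (aut_sqrt Db1 st) mulrA.
have h3 : s w3 = (-1) ^+ (t b3 != b3) * w3.
  by rewrite (rmorphM s) ls (aut_sqrt Db3 st) mulrA.
have h2 : s w2 = (-1) ^+ (t b1 != b1) * (-1) ^+ (t b3 != b3) * w2.
  by rewrite 2!(rmorphM s) ls (aut_sqrt Db1 st) (aut_sqrt Db3 st) /w2; ring.
rewrite /point_map hx hy ex h1 h2 h3; case: (t b1 != b1); case: (t b3 != b3);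
  rewrite ?expr0 ?expr1 ?mulrNN ?mulN1r ?mulr1 ?mul1r ?mulN1r ?opprK.
(* [half_translate] flips its last two roots, so the roots are permuted to put the one whose sign is
   kept first. *)
- have := half_translate two0 _ _ a13 W2 W1 W3; rewrite cubicC.
  rewrite (_ : half_x x w2 (- w1) (- w3) = half_x x (- w1) w2 (- w3)); last by rewrite /half_x; ring.
  rewrite (_ : half_y w2 (- w1) (- w3) = half_y (- w1) w2 (- w3)); last by rewrite /half_y; ring.
  rewrite (_ : half_x x w2 w1 w3 = half_x x w1 w2 w3); last by rewrite /half_x; ring.
  rewrite (_ : half_y w2 w1 w3 = half_y w1 w2 w3); last by rewrite /half_y; ring.
  by move=> H; symmetry; apply: H; rewrite // eq_sym.
- have := half_translate two0 _ _ a12 W3 W1 W2; rewrite -cubicCA.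
  rewrite (_ : half_x x w3 (- w1) (- w2) = half_x x (- w1) (- w2) w3); last by rewrite /half_x; ring.
  rewrite (_ : half_y w3 (- w1) (- w2) = half_y (- w1) (- w2) w3); last by rewrite /half_y; ring.
  rewrite (_ : half_x x w3 w1 w2 = half_x x w1 w2 w3); last by rewrite /half_x; ring.
  rewrite (_ : half_y w3 w1 w2 = half_y w1 w2 w3); last by rewrite /half_y; ring.
  by move=> H; symmetry; apply: H; rewrite // eq_sym.
- by rewrite (half_translate two0).
- by rewrite point_sub_self.
Qed.
End LocalCriterion.

(** * Global cocycles *)

Section KummerCharacter.
Variable chi : galQ -> bool.
Hypothesis chi_ext : forall s t : galQ, s =1 t -> chi s = chi t.
Hypothesis chiM : forall s t : galQ,
  chi (s \o t : {rmorphism algC -> algC}) = chi s (+) chi t.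
Hypothesis chi_cont : exists A : seq algC,
  forall t : galQ, {in A, t =1 id} -> chi t = false.

(** The finite set in the continuity hypothesis generates a number field, and [z] is a primitive
    element of it. *)
Lemma chi_primitive : exists z : algC, forall s t : galQ, s z = t z -> chi s = chi t.
Proof.
have [A HA] := chi_cont; have [z _ [ps DA]] := algC_PET A.
exists z => s t st; pose u : galQ := algC_invaut t \o s.
have uz : u z = z by rewrite /u /= st algC_autK.
have -> : chi s = chi (t \o u : {rmorphism algC -> algC}).
  by apply: chi_ext => x; rewrite /= algC_invautK.
rewrite chiM [chi u]HA ?addbF // => a; rewrite DA => /mapP[q _ ->].
rewrite -horner_map uz -map_poly_comp; congr (_.[_]); apply: eq_map_poly => r /=.
exact: (rmorph_ratr algC_char0 u).
Qed.

(** The square root is a resolvent: the sum of the powers [w ^+ k] over the conjugates [w] of [z],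
    signed by the character. An automorphism multiplies it by the character, so its square is
    rational. *)
Lemma kummer_character : exists (d : rat) (b : algC),
  [/\ d != 0, b ^+ 2 = ratr d & forall s : galQ, chi s = (s b != b)].
Proof.
have [z Hz] := chi_primitive.
have [p p0 rp] := algC_algebraic z.
have [rs Dp] := closed_field_poly_normal (map_poly (ratr : rat -> algC) p).
have inrs (s : galQ) : s z \in rs.
  have : root (map_poly (ratr : rat -> algC) p) (s z).
    rewrite (_ : map_poly _ _ = map_poly s (map_poly (ratr : rat -> algC) p)) ?fmorph_root //.
    by rewrite -map_poly_comp; apply: eq_map_poly => r /=; rewrite (rmorph_ratr algC_char0 s).
  by rewrite Dp rootZ ?lead_coef_eq0 ?map_poly_eq0 // root_prod_XsubC.
pose Z := [seq w <- undup rs | `[< exists s : galQ, s z = w >]].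
have ZP w : w \in Z <-> exists s : galQ, s z = w.
  rewrite mem_filter mem_undup; split=> [/andP[/asboolP]//|[s <-]].
  by rewrite inrs andbT; apply/asboolP; exists s.
have uZ : uniq Z by rewrite filter_uniq // undup_uniq.
(* The character viewed as a function on conjugates, well defined by the choice of [z]. *)
pose chi' w := `[< exists s : galQ, s z = w /\ chi s >].
have chi'E (s : galQ) : chi' (s z) = chi s.
  apply/asboolP/idP => [[t [e ct]]|cs]; last by exists s.
  by rewrite -(Hz t s).
have zZ : z \in Z by apply/ZP; exists idfun.
pose beta k := \sum_(w <- Z) (-1) ^+ chi' w * w ^+ k.
have sbeta (s : galQ) k : s (beta k) = (-1) ^+ chi s * beta k.
  have pZ : perm_eq (map s Z) Z.
    have sub : {subset map s Z <= Z}.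
      move=> _ /mapP[w /ZP[t <-] ->]; apply/ZP.
      by exists (s \o t : {rmorphism algC -> algC}).
    have u : uniq (map s Z) by rewrite map_inj_uniq //; exact: fmorph_inj.
    have [eqs e] := uniq_min_size u sub (eq_leq (esym (size_map s Z))).
    exact: uniq_perm.
  rewrite /beta rmorph_sum -[in RHS](perm_big _ pZ) big_map mulr_sumr /=.
  apply: eq_big_seq => w /ZP[t <-].
  rewrite rmorphM rmorphXn rmorph_sign.
  have -> : s (t z) = (s \o t : {rmorphism algC -> algC}) z by [].
  rewrite !chi'E chiM signr_addb /= mulrA mulrA -signr_addb addbb mul1r //.
(* If all resolvents vanished, so would the signed sum of any polynomial over the conjugates; [P],
   which vanishes at all conjugates except [z], contradicts this. *)
have [k bk] : exists k, beta k != 0.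
  apply: contrapT => /forallNP nb.
  pose P := \prod_(w <- rem z Z) ('X - w%:P).
  have Pz : P.[z] != 0.
    rewrite horner_prod prodf_seq_neq0; apply/allP => w.
    rewrite mem_rem_uniq // inE => /andP[wz _] /=.
    by rewrite hornerXsubC subr_eq0 eq_sym.
  have S : \sum_(w <- Z) (-1) ^+ chi' w * P.[w] = (-1) ^+ chi' z * P.[z].
    rewrite (perm_big _ (perm_to_rem zZ)) big_cons big_seq big1 => [|w wr]; first exact: addr0.
    have /rootP -> : root P w by rewrite root_prod_XsubC.
    by rewrite mulr0.
  have : \sum_(w <- Z) (-1) ^+ chi' w * P.[w] = \sum_(k < size P) P`_k * beta k.
    under eq_bigr do rewrite horner_coef mulr_sumr.
    rewrite exchange_big; apply: eq_bigr => i _; rewrite mulr_sumr.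
    by apply: eq_bigr => w _; ring.
  have -> : \sum_(k < size P) P`_k * beta k = 0.
    rewrite big1 // => i _.
    by have /negP := nb i; rewrite negbK => /eqP ->; rewrite mulr0.
  by move/eqP; rewrite S mulf_eq0 signr_eq0 (negPf Pz).
have [d Dd] : exists d : rat, beta k ^+ 2 = ratr d.
  by apply: algC_fixed => s; rewrite rmorphXn /= sbeta exprMn sqrr_sign mul1r.
exists d, (beta k); split=> //.
  by apply: contraNneq bk => d0; rewrite -sqrf_eq0 Dd d0 rmorph0.
move=> s; rewrite sbeta; case: (chi s); rewrite ?expr0 ?expr1 ?mul1r ?eqxx //.
by rewrite mulN1r eq_sym -addr_eq0 -mulr2n mulrn_eq0 (negPf bk).
Qed.
End KummerCharacter.

Section TwoTorsion.
Variables (L : fieldType) (a1 a2 a3 : L).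
Hypothesis two0 : (2 : L) != 0.
Hypotheses (a12 : a1 != a2) (a13 : a1 != a3) (a23 : a2 != a3).
Let f := cubic a1 a2 a3.
Let T := torsion_pt a1 a2 a3.

Lemma torsion_pt_inj f1 f3 g1 g3 : T f1 f3 = T g1 g3 -> f1 = g1 /\ f3 = g3.
Proof.
have b12 : a2 != a1 by rewrite eq_sym.
have b13 : a3 != a1 by rewrite eq_sym.
have b23 : a3 != a2 by rewrite eq_sym.
by case: f1; case: f3; case: g1; case: g3 => //= -[] /eqP;
  rewrite ?(negPf a12) ?(negPf a13) ?(negPf a23) ?(negPf b12) ?(negPf b13) ?(negPf b23).
Qed.

Lemma two_torsionP P : two_torsion f P <-> exists f1 f3, P = T f1 f3.
Proof.
split; last first.
  case=> f1 [f3 ->]; split.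
    by case: f1; case: f3; rewrite /= ?cubic_horner ?subrr ?mul0r ?mulr0 ?mul0r ?expr0n.
  by case: f1; case: f3; rewrite /= ?oppr0 ?eqxx.
case: P => [_|x y [/= cP]]; first by exists false, false.
case: eqP => //= ?; case: eqP => //= yy _.
have y0 : y = 0.
  have : 2 * y = 0 by rewrite mulr_natl mulr2n {1}yy addNr.
  by move/eqP; rewrite mulf_eq0 (negPf two0) => /eqP.
move: cP; rewrite y0 cubic_horner expr0n /= => /esym/eqP.
rewrite !mulf_eq0 !subr_eq0 => /orP[/orP[]|] /eqP ->.
- by exists false, true.
- by exists true, true.
- by exists true, false.
Qed.

Lemma torsion_ptD f1 f3 g1 g3 :
  point_add f (T f1 f3) (T g1 g3) = T (f1 (+) g1) (f3 (+) g3).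
Proof.
have b12 : a2 != a1 by rewrite eq_sym.
have b13 : a3 != a1 by rewrite eq_sym.
have b23 : a3 != a2 by rewrite eq_sym.
case: f1; case: f3; case: g1; case: g3 => //=;
  rewrite ?oppr0 ?eqxx ?(negPf a12) ?(negPf a13) ?(negPf a23) ?(negPf b12) ?(negPf b13) ?(negPf b23) //= !addr0 !mul0r cubic_coef2 expr0n /= ?addr0 //; congr (Aff _ _); ring.
Qed.
End TwoTorsion.

Section GlobalCocycles.
Variables (e1 e2 e3 : rat).
Hypotheses (e12 : e1 != e2) (e13 : e1 != e3) (e23 : e2 != e3).
Let f := cubic e1 e2 e3.
Let fC : {poly algC} := map_poly ratr f.
Let a1 : algC := ratr e1.
Let a2 : algC := ratr e2.
Let a3 : algC := ratr e3.
Let T := torsion_pt a1 a2 a3.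

Let two0 : (2 : algC) != 0. Proof. by rewrite pnatr_eq0. Qed.
Let a12 : a1 != a2. Proof. by rewrite (inj_eq (fmorph_inj _)). Qed.
Let a13 : a1 != a3. Proof. by rewrite (inj_eq (fmorph_inj _)). Qed.
Let a23 : a2 != a3. Proof. by rewrite (inj_eq (fmorph_inj _)). Qed.

Lemma map_cubic_algC : fC = cubic a1 a2 a3.
Proof.
rewrite /fC /f /cubic 2!(rmorphM (map_poly (ratr : rat -> algC))).
by congr (_ * _ * _); exact: (map_polyXsubC (ratr : {rmorphism rat -> algC})).
Qed.

Lemma torsion_pt_fixed (s : galQ) f1 f3 : point_map s (T f1 f3) = T f1 f3.
Proof.
by case: f1; case: f3 => //=; rewrite rmorph0 (rmorph_ratr algC_char0 s).
Qed.

(** Since E[2] is fixed by Galois, the cocycle is a homomorphism, and its two components are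
    quadratic characters. *)
Lemma cocycle2_kummer (c : galQ -> ecpoint algC) : cocycle2 f c ->
  exists d1 d3 b1 b3, [/\ d1 != 0, d3 != 0, b1 ^+ 2 = ratr d1, b3 ^+ 2 = ratr d3 &
    c = kummer_cocycle e1 e2 e3 b1 b3].
Proof.
case; rewrite -/fC map_cubic_algC => tc cM kc.
have ex s : exists f13 : bool * bool, c s = T f13.1 f13.2.
  by have /(two_torsionP a1 a2 a3 two0)[f1 [f3 e]] := tc s; exists (f1, f3).
pose chi s := projT1 (cid (ex s)).
have chiP s : c s = T (chi s).1 (chi s).2 := projT2 (cid (ex s)).
have chi_inj s g1 g3 : c s = T g1 g3 -> (chi s).1 = g1 /\ (chi s).2 = g3.
  by rewrite chiP; exact: torsion_pt_inj.
have cext (s t : galQ) : s =1 t -> c s = c t.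
  by move=> st; have [A HA] := kc t; apply: HA => x _; exact: st.
have chiM (s t : galQ) : c (s \o t : {rmorphism algC -> algC}) =
    T ((chi s).1 (+) (chi t).1) ((chi s).2 (+) (chi t).2).
  by rewrite cM chiP [c t]chiP torsion_pt_fixed torsion_ptD.
have c1 : c (idfun : {rmorphism algC -> algC}) = Infty.
  have e : c (idfun \o idfun : {rmorphism algC -> algC}) = c (idfun : {rmorphism algC -> algC}).
    exact: cext.
  by rewrite -e chiM !addbb.
have [A HA] := kc (idfun : {rmorphism algC -> algC}).
have kA (t : galQ) : {in A, t =1 id} -> chi t = (false, false).
  move=> tA; have /chi_inj : c t = T false false by rewrite HA // c1.
  by case: (chi t) => x y /= [-> ->].
have [|||d1 [b1 [d10 Db1 H1]]] := @kummer_character (fun s => (chi s).1).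
- by move=> s t /cext; rewrite (chiP t) => /chi_inj[].
- by move=> s t; have [] := chi_inj _ _ _ (chiM s t).
- by exists A => t /kA ->.
have [|||d3 [b3 [d30 Db3 H3]]] := @kummer_character (fun s => (chi s).2).
- by move=> s t /cext; rewrite (chiP t) => /chi_inj[].
- by move=> s t; have [] := chi_inj _ _ _ (chiM s t).
- by exists A => t /kA ->.
exists d1, d3, b1, b3; split=> //; apply/funext => s.
by rewrite chiP H1 H3.
Qed.

Lemma aut_flipM (s t : galQ) (b : algC) (d : rat) : b ^+ 2 = ratr d -> b != 0 ->
  (s (t b) != b) = (s b != b) (+) (t b != b).
Proof.
move=> Db b0.
have nb : (- b == b) = false.
  by apply/negbTE; rewrite eq_sym -addr_eq0 -mulr2n mulrn_eq0 (negPf b0).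
by have [->|->] := sqr_rat_aut t Db; rewrite ?rmorphN; have [->|->] := sqr_rat_aut s Db;
  rewrite ?opprK ?eqxx ?nb ?(inj_eq oppr_inj).
Qed.

Lemma kummer_cocycleP (d1 d3 : rat) (b1 b3 : algC) :
  d1 != 0 -> d3 != 0 -> b1 ^+ 2 = ratr d1 -> b3 ^+ 2 = ratr d3 ->
  cocycle2 f (kummer_cocycle e1 e2 e3 b1 b3).
Proof.
move=> d10 d30 Db1 Db3.
have nz (b : algC) d : b ^+ 2 = ratr d -> d != 0 -> b != 0.
  by move=> Db; apply: contraNneq => b0; move: Db; rewrite b0 expr0n => /esym/eqP; rewrite fmorph_eq0.
split; rewrite -/fC ?map_cubic_algC.
- by move=> s; apply/two_torsionP => //; eexists; eexists.
- move=> s t; rewrite torsion_pt_fixed torsion_ptD // /kummer_cocycle /=.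
  by rewrite (aut_flipM s t Db1) ?(aut_flipM s t Db3) //; [exact: nz Db3 _ | exact: nz Db1 _].
- move=> s; exists [:: b1; b3] => t H.
  by rewrite /kummer_cocycle !H ?inE ?eqxx ?orbT.
Qed.

(** The coboundary of a rational torsion point is trivial, so classes can be counted as cocycles. *)
Lemma H1_class_set1 (c : galQ -> ecpoint algC) : cocycle2 f c ->
  H1_class f c = [set c]%classic.
Proof.
move=> cc; rewrite /H1_class; apply/seteqP; split=> [c' /= [_ [P tP HP]]|_ /= ->].
  apply/funext => s; rewrite HP -/fC.
  move: tP; rewrite -/fC map_cubic_algC => /(two_torsionP a1 a2 a3 two0)[f1 [f3 ->]].
  by rewrite torsion_pt_fixed point_sub_self; case: (c s).
split=> //; exists Infty; first by [].
by move=> s /=; case: (c s).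
Qed.

Definition sqrtQ (d : rat) : algC := sqrtC (ratr d).

Lemma sqrtQK d : sqrtQ d ^+ 2 = ratr d. Proof. exact: sqrtCK. Qed.

Lemma flip_eq (s : galQ) (b b' : algC) (d d' r : rat) :
  b ^+ 2 = ratr d -> b' ^+ 2 = ratr d' -> d' = d * r ^+ 2 -> r != 0 ->
  (s b != b) = (s b' != b').
Proof.
move=> Db Db' Dd r0; have r0' : (ratr r : algC) != 0 by rewrite fmorph_eq0.
have : b' ^+ 2 == (b * ratr r) ^+ 2 by rewrite Db' Dd exprMn Db rmorphM rmorphXn.
have e : (s (b * ratr r) == b * ratr r) = (s b == b).
  by rewrite rmorphM /= (rmorph_ratr algC_char0 s) (inj_eq (mulIf r0')).
by rewrite eqf_sqr => /orP[] /eqP ->; rewrite ?rmorphN ?(inj_eq oppr_inj) e.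
Qed.

Lemma kummer_cocycle_class (d1 d3 r1 r3 d1' d3' : rat) (b1 b3 : algC) :
  b1 ^+ 2 = ratr d1 -> b3 ^+ 2 = ratr d3 ->
  d1 = d1' * r1 ^+ 2 -> d3 = d3' * r3 ^+ 2 -> r1 != 0 -> r3 != 0 ->
  kummer_cocycle e1 e2 e3 b1 b3 = kummer_cocycle e1 e2 e3 (sqrtQ d1') (sqrtQ d3').
Proof.
move=> Db1 Db3 D1 D3 r10 r30; apply/funext => s; rewrite /kummer_cocycle.
by rewrite -(flip_eq s (sqrtQK d1') Db1 D1 r10) -(flip_eq s (sqrtQK d3') Db3 D3 r30).
Qed.

(** The quotient of the two square roots is fixed by all automorphisms, hence rational. *)
Lemma flip_inj (d d' : rat) : d != 0 -> d' != 0 ->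
  (forall s : galQ, (s (sqrtQ d) != sqrtQ d) = (s (sqrtQ d') != sqrtQ d')) ->
  exists r : rat, d = d' * r ^+ 2.
Proof.
move=> d0 d0' H.
have nz e : e != 0 -> sqrtQ e != 0 by move=> e0; rewrite sqrtC_eq0 fmorph_eq0.
have [s|r Dr] := @algC_fixed (sqrtQ d / sqrtQ d').
  have nb e : e != 0 -> (- sqrtQ e == sqrtQ e) = false.
    by move=> /nz e0; apply/negbTE; rewrite eq_sym -addr_eq0 -mulr2n mulrn_eq0 (negPf e0).
  have := H s; rewrite fmorph_div.
  have [->|->] := sqr_rat_aut s (sqrtQK d); have [->|->] := sqr_rat_aut s (sqrtQK d');
   by rewrite ?eqxx ?nb // invrN mulrNN.
exists r; apply: (fmorph_inj (ratr : {rmorphism rat -> algC})).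
rewrite rmorphM rmorphXn /= -Dr -!sqrtQK; field; exact: nz.
Qed.

Lemma kummer_cocycle_inj (d1 d3 d1' d3' : rat) :
  d1 != 0 -> d3 != 0 -> d1' != 0 -> d3' != 0 ->
  kummer_cocycle e1 e2 e3 (sqrtQ d1) (sqrtQ d3) =
  kummer_cocycle e1 e2 e3 (sqrtQ d1') (sqrtQ d3') ->
  (exists r, d1 = d1' * r ^+ 2) /\ (exists r, d3 = d3' * r ^+ 2).
Proof.
move=> d10 d30 d10' d30' e; split; apply: flip_inj => // s;
  have := congr1 (fun c => c s) e; by case/(torsion_pt_inj a12 a13 a23).
Qed.

Lemma locally_trivial_kummer (v : place) (d1 d3 : rat) (b1 b3 : algC) :
  d1 != 0 -> d3 != 0 -> b1 ^+ 2 = ratr d1 -> b3 ^+ 2 = ratr d3 ->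
  (forall K : completion v, covering_soluble e1 e2 e3 d1 d3 K) ->
  locally_trivial f v (kummer_cocycle e1 e2 e3 b1 b3).
Proof.
move=> d10 d30 Db1 Db3 sol K L iota.
have [P cP HP] := coboundary_of_covering_soluble iota e12 e13 e23 Db1 Db3 (sol K).
by exists P => // s t ls st; exact: HP.
Qed.

(** Local triviality is instantiated at the model from [local_model], which yields solubility over
    one completion; the converse above assumes it over all of them. *)
Lemma kummer_locally_trivial (p : nat) (p_pr : prime p) (d1 d3 : rat) (b1 b3 : algC) :
  d1 != 0 -> d3 != 0 -> b1 ^+ 2 = ratr d1 -> b3 ^+ 2 = ratr d3 ->
  locally_trivial f (Defs.Finite p_pr) (kummer_cocycle e1 e2 e3 b1 b3) ->
  exists K : completion (Defs.Finite p_pr), covering_soluble e1 e2 e3 d1 d3 K.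
Proof.
move=> d10 d30 Db1 Db3 lt; have [K [L [iota]]] := local_model p_pr; exists K.
have [P cP HP] := lt K L iota.
apply: (covering_soluble_of_coboundary e12 e13 e23 Db1 Db3 d10 d30 cP).
by move=> s t ls st; exact: HP.
Qed.
End GlobalCocycles.

(** * Square roots and residues in completions *)

Section CompletionAbs.
Variables (v : place) (K : completion v).
Implicit Types x y : K.
Local Notation abs := (@compl_abs v K).

Lemma ratr_complB (r s : rat) : (ratr (r - s) : K) = ratr r - ratr s.
Proof. exact: (rmorphB (rat_compl K)). Qed.
Lemma ratr_complD (r s : rat) : (ratr (r + s) : K) = ratr r + ratr s.
Proof. exact: (rmorphD (rat_compl K)). Qed.
Lemma ratr_complM (r s : rat) : (ratr (r * s) : K) = ratr r * ratr s.
Proof. exact: (rmorphM (rat_compl K)). Qed.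
Lemma ratr_complXn (r : rat) n : (ratr (r ^+ n) : K) = ratr r ^+ n.
Proof. exact: (rmorphXn (rat_compl K)). Qed.
Lemma ratr_compl_eq0 (r : rat) : ((ratr r : K) == 0) = (r == 0).
Proof. exact: (fmorph_eq0 (rat_compl K)). Qed.

Lemma compl_abs0 : abs 0 = 0.
Proof.
rewrite -[0 in LHS](rmorph0 (rat_compl K)) rat_complE compl_abs_rat.
by case: (v) => [|p p_pr] /=; rewrite ?padic0 // rmorph0 normr0.
Qed.

Lemma compl_abs1 : abs 1 = 1.
Proof.
rewrite -[1 in LHS](rmorph1 (rat_compl K)) rat_complE compl_abs_rat.
case: (v) => [|p p_pr] /=; first by rewrite rmorph1 normr1.
by have := @padic_int p p_pr 1 isT; rewrite logn1 expr0 invr1.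
Qed.

Lemma compl_abs_eq0P x : (abs x == 0) = (x == 0).
Proof.
apply/eqP/eqP => [|->]; [exact: compl_abs_eq0 | exact: compl_abs0].
Qed.

Lemma compl_abs_gt0 x : (0 < abs x) = (x != 0).
Proof. by rewrite lt_neqAle compl_abs_ge0 andbT eq_sym compl_abs_eq0P. Qed.

Lemma compl_absN x : abs (- x) = abs x.
Proof.
have : abs (-1) ^+ 2 = 1 by rewrite expr2 -compl_absM mulrNN mulr1 compl_abs1.
move=> e; have a1 : abs (-1) = 1.
  by apply/eqP; rewrite -(@eqrXn2 _ 2) ?compl_abs_ge0 // e expr1n.
by rewrite -mulN1r compl_absM a1 mul1r.
Qed.

Lemma compl_absBC x y : abs (x - y) = abs (y - x).
Proof. by rewrite -compl_absN opprB. Qed.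

Lemma compl_absXn x n : abs (x ^+ n) = abs x ^+ n.
Proof. by elim: n => [|n IH]; rewrite ?expr0 ?compl_abs1 // !exprS compl_absM IH. Qed.

Lemma compl_absV x : abs x^-1 = (abs x)^-1.
Proof.
have [->|x0] := eqVneq x 0; first by rewrite invr0 compl_abs0 invr0.
have n0 : abs x != 0 by rewrite compl_abs_eq0P.
by apply: (mulfI n0); rewrite -compl_absM !mulfV // compl_abs1.
Qed.

(** With this, real and p-adic square roots alike reduce to estimates on rational sequences. *)
Lemma compl_sqrt_seq (n : rat) (r : nat -> rat) :
  (forall e : R, 0 < e -> exists N, forall i j, (N <= i)%N -> (N <= j)%N ->
     place_abs v (r i - r j) < e) ->
  (forall e : R, 0 < e -> eventually_nat (fun i => place_abs v (r i ^+ 2 - n) < e)) ->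
  exists u : K, ratr n = u ^+ 2.
Proof.
move=> cr cn; have [|l Hl] := @compl_complete v K (fun i => ratr (r i)).
  move=> e e0; have [N HN] := cr e e0; exists N => i j Ni Nj.
  by rewrite -ratr_complB compl_abs_rat; exact: HN.
exists l; apply/eqP; rewrite eq_sym -subr_eq0 -compl_abs_eq0P; apply/negPn/negP => n0.
have e0 : 0 < abs (l ^+ 2 - ratr n) by rewrite lt_neqAle eq_sym n0 compl_abs_ge0.
set e := abs _ in e0.
pose M := abs (2 * l) + 1.
have M0 : 0 < M by have := compl_abs_ge0 (2 * l); rewrite /M; lra.
pose d := Num.min 1 (e / (2 * M)).
have d0 : 0 < d by rewrite lt_min ltr01 divr_gt0 // mulr_gt0.
have e2 : 0 < e / 2 by rewrite divr_gt0.
have [i [h1 h2]] := eventually_nat_ex (eventually_nat2 (fun i => @conj _ _) (Hl d d0) (cn _ e2)).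
have d1 : d <= 1 by rewrite ge_min lexx.
have dM : d * M <= e / 2.
  have : d <= e / (2 * M) by rewrite ge_min lexx orbT.
  by rewrite ler_pdivlMr ?mulr_gt0 // ler_pdivlMr // -mulrA [M * 2]mulrC.
have : e < e; last by rewrite ltxx.
rewrite {1}/e.
have -> : l ^+ 2 - ratr n = (ratr (r i) ^+ 2 - ratr n) - (ratr (r i) - l) * ((ratr (r i) - l) + 2 * l) by ring.
apply: (le_lt_trans (compl_absD _ _)); rewrite compl_absN compl_absM.
have h3 := compl_absD (ratr (r i) - l) (2 * l).
have h4 : abs (ratr (r i) - l + 2 * l) <= M by rewrite /M; move: h1 h3 d1; lra.
have h5 : abs (ratr (r i) - l) * abs (ratr (r i) - l + 2 * l) <= d * M.
  by apply: ler_pM; rewrite ?compl_abs_ge0 // ltW.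
rewrite -ratr_complXn -ratr_complB compl_abs_rat.
move: h2 h5 dM; lra.
Qed.
End CompletionAbs.

Lemma real_sqrt (K : completion Infinite) (n : rat) : 0 <= n ->
  exists u : K, ratr n = u ^+ 2.
Proof.
move=> n0; pose S := Num.sqrt (ratr n : R).
have S2 : S ^+ 2 = ratr n by rewrite sqr_sqrtr // ler0q.
have S0 : 0 <= S := sqrtr_ge0 _.
have [eps eps0 epsP] : exists2 eps : nat -> R, (forall i, 0 < eps i) &
    forall e : R, 0 < e -> eventually_nat (fun i => eps i < e).
  exists (fun i => i.+1%:R^-1) => [i|]; last exact: small_inv.
  by rewrite invr_gt0 ltr0Sn.
have ex i : exists r : rat, `|(ratr r : R) - S| < eps i.
  have i0 := eps0 i; have [|r] := @rat_in_itvoo R (S - eps i) (S + eps i); first by lra.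
  rewrite in_itv /= => /andP[h1 h2]; exists r; rewrite ltr_norml.
  by apply/andP; split; lra.
pose r i := projT1 (cid (ex i)).
have rP i : `|(ratr (r i) : R) - S| < eps i := projT2 (cid (ex i)).
apply: (@compl_sqrt_seq _ K n r) => e e0 /=.
  have e2 : 0 < e / 2 by rewrite divr_gt0.
  have [N HN] := epsP _ e2; exists N => i j /HN hi /HN hj.
  rewrite rmorphB /=.
  have := rP i; have := rP j; rewrite !ltr_norml => /andP[h1 h2] /andP[h3 h4].
  by apply/andP; split; lra.
have M0 : 0 < 2 * S + 1 by lra.
pose d := e / (2 * S + 1).
have d0 : 0 < d by rewrite divr_gt0.
have de : d * (2 * S + 1) = e by rewrite /d mulfVK // gt_eqF.
apply: eventually_nat2 (epsP _ d0) (epsP _ ltr01) => i hi hi1.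
rewrite rmorphB rmorphXn /= -S2.
have -> : (ratr (r i) : R) ^+ 2 - S ^+ 2 = (ratr (r i) - S) * ((ratr (r i) - S) + 2 * S) by ring.
have h := rP i; have hd := lt_trans h hi; have h1 := lt_trans h hi1.
have h2 : `|(ratr (r i) : R) - S + 2 * S| <= 2 * S + 1.
  apply: (le_trans (ler_normD _ _)); rewrite [`|2 * S|]ger0_norm ?mulr_ge0 //.
  by lra.
rewrite normrM -de.
have [z|z] := eqVneq ((ratr (r i) : R) - S) 0.
  by rewrite z normr0 mul0r mulr_gt0.
apply: (le_lt_trans (ler_wpM2l (normr_ge0 _) h2)).
by rewrite ltr_pM2r.
Qed.

(** * Hensel lifting of square roots *)

Section PadicSqrt.
Variables (p : nat) (p_pr : prime p).
Variable K : completion (Defs.Finite p_pr).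
Local Notation pabs := (padic_abs p).

Let p_gt0 : 0 < (p%:R : R). Proof. by rewrite ltr0n prime_gt0. Qed.
Let pV1 : (p%:R^-1 : R) < 1. Proof. by rewrite invf_lt1 // ltr1n prime_gt1. Qed.

Lemma pV_small (C e : R) : 0 < e -> eventually_nat (fun i => C * p%:R^-1 ^+ i < e).
Proof.
move=> e0; have C0 : 0 < `|C| + 1 by have := normr_ge0 C; lra.
have [N HN] := small_inv (divr_gt0 e0 C0); exists N => i /HN hi.
have le1 : p%:R^-1 ^+ i <= i.+1%:R^-1 :> R.
  rewrite exprVn lef_pV2 ?posrE ?exprn_gt0 ?ltr0Sn //.
  by rewrite -natrX ler_nat ltn_expl // prime_gt1.
rewrite ltr_pdivlMr // in hi.
apply: le_lt_trans hi; rewrite mulrC.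
have h0 : 0 <= p%:R^-1 ^+ i :> R by rewrite exprn_ge0 // invr_ge0 ltW.
apply: (@le_trans _ _ (p%:R^-1 ^+ i * (`|C| + 1))).
  by rewrite ler_wpM2l //; have := ler_norm C; lra.
by rewrite ler_wpM2r // ltW.
Qed.

(* Newton iteration for [a^2 = n], with [w] a fixed approximation to [1/(2a)]. *)
Lemma padic_sqrt (n a w : rat) :
  pabs (1 - 2 * a * w) <= p%:R^-1 -> pabs ((a ^+ 2 - n) * w ^+ 2) <= p%:R^-1 ->
  exists u : K, ratr n = u ^+ 2.
Proof.
move=> H1 H2.
pose r i := iter i (fun x => x - (x ^+ 2 - n) * w) a.
have padicN x : pabs (- x) = pabs x.
  exact: (absvalN (padic_ge0 p) (padic_eq0 p_pr) (padicM p_pr)).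
have abs2 : pabs 2 <= 1.
  by have := @padic_int_dvd p p_pr 2 0; rewrite expr0 invr1 dvd1n => /idP.
have C0 : 0 <= pabs (a ^+ 2 - n) by exact: padic_ge0.
have inv i : [/\ pabs (1 - 2 * r i * w) <= p%:R^-1,
    pabs ((r i ^+ 2 - n) * w ^+ 2) <= p%:R^-1 &
    pabs (r i ^+ 2 - n) <= pabs (a ^+ 2 - n) * p%:R^-1 ^+ i].
  elim: i => [|i [h1 h2 h3]]; first by rewrite expr0 mulr1.
  (* Each step multiplies the error by this factor, both parts of which the invariant bounds by
     [1/p]. *)
  have E : r i.+1 ^+ 2 - n = (r i ^+ 2 - n) * ((1 - 2 * r i * w) + (r i ^+ 2 - n) * w ^+ 2).
    by rewrite /r iterS -/(r i); ring.
  have F : 1 - 2 * r i.+1 * w = (1 - 2 * r i * w) + 2 * ((r i ^+ 2 - n) * w ^+ 2).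
    by rewrite /r iterS -/(r i); ring.
  have le1 : pabs ((1 - 2 * r i * w) + (r i ^+ 2 - n) * w ^+ 2) <= p%:R^-1.
    by apply: le_trans (padicD_max p_pr _ _) _; rewrite ge_max h1 h2.
  have pV0 : 0 <= p%:R^-1 :> R by rewrite invr_ge0 ltW.
  split.
  - rewrite F; apply: le_trans (padicD_max p_pr _ _) _; rewrite ge_max h1 padicM //.
    by rewrite -[X in _ <= X]mul1r; apply: ler_pM; rewrite ?padic_ge0.
  - rewrite E mulrAC padicM //; apply: le_trans h2.
    by rewrite -[X in _ <= X]mulr1 ler_wpM2l ?padic_ge0 // (le_trans le1) // ltW.
  - by rewrite E padicM // [_ ^+ i.+1]exprSr [X in _ <= X]mulrA; apply: ler_pM; rewrite ?padic_ge0.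
have step i : pabs (r i.+1 - r i) <= pabs w * pabs (a ^+ 2 - n) * p%:R^-1 ^+ i.
  have -> : r i.+1 - r i = - ((r i ^+ 2 - n) * w) by rewrite /r iterS -/(r i); ring.
  rewrite padicN padicM // mulrC -mulrA ler_wpM2l ?padic_ge0 //.
  by have [] := inv i.
have decr i k : p%:R^-1 ^+ (i + k) <= p%:R^-1 ^+ i :> R.
  by rewrite ler_wiXn2l ?leq_addr // ?invr_ge0 ltW.
have far i k : pabs (r (i + k)%N - r i) <= pabs w * pabs (a ^+ 2 - n) * p%:R^-1 ^+ i.
  elim: k => [|k IH].
    by rewrite addn0 subrr padic0 !mulr_ge0 ?padic_ge0 // exprn_ge0 // invr_ge0 ltW.
  rewrite addnS.
  have -> : r (i + k).+1 - r i = (r (i + k).+1 - r (i + k)%N) + (r (i + k)%N - r i) by ring.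
  apply: le_trans (padicD_max p_pr _ _) _; rewrite ge_max IH andbT.
  apply: le_trans (step _) _; rewrite ler_wpM2l // ?mulr_ge0 ?padic_ge0 //.
apply: (@compl_sqrt_seq _ K n r) => e e0 /=.
  have [N HN] := pV_small (pabs w * pabs (a ^+ 2 - n)) e0; exists N => i j Ni Nj.
  have hN k : (N <= k)%N -> pabs (r k - r N) < e.
    by move=> Nk; rewrite -(subnKC Nk); apply: le_lt_trans (far _ _) (HN _ _).
  have -> : r i - r j = (r i - r N) + - (r j - r N) by ring.
  by apply: le_lt_trans (padicD_max p_pr _ _) _; rewrite gt_max padicN !hN.
have [N HN] := pV_small (pabs (a ^+ 2 - n)) e0; exists N => i Ni.
by have [_ _ h] := inv i; apply: le_lt_trans h (HN _ _).
Qed.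

Lemma padic_sqrt_odd (n a : int) : odd p -> ~~ (p%:Z %| n)%Z -> (p%:Z %| a ^+ 2 - n)%Z ->
  exists u : K, ratr n%:~R = u ^+ 2.
Proof.
move=> p_odd pn pa.
have pdvd (z : int) : (p%:Z %| z)%Z -> pabs z%:~R <= p%:R^-1.
  by move=> h; rewrite -[p%:R^-1]expr1 exprVn padic_int_dvd // expn1 -dvdzE.
have co : coprimez (2 * a) p%:Z.
  rewrite /coprimez /gcdz /= eqz_nat -/(coprime _ _) coprime_sym prime_coprime //.
  rewrite abszM Euclid_dvdM // negb_or; apply/andP; split.
    by rewrite /= gtnNdvd // ltn_neqAle eq_sym; case: (p) p_pr p_odd => [|[|[|[|]]]].
  apply: contra pn => pa'; have : (p%:Z %| a)%Z by rewrite dvdzE.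
  by move=> h; have := rpredB (dvdz_exp (ltn0Sn 1) h) pa; rewrite opprB addrC subrK.
(* Bezout provides the inverse [w] of [2 a] modulo [p]. *)
have [[w y] /= e] := coprimezP _ _ co.
apply: (@padic_sqrt n%:~R a%:~R w%:~R).
  have -> : 1 - 2 * a%:~R * w%:~R = (y * p%:Z)%:~R :> rat.
    have := congr1 (fun z : int => z%:~R : rat) e.
    by rewrite rmorphD !rmorphM /= => e'; lra.
  by apply: pdvd; exact: dvdz_mull.
have -> : (a%:~R ^+ 2 - n%:~R) * w%:~R ^+ 2 = ((a ^+ 2 - n) * w ^+ 2)%:~R :> rat.
  by rewrite !(rmorphM, rmorphB, rmorphXn).
by apply: pdvd; exact: dvdz_mulr.
Qed.

(** With [a = 1] and [w = 1/2], the first hypothesis of [padic_sqrt] has defect 0 and the second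
    asks that [(1 - n) / 4] be even, which is the condition modulo 8. *)
Lemma padic_sqrt_two (n : int) : p = 2%N -> (8 %| 1 - n)%Z ->
  exists u : K, ratr n%:~R = u ^+ 2.
Proof.
move=> p2 n8; apply: (@padic_sqrt n%:~R 1 (1 / 2)).
  have -> : 1 - 2 * 1 * (1 / 2) = 0 :> rat by field.
  by rewrite padic0 invr_ge0 ltW.
have /dvdzP[k ek] := n8.
have -> : (1 ^+ 2 - n%:~R) * (1 / 2) ^+ 2 = (k * 2)%:~R :> rat.
  have -> : n = 1 - k * 8 by rewrite -ek; ring.
  by rewrite !(rmorphM, rmorphB) /=; field.
rewrite -[p%:R^-1]expr1 exprVn padic_int_dvd // expn1 p2.
by rewrite -[2%N]/(`|2|%N) -dvdzE dvdz_mull.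
Qed.
End PadicSqrt.

(** * Valuations and residues in p-adic completions *)

Section PadicResidues.
Variables (p : nat) (p_pr : prime p).
Variable K : completion (Defs.Finite p_pr).
Implicit Types x y u : K.
Local Notation abs := (@compl_abs _ K).
Local Notation pabs := (padic_abs p).

Let p_gt0 : 0 < (p%:R : R). Proof. by rewrite ltr0n prime_gt0. Qed.
Let p_gt1 : 1 < (p%:R : R). Proof. by rewrite ltr1n prime_gt1. Qed.
Let pV1 : (p%:R^-1 : R) < 1. Proof. by rewrite invf_lt1 // ltr1n prime_gt1. Qed.

Lemma compl_absE (r : rat) : abs (ratr r) = pabs r.
Proof. exact: compl_abs_rat. Qed.

Lemma compl_ultra x y : abs (x + y) <= Num.max (abs x) (abs y).
Proof.
rewrite leNgt; apply/negP; set m := Num.max _ _ => h.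
(* Rational approximation costs at most [3 e] in total, so a quarter of the supposed gap suffices
   for a contradiction. *)
pose e := (abs (x + y) - m) / 4.
have e0 : 0 < e by rewrite divr_gt0 // subr_gt0.
have [r Hr] := compl_dense x e0; have [s Hs] := compl_dense y e0.
have xm : abs x <= m by rewrite le_max lexx.
have ym : abs y <= m by rewrite le_max lexx orbT.
have h1 := compl_absD (x - ratr r) (y - ratr s).
have h2 := compl_absD ((x - ratr r) + (y - ratr s)) (ratr (r + s)).
have E : x - ratr r + (y - ratr s) + ratr (r + s) = x + y.
  by rewrite ratr_complD; ring.
rewrite E compl_absE in h2.
have h3 := padicD_max p_pr r s.
have h4 := compl_absD (ratr r - x) x; rewrite subrK compl_absE compl_absBC in h4.
have h5 := compl_absD (ratr s - y) y; rewrite subrK compl_absE compl_absBC in h5.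
have h6 : Num.max (pabs r) (pabs s) <= m + e.
  by rewrite ge_max; apply/andP; split; lra.
have E' : abs (x + y) = m + 4 * e by rewrite /e; field.
by lra.
Qed.

Lemma compl_ultra_lt x y c : abs x < c -> abs y < c -> abs (x + y) < c.
Proof. by move=> hx hy; apply: le_lt_trans (compl_ultra _ _) _; rewrite gt_max hx hy. Qed.

Lemma compl_ultra_le x y c : abs x <= c -> abs y <= c -> abs (x + y) <= c.
Proof. by move=> hx hy; apply: le_trans (compl_ultra _ _) _; rewrite ge_max hx hy. Qed.

Lemma compl_ultra_eq x y : abs x < abs y -> abs (x + y) = abs y.
Proof.
move=> h; apply/eqP; rewrite eq_le; apply/andP; split.
  by apply: compl_ultra_le => //; exact: ltW.
rewrite leNgt; apply/negP => h'.
have : abs ((x + y) - x) < abs y by apply: compl_ultra_lt; rewrite ?compl_absN.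
by rewrite addrC addKr ltxx.
Qed.

(** A rational closer to [x] than [abs x] has the same absolute value, so [K] has the value group of
    the rationals. *)
Lemma compl_abs_ratP x : x != 0 -> exists2 r : rat, r != 0 & abs x = pabs r.
Proof.
rewrite -compl_abs_gt0 => x0; have [r Hr] := compl_dense x x0.
have e : abs x = pabs r.
  have := @compl_ultra_eq (ratr r - x) x; rewrite compl_absBC subrK => /(_ Hr).
  by rewrite compl_absE.
exists r => //; apply: contraTneq x0 => r0.
by rewrite e r0 padic0 ltxx.
Qed.

Lemma pabs_val (r : rat) : r != 0 -> exists a b : nat, pabs r = p%:R ^+ a / p%:R ^+ b.
Proof. by rewrite /padic_abs => /negPf ->; eexists; eexists. Qed.

Lemma pabs_lt1 (r : rat) : pabs r < 1 -> pabs r <= p%:R^-1.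
Proof.
have [->|/pabs_val[a [b ->]]] := eqVneq r 0.
  by rewrite padic0 invr_ge0 ltW.
rewrite ltr_pdivrMr ?exprn_gt0 // mul1r ltr_eXn2l // => ab.
by rewrite ler_pdivrMr ?exprn_gt0 // ler_pdivlMl // -exprS ler_eXn2l.
Qed.

Lemma compl_abs_lt1 x : abs x < 1 -> abs x <= p%:R^-1.
Proof.
have [->|/compl_abs_ratP[r _ ->]] := eqVneq x 0; last exact: pabs_lt1.
by rewrite compl_abs0 invr_ge0 ltW.
Qed.

Lemma compl_abs_sqr_neq u : abs u ^+ 2 != p%:R^-1.
Proof.
have [->|/compl_abs_ratP[r r0 ->]] := eqVneq u 0.
  by rewrite compl_abs0 expr0n eq_sym invr_eq0 gt_eqF.
have [a [b ->]] := pabs_val r0; apply/eqP => e.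
have : p%:R ^+ (a * 2).+1 = p%:R ^+ (b * 2) :> R.
  rewrite exprS !exprM; apply: (mulfI (invr_neq0 (lt0r_neq0 p_gt0))).
  rewrite mulKf ?gt_eqF // -e; field.
  by rewrite gt_eqF // exprn_gt0.
by move/(ieexprIn p_gt0 (negbT (gt_eqF p_gt1))); lia.
Qed.

(** Even valuation, expressed in the value group instead of through an integer valued function. *)
Definition even_val x := exists2 r : rat, r != 0 & abs x = pabs r ^+ 2.

Lemma even_val_sqr u : u != 0 -> even_val (u ^+ 2).
Proof. by move=> /compl_abs_ratP[r r0 e]; exists r => //; rewrite compl_absXn e. Qed.

Lemma even_valM x y : even_val x -> even_val y -> even_val (x * y).
Proof.
move=> [r r0 er] [s s0 es]; exists (r * s); first by rewrite mulf_neq0.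
by rewrite compl_absM er es padicM // exprMn.
Qed.

Lemma even_valV x : even_val x -> even_val x^-1.
Proof.
move=> [r r0 e]; exists r^-1; first by rewrite invr_eq0.
rewrite compl_absV e (absvalV (padic_eq0 p_pr) (padic0 p) (padicM p_pr)).
by rewrite exprVn.
Qed.

Lemma even_val_unit x : abs x = 1 -> even_val x.
Proof.
exists 1 => //; rewrite (absval1 (padic_eq0 p_pr) (padicM p_pr)).
by rewrite expr1n.
Qed.

Lemma even_val_cancel x y : y != 0 -> even_val y -> even_val (x * y) -> even_val x.
Proof.
by move=> y0 /even_valV ey exy; rewrite -(mulfK y0 x); exact: even_valM.
Qed.

Lemma compl_abs_int (z : int) : abs z%:~R = pabs z%:~R.
Proof. by rewrite -compl_absE ratr_int. Qed.

Lemma compl_abs_int_le1 (z : int) : abs z%:~R <= 1.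
Proof.
by rewrite compl_abs_int; have := @padic_int_dvd p p_pr z 0; rewrite expr0 invr1 dvd1n.
Qed.

Lemma compl_abs_int_lt1 (z : int) : (abs z%:~R < 1) = (p%:Z %| z)%Z.
Proof.
have e : (p%:Z %| z)%Z = (abs z%:~R <= p%:R^-1).
  by rewrite compl_abs_int -[p%:R^-1]expr1 exprVn padic_int_dvd // expn1 dvdzE.
rewrite e; apply/idP/idP => h; first exact: compl_abs_lt1.
exact: le_lt_trans h pV1.
Qed.

Lemma compl_abs_int_unit (z : int) : ~~ (p%:Z %| z)%Z -> abs z%:~R = 1.
Proof.
rewrite -compl_abs_int_lt1 -leNgt => h; apply/eqP.
by rewrite eq_le h compl_abs_int_le1.
Qed.

Lemma even_val_int (z : int) : z != 0 -> even_val z%:~R -> ~~ odd (logn p `|z|%N).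
Proof.
move=> z0 [r r0]; rewrite compl_abs_int padic_int //.
have [a [b ->]] := pabs_val r0 => e.
have : p%:R ^+ (a * 2 + logn p `|z|%N)%N = p%:R ^+ (b * 2) :> R.
  have n0 k : (p%:R ^+ k : R) != 0 by rewrite expf_neq0 // gt_eqF.
  rewrite exprD !exprM; apply: (mulIf (invr_neq0 (n0 (logn p `|z|%N)))).
  rewrite mulfK // e; field; exact: n0.
move/(ieexprIn p_gt0 (negbT (gt_eqF p_gt1))) => h.
have := congr1 odd h; rewrite oddD !oddM !andbF /= => ->.
by [].
Qed.

(** Approximate [u] by a rational; its denominator is prime to [p] and can be inverted modulo
    [p]. *)
Lemma compl_residue u : abs u <= 1 -> exists a : int, abs (u - a%:~R) < 1.
Proof.
move=> u1; have [r Hr] := compl_dense u (ltr01 : 0 < 1 :> R).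
have r1 : pabs r <= 1.
  rewrite -compl_absE -[ratr r](subrK u) addrC; apply: compl_ultra_le => //.
  by rewrite compl_absBC ltW.
have co : coprimez (denq r) p%:Z.
  rewrite /coprimez /gcdz /= eqz_nat -/(coprime _ _) coprime_sym prime_coprime //.
  apply/negP => pd; have [r0|r0] := eqVneq r 0.
    by move: pd; rewrite r0 /= dvdn1 => /eqP p1; move: p_pr; rewrite p1.
  move: r1; rewrite /padic_abs (negPf r0) ler_pdivrMr ?exprn_gt0 // mul1r ler_eXn2l //.
  have h : (0 < logn p `|denq r|)%N by rewrite logn_gt0 mem_primes p_pr pd absz_gt0 denq_neq0.
  move=> h'; have : (0 < logn p `|numq r|)%N by exact: leq_trans h'.
  rewrite logn_gt0 mem_primes => /and3P[_ _ pn].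
  have := coprime_num_den r; rewrite /coprime => /eqP g.
  have : (p %| gcdn `|numq r| `|denq r|)%N by rewrite dvdn_gcd pn pd.
  by rewrite g dvdn1 => /eqP p1; move: p_pr; rewrite p1.
have [[c y] /= e] := coprimezP _ _ co.
have De : (denq r)%:~R != 0 :> K.
  rewrite -(ratr_int K) ratr_compl_eq0 intr_eq0; exact: denq_neq0.
exists (numq r * c).
have -> : u - (numq r * c)%:~R = (u - ratr r) + ratr r * (y * p%:Z)%:~R.
  have e' := congr1 (fun z : int => z%:~R : K) e; rewrite rmorphD !rmorphM /= in e'.
  rewrite !rmorphM /= -[y%:~R * _](addKr (c%:~R * (denq r)%:~R)) e'.
  by rewrite /ratr; field.
apply: compl_ultra_lt => //; rewrite compl_absM compl_absE.
apply: (@le_lt_trans _ _ (1 * abs (y * p%:Z)%:~R)).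
  by rewrite ler_wpM2r ?compl_abs_ge0.
by rewrite mul1r compl_abs_int_lt1 dvdz_mull.
Qed.

Lemma compl_sqr_residue u (n : int) : abs (u ^+ 2 - n%:~R) < 1 ->
  exists a : int, (p%:Z %| a ^+ 2 - n)%Z.
Proof.
move=> h; have u1 : abs u <= 1.
  rewrite leNgt; apply/negP => u1.
  have : abs (u ^+ 2) <= 1.
    rewrite -[u ^+ 2](subrK n%:~R); apply: compl_ultra_le; first exact: ltW.
    exact: compl_abs_int_le1.
  by rewrite compl_absXn leNgt exprn_egt1.
have [a Ha] := compl_residue u1; exists a; rewrite -compl_abs_int_lt1.
have -> : (a ^+ 2 - n)%:~R = (a%:~R - u) * (a%:~R + u) + (u ^+ 2 - n%:~R) :> K.
  by rewrite rmorphB rmorphXn /=; ring.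
apply: compl_ultra_lt => //; rewrite compl_absM compl_absBC.
have h1 : abs (a%:~R + u) <= 1 by apply: compl_ultra_le => //; exact: compl_abs_int_le1.
apply: (@le_lt_trans _ _ (abs (u - a%:~R) * 1)); last by rewrite mulr1.
by rewrite ler_wpM2l ?compl_abs_ge0.
Qed.

(** If [abs X > 1], the three differences have the valuation of [X], so their product shows that
    [X ^+ 3], hence [X] and [d1], has even valuation. If [X] is integral and not congruent to [e1],
    then [X - e1] is a unit. If it is congruent to [e1], the other two differences are units, so
    [d2] and [d3] are even, and with them [d1]. *)
Lemma even_val_first (X e1 e2 e3 d1 d2 d3 u1 u2 u3 : K) :
  abs e1 <= 1 -> abs (e1 - e2) = 1 -> abs (e1 - e3) = 1 ->
  d1 != 0 -> d2 != 0 -> d3 != 0 -> even_val (d1 * d2 * d3) ->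
  X - e1 = d1 * u1 ^+ 2 -> X - e2 = d2 * u2 ^+ 2 -> X - e3 = d3 * u3 ^+ 2 ->
  even_val d1.
Proof.
move=> a1 a12 a13 d10 d20 d30 ed E1 E2 E3.
have unit_even e d u : X - e = d * u ^+ 2 -> abs (X - e) = 1 -> even_val d.
  move=> E h; have u0 : u != 0.
    by apply: contra_eqN h => /eqP u0; rewrite E u0 expr0n mulr0 compl_abs0 eq_sym oner_eq0.
  apply: (@even_val_cancel _ (u ^+ 2)); first by rewrite expf_neq0.
    exact: even_val_sqr.
  by rewrite -E; exact: even_val_unit.
have a2 : abs e2 <= 1.
  have -> : e2 = e1 + - (e1 - e2) by ring.
  by apply: compl_ultra_le => //; rewrite compl_absN a12.
have a3 : abs e3 <= 1.
  have -> : e3 = e1 + - (e1 - e3) by ring.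
  by apply: compl_ultra_le => //; rewrite compl_absN a13.
have [X1|X1] := ltP 1 (abs X).
  have big e : abs e <= 1 -> abs (X - e) = abs X.
    by move=> h; rewrite addrC; apply: compl_ultra_eq; rewrite compl_absN; exact: le_lt_trans X1.
  have X0 : X != 0 by rewrite -compl_abs_gt0 (lt_trans ltr01).
  have nz e d u : abs e <= 1 -> X - e = d * u ^+ 2 -> u != 0.
    move=> /big h E; apply: contra_neq X0 => u0; apply/eqP; rewrite -compl_abs_eq0P -h E u0.
    by rewrite expr0n mulr0 compl_abs0.
  have u10 := nz _ _ _ a1 E1; have u20 := nz _ _ _ a2 E2; have u30 := nz _ _ _ a3 E3.
  have eX3 : even_val (X ^+ 3).
    have [r r0 er] : even_val ((d1 * d2 * d3) * (u1 * u2 * u3) ^+ 2).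
      by apply: even_valM => //; apply: even_val_sqr; rewrite !mulf_neq0.
    exists r => //; rewrite -er.
    have -> : d1 * d2 * d3 * (u1 * u2 * u3) ^+ 2 = (X - e1) * (X - e2) * (X - e3).
      by rewrite E1 E2 E3; ring.
    by rewrite compl_absXn 2!compl_absM !big //; ring.
  have eX : even_val X.
    apply: (@even_val_cancel _ (X ^+ 2)); rewrite ?expf_neq0 //; exact: even_val_sqr.
  apply: (@even_val_cancel _ (u1 ^+ 2)); first by rewrite expf_neq0.
    exact: even_val_sqr.
  by case: eX => r r0 er; exists r => //; rewrite -E1 big.
have le1 : abs (X - e1) <= 1 by apply: compl_ultra_le => //; rewrite compl_absN.
have [h|h] := ltP (abs (X - e1)) 1; last first.
  by apply: (unit_even e1 d1 u1) => //; apply/eqP; rewrite eq_le h le1.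
have other e : abs (e1 - e) = 1 -> abs (X - e) = 1.
  move=> he; have -> : X - e = (X - e1) + (e1 - e) by ring.
  by rewrite compl_ultra_eq ?he.
have ed2 := unit_even _ _ _ E2 (other _ a12).
have ed3 := unit_even _ _ _ E3 (other _ a13).
apply: (@even_val_cancel _ (d2 * d3)); rewrite ?mulf_neq0 //; first exact: even_valM.
by rewrite mulrA.
Qed.
End PadicResidues.

(** * Quadratic characters *)

Section QuadraticCharacter.
Variable F : finFieldType.
Implicit Types a b x y : F.

Definition is_sqr a := [exists y : F, y ^+ 2 == a].

Lemma is_sqrP a : reflect (exists y, y ^+ 2 = a) (is_sqr a).
Proof. by apply: (iffP existsP) => -[y /eqP]; exists y => //; apply/eqP. Qed.

Lemma is_sqr0 : is_sqr 0. Proof. by apply/is_sqrP; exists 0; rewrite expr0n. Qed.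

Lemma is_sqrX y : is_sqr (y ^+ 2). Proof. by apply/is_sqrP; exists y. Qed.

Lemma is_sqrM a b : is_sqr a -> is_sqr b -> is_sqr (a * b).
Proof. by move=> /is_sqrP[x <-] /is_sqrP[y <-]; rewrite -exprMn is_sqrX. Qed.

Lemma is_sqrV a : is_sqr a -> is_sqr a^-1.
Proof. by move=> /is_sqrP[x <-]; rewrite -exprVn is_sqrX. Qed.

Let U := [set x : F | x != 0].
Let S := [set a : F | (a != 0) && is_sqr a].

Lemma card_nonzero_le : (#|U| <= 2 * #|S|)%N.
Proof.
have -> : #|U| = (\sum_(a in S) \sum_(y in U | (y ^+ 2)%R == a) 1)%N.
  rewrite -sum1_card (partition_big (fun y : F => y ^+ 2) (mem S)) //= => y.
  by rewrite !inE => y0; rewrite expf_neq0 // is_sqrX.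
rewrite mulnC -sum_nat_const; apply: leq_sum => a; rewrite inE => /andP[a0 /is_sqrP[z zz]].
rewrite sum1dep_card; apply: (@leq_trans #|[set z; - z]|); last by rewrite cards2; case: eqP.
apply: subset_leq_card; apply/fintype.subsetP => y; rewrite !inE => /andP[_].
by rewrite -zz eqf_sqr.
Qed.

(** At least half of the nonzero elements are squares. The nonzero squares and their multiples by
    [a] are disjoint, so they exhaust the nonzero elements and [b] is [a] times a square. *)
Lemma nonsqrM a b : ~~ is_sqr a -> ~~ is_sqr b -> is_sqr (a * b).
Proof.
move=> na nb.
have a0 : a != 0 by apply: contraNneq na => ->; rewrite is_sqr0.
have b0 : b != 0 by apply: contraNneq nb => ->; rewrite is_sqr0.
pose aS := [set a * x | x in S].
have caS : #|aS| = #|S| by rewrite card_imset //; exact: mulfI.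
have dis : [disjoint S & aS].
  apply/pred0P => x /=; apply/negP => /andP[]; rewrite inE => /andP[_ sx] /imsetP[y].
  rewrite inE => /andP[y0 sy] e; case/negP: na.
  by rewrite -(mulfK y0 a) -e is_sqrM // is_sqrV.
have sub : S :|: aS \subset U.
  apply/fintype.subsetP => x; rewrite !inE => /orP[/andP[]//|/imsetP[y]].
  by rewrite inE => /andP[y0 _] ->; rewrite mulf_neq0.
have cU : #|S :|: aS| = (2 * #|S|)%N.
  by rewrite cardsU caS disjoint_setI0 // cards0 subn0 mul2n addnn.
have /eqP E : S :|: aS == U.
  by rewrite eqEcard sub cU card_nonzero_le.
have : b \in S :|: aS by rewrite E inE.
rewrite !inE (negPf nb) andbF /= => /imsetP[y]; rewrite inE => /andP[_ sy] ->.
by rewrite mulrA is_sqrM // -expr2 is_sqrX.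
Qed.

Definition chi a : int := if a == 0 then 0 else if is_sqr a then 1 else -1.

Lemma chi0 : chi 0 = 0. Proof. by rewrite /chi eqxx. Qed.

Lemma chi1 : chi 1 = 1.
Proof. by rewrite /chi oner_eq0 -[X in is_sqr X](expr1n F 2) is_sqrX. Qed.

Lemma chiM a b : chi (a * b) = chi a * chi b.
Proof.
rewrite /chi mulf_eq0; case: eqP => [_|/eqP a0] /=; first by rewrite mul0r.
case: eqP => [_|/eqP b0] /=; first by rewrite mulr0.
have [sa|na] := boolP (is_sqr a); have [sb|nb] := boolP (is_sqr b).
- by rewrite is_sqrM.
- rewrite ifN //; apply: contra nb => h.
  by rewrite -(mulKf a0 b) is_sqrM // is_sqrV.
- rewrite ifN //; apply: contra na => h.
  by rewrite -(mulfK b0 a) is_sqrM // is_sqrV.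
- by rewrite nonsqrM.
Qed.

Lemma chi_sqr a : a != 0 -> chi a * chi a = 1.
Proof. by rewrite /chi => /negPf ->; case: is_sqr. Qed.

Lemma chiV a : chi a^-1 = chi a.
Proof.
have [->|a0] := eqVneq a 0; first by rewrite invr0.
have c0 : chi a != 0 by apply: contra_eq_neq (chi_sqr a0) => ->; rewrite mul0r eq_sym oner_eq0.
by apply: (mulfI c0); rewrite -chiM mulfV // chi1 chi_sqr.
Qed.

Lemma chi_ge a : -1 <= chi a. Proof. by rewrite /chi; case: ifP => // _; case: ifP. Qed.
Variable nu : F.
Hypothesis nu_nonsqr : ~~ is_sqr nu.

Lemma nu0 : nu != 0.
Proof. by apply: contraNneq nu_nonsqr => ->; rewrite is_sqr0. Qed.

Lemma sum_chi : \sum_x chi x = 0.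
Proof.
have e : \sum_x chi x = - \sum_x chi x.
  rewrite {1}(reindex_inj (mulfI nu0)) -sumrN; apply: eq_bigr => x _.
  by rewrite chiM {1}/chi (negPf nu0) (negPf nu_nonsqr) mulN1r.
by move: e; lia.
Qed.

Lemma sum_chi_shift a : \sum_x chi (x - a) = 0.
Proof. by rewrite -[RHS]sum_chi [RHS](reindex_inj (addIr (- a))). Qed.

(** Substituting [x = b + 1/y] turns the summand into [chi (1 + (b - a) y)]. Over all [y] this sums
    to 0, and the missing term [y = 0] is [chi 1 = 1]. *)
Lemma sum_chi2 a b : a != b -> \sum_x chi (x - a) * chi (x - b) = -1.
Proof.
move=> ab; have c0 : b - a != 0 by rewrite subr_eq0 eq_sym.
have E : \sum_x chi (1 + (b - a) * x) = 0.
  rewrite -[RHS]sum_chi [RHS](reindex_inj (addrI 1)).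
  by rewrite [RHS](reindex_inj (mulfI c0)).
rewrite (reindex_inj (addIr b)) /=.
rewrite (reindex_inj (inv_inj (@invrK F))) /=.
rewrite (bigD1 0) //= in E.
rewrite mulr0 addr0 chi1 in E.
rewrite (bigD1 0) //= invr0 addrK chi0 mulr0 add0r.
rewrite (eq_bigr (fun x => chi (1 + (b - a) * x))); first by apply/eqP; rewrite -addr_eq0 addrC; apply/eqP.
move=> x x0; rewrite addrK chiV -chiM; congr chi; rewrite -addrA mulrDl mulVf //.
Qed.

(** Expand the sum of [(1 - A)(1 - B)(1 + C)]: the linear terms vanish, the quadratic ones give -1 +
    1 + 1, and [1 + A B C] is nonnegative termwise. The sum is positive, and a nonzero term is the
    required [x]. *)
Lemma chi_triple a b c : a != b -> a != c -> b != c ->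
  exists x, [/\ chi (x - a) != 1, chi (x - b) != 1 & chi (x - c) != -1].
Proof.
move=> ab ac bc.
pose A x := chi (x - a); pose B x := chi (x - b); pose C x := chi (x - c).
have S0 : 0 < \sum_x (1 - A x) * (1 - B x) * (1 + C x).
  have -> : \sum_x (1 - A x) * (1 - B x) * (1 + C x) =
     \sum_x (1 + A x * B x * C x) + (- \sum_x A x - \sum_x B x + \sum_x C x)
     + (\sum_x A x * B x - \sum_x A x * C x - \sum_x B x * C x).
    rewrite -!sumrN -!big_split /=; apply: eq_bigr => x _; ring.
  rewrite /A /B /C !sum_chi_shift !sum_chi2 //.
  have h (y : F) : 0 <= 1 + chi (y - a) * chi (y - b) * chi (y - c).
    by rewrite -!chiM; have := chi_ge ((y - a) * (y - b) * (y - c)); lia.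
  rewrite (bigD1 a) //= (bigD1 b) 1?eq_sym //= subrr chi0 !(mul0r, mulr0).
  have := chi_ge 0; set s := \sum_(i | _) _.
  have s0 : 0 <= s by apply: sumr_ge0 => y _; exact: h.
  by rewrite subrr chi0 ?(mul0r, mulr0); move: s0; lia.
have [x Hx] : exists x, (1 - A x) * (1 - B x) * (1 + C x) != 0.
  apply/existsP; apply: contraTT S0 => /existsPn nx.
  by rewrite big1 // => x _; apply/eqP; have := nx x; rewrite negbK.
exists x; move: Hx; rewrite !mulf_eq0 !negb_or subr_eq0 subr_eq0 addr_eq0 => /andP[/andP[h1 h2] h3].
by split; rewrite eq_sym // eqr_oppLR.
Qed.
End QuadraticCharacter.

(** * Quadratic residues modulo a prime *)

Definition qr (p : nat) (n : int) : Prop := exists a : int, (p%:Z %| a ^+ 2 - n)%Z.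

Section PrimeField.
Variable p : nat.
Hypothesis p_pr : prime p.

Lemma Fp_int_eq0 (z : int) : (z%:~R == 0 :> 'F_p) = (p%:Z %| z)%Z.
Proof.
rewrite dvdzE /=; have h n : (n%:R == 0 :> 'F_p) = (p %| n)%N.
  by rewrite -(dvdn_pcharf (pchar_Fp p_pr)).
by case: z => n; rewrite ?NegzE ?mulrNz ?oppr_eq0 -pmulrn h.
Qed.

Lemma Fp_int_surj (x : 'F_p) : exists z : int, x = z%:~R.
Proof. by exists (val x)%:Z; rewrite -pmulrn natr_Zp. Qed.

Lemma Fp_is_sqr (z : int) : is_sqr (z%:~R : 'F_p) <-> qr p z.
Proof.
split=> [/is_sqrP[y]|[a]].
  have [a ->] := Fp_int_surj y => e; exists a.
  by rewrite -Fp_int_eq0 rmorphB rmorphXn /= e subrr.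
rewrite -Fp_int_eq0 rmorphB rmorphXn /= subr_eq0 => /eqP e.
by apply/is_sqrP; exists a%:~R.
Qed.

Lemma Fp_two_neq0 : odd p -> (2 : 'F_p) != 0.
Proof.
move=> p_odd; rewrite -[2]/(2%:~R) Fp_int_eq0 dvdzE /= gtnNdvd //.
by case: (p) p_pr p_odd => [|[|[]]].
Qed.

Lemma qrM (a b : int) : qr p a -> qr p b -> qr p (a * b).
Proof. by move=> /Fp_is_sqr sa /Fp_is_sqr sb; apply/Fp_is_sqr; rewrite rmorphM is_sqrM. Qed.

(* The first alternatives ensure that a nonzero [x - a] is prime to [p], so that
   its square class in Q_p can be read off modulo [p]. *)
Lemma integer_triple (a b c d : int) :
  ~~ (p%:Z %| a - b)%Z -> ~~ (p%:Z %| a - c)%Z -> ~~ (p%:Z %| b - c)%Z -> ~ qr p d ->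
  exists x : int,
   [/\ x = a \/ (~~ (p%:Z %| x - a)%Z /\ qr p ((x - a) * d)),
       x = b \/ (~~ (p%:Z %| x - b)%Z /\ qr p ((x - b) * d)) &
       x = c \/ (~~ (p%:Z %| x - c)%Z /\ qr p (x - c))].
Proof.
move=> ab ac bc nd.
have nd' : ~~ is_sqr (d%:~R : 'F_p) by apply/negP => /Fp_is_sqr.
have neq (u v : int) : ~~ (p%:Z %| u - v)%Z -> (u%:~R : 'F_p) != v%:~R.
  by rewrite -Fp_int_eq0 rmorphB /= subr_eq0.
have [y [h1 h2 h3]] := chi_triple nd' (neq _ _ ab) (neq _ _ ac) (neq _ _ bc).
have [x0 Dx0] := Fp_int_surj y.
have [x Dx [xa xb xc]] : exists2 x : int, y = x%:~R &
   [/\ x = a \/ ~~ (p%:Z %| x - a)%Z, x = b \/ ~~ (p%:Z %| x - b)%Z & x = c \/ ~~ (p%:Z %| x - c)%Z].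
  have neqC (u v : int) : (p%:Z %| u - v)%Z = (p%:Z %| v - u)%Z by rewrite -opprB rpredN.
  have [ya|ya] := eqVneq y a%:~R.
    by exists a => //; split; [left|right|right].
  have [yb|yb] := eqVneq y b%:~R.
    by exists b => //; split; [right; rewrite neqC|left|right].
  have [yc|yc] := eqVneq y c%:~R.
    by exists c => //; split; [right; rewrite neqC|right; rewrite neqC|left].
  have n0 (u : int) : y != u%:~R -> ~~ (p%:Z %| x0 - u)%Z.
    by rewrite Dx0 -Fp_int_eq0 rmorphB subr_eq0.
  by exists x0 => //; split; right; exact: n0.
have nsq (u : int) : chi (y - u%:~R) != 1 -> ~~ (p%:Z %| x - u)%Z -> qr p ((x - u) * d).
  rewrite /chi Dx -rmorphB Fp_int_eq0 => /[swap] /negPf -> /=.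
  case: (boolP (is_sqr _)) => // ns _; apply/Fp_is_sqr; rewrite rmorphM.
  exact: nonsqrM.
have sq (u : int) : chi (y - u%:~R) != -1 -> ~~ (p%:Z %| x - u)%Z -> qr p (x - u).
  rewrite /chi Dx -rmorphB Fp_int_eq0 => /[swap] /negPf -> /=.
  by case: (boolP (is_sqr _)) => // s _; apply/Fp_is_sqr.
exists x; split.
- by case: xa => [|n]; [left | right; split=> //; exact: nsq].
- by case: xb => [|n]; [left | right; split=> //; exact: nsq].
- by case: xc => [|n]; [left | right; split=> //; exact: sq].
Qed.

(** A square root [x] of -1 has order 4, so [x ^+ p = x ^+ 3 = - x], against Fermat. *)
Lemma nqr_opp1 : p = 3 %[mod 4] -> ~ qr p (-1).
Proof.
move=> p4 /Fp_is_sqr /is_sqrP[x x2].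
have xp : x ^+ p = x by have := expf_card x; rewrite card_Fp.
have x0 : x != 0 by apply: contra_eq_neq x2 => ->; rewrite expr0n eq_sym mulrN1z oppr_eq0 oner_eq0.
have Dp : p = (4 * (p %/ 4) + 3)%N by rewrite {1}(divn_eq p 4) p4 mulnC.
have p_odd : odd p by rewrite Dp oddD oddM.
have two0 := Fp_two_neq0 p_odd.
have x4 : x ^+ 4 = 1 by rewrite (exprM x 2 2) x2 -rmorphXn.
have xn n k : n = (4 * k + 3)%N -> x ^+ n = x ^+ 3.
  by move=> ->; rewrite exprD exprM x4 expr1n mul1r.
have x3 : x ^+ 3 = x by rewrite -[RHS]xp (xn _ _ Dp).
have : x ^+ 2 = 1 by apply: (mulfI x0); rewrite -exprS x3 mulr1.
rewrite x2 => /eqP; rewrite mulrN1z -subr_eq0 -opprD oppr_eq0.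
by rewrite -[1 + 1]/(2%:R) (negPf two0).
Qed.

Lemma frobenius_fixed (F : fieldType) (i : {rmorphism 'F_p -> F}) (t : F) :
  t ^+ p = t -> exists x, t = i x.
Proof.
move=> tp; have E : (map_poly i ('X^p - 'X)).[t] = 0.
  by rewrite rmorphB /= map_polyXn map_polyX hornerD hornerN hornerXn hornerX tp subrr.
have G : 'X^p - 'X = \prod_(x : 'F_p) ('X - x%:P) :> {poly 'F_p}.
  by rewrite -finField_genPoly card_Fp.
move: E; rewrite G rmorph_prod horner_prod => /eqP.
rewrite prodf_seq_eq0 => /hasP[x _ /=]; rewrite map_polyXsubC hornerXsubC subr_eq0 => /eqP ->.
by exists x.
Qed.

Lemma qr_of_sqrt (F : fieldType) (i : {rmorphism 'F_p -> F}) (t : F) (n : int) :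
  t ^+ p = t -> t ^+ 2 = n%:~R -> qr p n.
Proof.
move=> /(frobenius_fixed i)[x ->] e; apply/Fp_is_sqr/is_sqrP; exists x.
by apply: (fmorph_inj i); rewrite rmorphXn /= e rmorph_int.
Qed.

Lemma pchar_Fp_ext (F : fieldType) (i : {rmorphism 'F_p -> F}) : p \in [pchar F].
Proof. by rewrite (fmorph_pchar i) pchar_Fp. Qed.

(* With [z] a primitive 8th root of unity, [z + z^-1] is a square root of 2. *)
Lemma qr_two : p = 7 %[mod 8] -> qr p 2.
Proof.
move=> p8; have s5 : size ('X^4 + 1 : {poly 'F_p}) = 5%N.
  by rewrite size_polyDl ?size_polyXn // size_poly1.
have [|F [i [z]]] := @root_extension _ ('X^4 + 1 : {poly 'F_p}); first by rewrite s5.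
rewrite rmorphD rmorph1 /= map_polyXn rootE hornerD hornerXn hornerC addr_eq0 => /eqP z4.
have z0 : z != 0 by apply: contra_eq_neq z4 => ->; rewrite expr0n eq_sym oppr_eq0 oner_eq0.
have z8 : z ^+ 8 = 1 by rewrite (exprM z 4 2) z4 sqrrN expr1n.
have Dp : p = (8 * (p %/ 8) + 7)%N by rewrite {1}(divn_eq p 8) p8 mulnC.
have zp : z ^+ p = z^-1.
  apply: (mulfI z0); rewrite -exprS mulfV // Dp -addnS -[7.+1]/(8 * 1)%N -mulnDr.
  by rewrite exprM z8 expr1n.
apply: (@qr_of_sqrt F i (z + z^-1)).
  have := pFrobenius_autD_comm (pchar_Fp_ext i) (mulrC z z^-1).
  by rewrite !pFrobenius_autE => ->; rewrite exprVn zp invrK addrC.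
have -> : (z + z^-1) ^+ 2 = z ^- 2 * (z ^+ 4 + 1) + 2 by field.
by rewrite z4 addNr mulr0 add0r.
Qed.

End PrimeField.

(** * Gauss sums and reciprocity *)

Section GaussSum.
Variables (q : nat) (q_pr : prime q) (F : fieldType) (z : F).
Hypothesis zq : z ^+ q = 1.
Hypothesis z1 : z != 1.

Definition Fp_exp (a : 'F_q) : F := z ^+ val a.

Lemma Fp_expD a b : Fp_exp (a + b) = Fp_exp a * Fp_exp b.
Proof.
have zn n : n = q -> z ^+ n = 1 by move=> ->.
by rewrite /Fp_exp /= (expr_mod _ (zn _ (Fp_cast q_pr))) exprD.
Qed.

Lemma Fp_exp0 : Fp_exp 0 = 1. Proof. by []. Qed.

Lemma Fp_exp_natmul a n : Fp_exp (a *+ n) = Fp_exp a ^+ n.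
Proof.
elim: n => [|n IH]; first by rewrite mulr0n expr0.
by rewrite mulrS Fp_expD IH exprS.
Qed.

Lemma sum_Fp_exp : \sum_a Fp_exp a = 0.
Proof.
have e : \sum_a Fp_exp a = z * \sum_a Fp_exp a.
  rewrite {1}(reindex_inj (addrI 1)) mulr_sumr; apply: eq_bigr => a _.
  by rewrite Fp_expD {1}/Fp_exp /= expr1.
have : (1 - z) * \sum_a Fp_exp a = 0 by rewrite mulrBl mul1r -e subrr.
by move/eqP; rewrite mulf_eq0 subr_eq0 eq_sym (negPf z1) => /eqP.
Qed.

Lemma sum_Fp_exp_mul b : b != 0 -> \sum_a Fp_exp (a * b) = 0.
Proof. by move=> b0; rewrite -[RHS]sum_Fp_exp [RHS](reindex_inj (mulIf b0)). Qed.

Variable nu : 'F_q.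
Hypothesis nu_nonsqr : ~~ is_sqr nu.

Definition gauss_sum : F := \sum_(a : 'F_q) (chi a)%:~R * Fp_exp a.

(** In the double sum, write the second index as [a c]; then [chi a] occurs squared. The inner sum
    of exponentials is -1 unless [c = -1], when it is [q - 1], and the constant parts cancel because
    [chi] sums to 0. *)
Lemma gauss_sum_sqr : is_sqr (-1 : 'F_q) -> gauss_sum ^+ 2 = q%:R.
Proof.
move=> s1.
have chiN1 : chi (-1 : 'F_q) = 1 by rewrite /chi oppr_eq0 oner_eq0 s1.
have E : gauss_sum ^+ 2 = \sum_(c : 'F_q) (chi c)%:~R * \sum_(a : 'F_q | a != 0) Fp_exp (a * (1 + c)).
  rewrite expr2 /gauss_sum mulr_suml.
  transitivity (\sum_(a : 'F_q | a != 0) \sum_(c : 'F_q) (chi c)%:~R * Fp_exp (a * (1 + c))).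
    rewrite (bigD1 0) //= chi0 mulr0z !mul0r add0r; apply: eq_bigr => a a0.
    rewrite mulr_sumr (reindex_inj (mulfI a0)); apply: eq_bigr => c _.
    have -> : Fp_exp (a * (1 + c)) = Fp_exp a * Fp_exp (a * c) by rewrite -Fp_expD mulrDr mulr1.
    rewrite chiM rmorphM /=.
    have : (chi a)%:~R * (chi a)%:~R = 1 :> F by rewrite -rmorphM /= chi_sqr.
    move: (_%:~R) => /= u uu; rewrite -[RHS]mul1r -uu; ring.
  by rewrite exchange_big; apply: eq_bigr => c _; rewrite mulr_sumr.
have S c : \sum_(a : 'F_q | a != 0) Fp_exp (a * (1 + c)) = (if c == -1 then q%:R else 0) - 1.
  have -> : \sum_(a : 'F_q | a != 0) Fp_exp (a * (1 + c)) = \sum_(a : 'F_q) Fp_exp (a * (1 + c)) - 1.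
    by rewrite [X in _ = X - 1](bigD1 0) //= mul0r Fp_exp0 addrAC subrr add0r.
  congr (_ - 1); case: eqP => [->|/eqP c1].
    rewrite subrr (eq_bigr (fun=> 1)) => [|a _]; last by rewrite mulr0.
    by rewrite sumr_const card_Fp.
  by rewrite sum_Fp_exp_mul // addrC -[1]opprK subr_eq0.
rewrite E (eq_bigr (fun c => (chi c)%:~R * (if c == -1 then q%:R else 0) - (chi c)%:~R)); last first.
  by move=> c _; rewrite S mulrBr mulr1.
rewrite sumrB -(rmorph_sum (intr : int -> F)) (sum_chi nu_nonsqr) subr0.
rewrite (bigD1 (-1)) //= eqxx chiN1 mul1r big1 ?addr0 // => c /negPf ->.
by rewrite mulr0.
Qed.

(** Frobenius replaces the index [a] by [p a], and [chi p = 1]. *)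
Lemma gauss_sum_frobenius (p : nat) : p \in [pchar F] -> odd p ->
  (p%:R : 'F_q) != 0 -> is_sqr (p%:R : 'F_q) -> gauss_sum ^+ p = gauss_sum.
Proof.
move=> chp p_odd p0 sp.
have chip : chi (p%:R : 'F_q) = 1 by rewrite /chi (negPf p0) sp.
rewrite -(pFrobenius_autE chp) /gauss_sum rmorph_sum /=.
rewrite [RHS](reindex_inj (mulfI p0)); apply: eq_bigr => a _.
rewrite pFrobenius_autE exprMn chiM chip mul1r mulr_natl Fp_exp_natmul; congr (_ * _).
rewrite /chi; case: ifP => _; first by rewrite expr0n; case: (p) p_odd.
case: ifP => _; first by rewrite expr1n.
by rewrite mulrN1z -signr_odd p_odd expr1.
Qed.
End GaussSum.

(** In an extension of F_p containing a q-th root of unity, the Gauss sum is a square root of [q]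
    fixed by Frobenius, so it lies in F_p. *)
Lemma qr_reciprocity (p q : nat) : prime p -> prime q -> p != q -> odd p -> odd q ->
  qr q (-1) -> qr q p -> qr p q.
Proof.
move=> p_pr q_pr pq p_odd q_odd s1 sp.
pose P : {poly 'F_p} := \poly_(i < q) 1.
have qn0 : (q%:R : 'F_p) != 0.
  by rewrite -(dvdn_pcharf (pchar_Fp p_pr)) dvdn_prime2.
have sP : (1 < size P)%N by rewrite size_poly_eq ?oner_eq0 // prime_gt1.
have [F [i [z]]] := root_extension sP; rewrite rootE.
have -> : (map_poly i P).[z] = \sum_(k < q) z ^+ k.
  have -> : map_poly i P = \poly_(k < q) 1.
    by apply/polyP => k; rewrite coef_map !coef_poly; case: ifP => _; rewrite /= ?rmorph1 ?rmorph0.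
  by rewrite horner_poly; apply: eq_bigr => k _; rewrite mul1r.
move=> /eqP sz.
have zq : z ^+ q = 1.
  by apply/eqP; rewrite -subr_eq0 subrX1 sz mulr0.
have z1 : z != 1.
  apply: contraNneq qn0 => z1; move: sz; rewrite z1.
  under eq_bigr do rewrite expr1n.
  by rewrite sumr_const card_ord => /eqP; rewrite -(rmorph_nat i) fmorph_eq0.
have chp : p \in [pchar F] := pchar_Fp_ext p_pr i.
(* If everything were a square, squaring would be onto and hence injective, but 1 and -1 are
   distinct with equal squares. *)
have [nu nnu] : exists nu : 'F_q, ~~ is_sqr nu.
  apply/existsP; rewrite -negb_forall; apply/negP => /forallP all_sqr.
  have inj2 : injective (fun x : 'F_q => x ^+ 2).
    have /image_injP h : #|fintype.image (fun x : 'F_q => x ^+ 2) predT| == #|'F_q|.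
      apply/eqP/eq_card => y; rewrite [RHS]inE.
      by have /is_sqrP[x <-] := all_sqr y; apply: fintype.image_f.
    by move=> x y; apply: h.
  have : (1 : 'F_q) = -1 by apply: inj2; rewrite sqrrN.
  move/eqP; rewrite -subr_eq0 opprK -[1 + 1]/(2%:R).
  by rewrite (negPf (Fp_two_neq0 q_pr q_odd)).
have p0 : (p%:R : 'F_q) != 0.
  by rewrite -(dvdn_pcharf (pchar_Fp q_pr)) dvdn_prime2 // eq_sym.
have m1 : is_sqr (-1 : 'F_q) by have /(Fp_is_sqr q_pr) := s1; rewrite mulrN1z.
have sp' : is_sqr (p%:R : 'F_q) by have /(Fp_is_sqr q_pr) := sp; rewrite -pmulrn.
apply: (@qr_of_sqrt p p_pr F i (@gauss_sum q F z) q).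
  exact: gauss_sum_frobenius.
by rewrite (gauss_sum_sqr q_pr zq z1 nnu m1) -pmulrn.
Qed.

(** * Coverings and square classes *)

Section CoveringClosure.
Variables (v : place) (K : completion v).
Implicit Types e d k r : rat.

Definition sqrK (k : rat) := exists2 s : K, s != 0 & ratr k = s ^+ 2.

Lemma sqrK_sqr r : r != 0 -> sqrK (r ^+ 2).
Proof. by move=> r0; exists (ratr r); rewrite ?ratr_compl_eq0 // ratr_complXn. Qed.

Lemma sqrKM k l : sqrK k -> sqrK l -> sqrK (k * l).
Proof.
move=> [s s0 es] [t t0 et]; exists (s * t); first by rewrite mulf_neq0.
by rewrite ratr_complM es et exprMn.
Qed.

Lemma sqrK_neq0 k : sqrK k -> k != 0.
Proof.
move=> [s s0 e]; rewrite -(ratr_compl_eq0 K) e.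
by rewrite expf_neq0.
Qed.

Lemma sqrKV k : sqrK k -> sqrK k^-1.
Proof.
move=> sk; have k0 := sqrK_neq0 sk.
have -> : k^-1 = k * k^-1 ^+ 2 by field.
by apply: sqrKM => //; apply: sqrK_sqr; rewrite invr_eq0.
Qed.

Lemma covering_sqr e1 e2 e3 d1 d3 k1 k3 : sqrK k1 -> sqrK k3 ->
  covering_soluble e1 e2 e3 d1 d3 K -> covering_soluble e1 e2 e3 (d1 * k1) (d3 * k3) K.
Proof.
move=> [s1 s10 E1] [s3 s30 E3] [[[u1 D1] [u3 D3]]|[X [u1 [u2 [u3 [D1 D2 D3]]]]]].
  left; split; [exists (u1 * s1)|exists (u3 * s3)].
    by rewrite ratr_complM D1 E1 exprMn.
  by rewrite ratr_complM D3 E3 exprMn.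
right; exists X, (u1 / s1), (u2 / (s1 * s3)), (u3 / s3).
rewrite !ratr_complM E1 E3 D1 D2 D3; split; field; rewrite ?s10 ?s30 //.
Qed.

Lemma covering_sqrP e1 e2 e3 d1 d3 k1 k3 : sqrK k1 -> sqrK k3 ->
  covering_soluble e1 e2 e3 (d1 * k1) (d3 * k3) K <-> covering_soluble e1 e2 e3 d1 d3 K.
Proof.
move=> s1 s3; split=> [h|]; last exact: covering_sqr.
have := covering_sqr (sqrKV s1) (sqrKV s3) h.
by rewrite !mulfK // sqrK_neq0.
Qed.

Lemma covering_swap e1 e2 e3 d1 d3 :
  covering_soluble e1 e2 e3 d1 d3 K -> covering_soluble e3 e2 e1 d3 d1 K.
Proof.
case=> [[h1 h3]|[X [u1 [u2 [u3 [D1 D2 D3]]]]]]; first by left.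
by right; exists X, u3, u2, u1; split=> //; rewrite D2 [_ * ratr d3]mulrC.
Qed.

Lemma covering_trivial e1 e2 e3 d1 d3 : sqrK d1 -> sqrK d3 ->
  covering_soluble e1 e2 e3 d1 d3 K.
Proof. by move=> [s _ es] [t _ et]; left; split; [exists s|exists t]. Qed.

(* Translation by the 2-torsion point [(e1, 0)]. *)
Lemma covering_translate e1 e2 e3 d1 d3 : e1 != e2 -> e1 != e3 -> d1 != 0 -> d3 != 0 ->
  covering_soluble e1 e2 e3 d1 d3 K ->
  covering_soluble e1 e2 e3 (d1 * ((e1 - e2) * (e1 - e3))) (d3 * (e1 - e3)) K.
Proof.
move=> e12 e13 d10 d30.
pose a1 : K := ratr e1; pose a2 : K := ratr e2; pose a3 : K := ratr e3.
pose c1 : K := ratr d1; pose c3 : K := ratr d3.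
have c10 : c1 != 0 by rewrite ratr_compl_eq0.
have c30 : c3 != 0 by rewrite ratr_compl_eq0.
have a12 : a1 - a2 != 0 by rewrite -ratr_complB ratr_compl_eq0 subr_eq0.
have a13 : a1 - a3 != 0 by rewrite -ratr_complB ratr_compl_eq0 subr_eq0.
have R1 : ratr (d1 * ((e1 - e2) * (e1 - e3))) = c1 * ((a1 - a2) * (a1 - a3)) :> K.
  by rewrite !ratr_complM !ratr_complB.
have R3 : ratr (d3 * (e1 - e3)) = c3 * (a1 - a3) :> K by rewrite !ratr_complM !ratr_complB.
case=> [[[s1 D1] [s3 D3]]|[X [u1 [u2 [u3 [D1 D2 D3]]]]]].
  have s10 : s1 != 0 by apply: contraNneq c10 => z; rewrite /c1 D1 z expr0n.
  have s30 : s3 != 0 by apply: contraNneq c30 => z; rewrite /c3 D3 z expr0n.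
  (* The points at infinity of the covering are translated to points with [X = e1]. *)
  right; exists a1, 0, (1 / (s1 * s3 * (a1 - a3))), (1 / s3).
  rewrite R1 R3 -/a1 -/a2 -/a3 /c1 /c3 D1 D3; split.
  - by rewrite subrr expr0n mulr0.
  - by field; rewrite a13 s10 s30.
  - by field.
rewrite -/a1 -/a2 -/a3 -/c1 -/c3 in D1 D2 D3.
(* Conversely, a point with [X = e1] moves to infinity. *)
have [u10|u10] := eqVneq u1 0.
  have X1 : X = a1 by apply/eqP; rewrite -subr_eq0 D1 u10 expr0n mulr0.
  left; rewrite R1 R3 -X1 D2 D3; split; [exists (c1 * c3 * u2 * u3) | exists (c3 * u3)]; ring.
(* The new abscissa is that of the sum with [(e1, 0)], where [X - e1 = c1 * u1 ^+ 2]. *)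
right; exists (a1 + (a1 - a2) * (a1 - a3) / (c1 * u1 ^+ 2)), (c1 * u1)^-1,
  (u3 / (c1 * u1 * (a1 - a3))), (u2 / u1).
have X0 : X = a1 + c1 * u1 ^+ 2 by rewrite -D1; ring.
rewrite R1 R3 -/a1 -/a2 -/a3.
have F2 : c1 * c3 * u2 ^+ 2 = a1 - a2 + c1 * u1 ^+ 2 by rewrite -D2 X0; ring.
have F3 : c3 * u3 ^+ 2 = a1 - a3 + c1 * u1 ^+ 2 by rewrite -D3 X0; ring.
have n0 : c1 * u1 ^+ 2 != 0 by rewrite mulf_neq0 // expf_neq0.
split.
- by field; rewrite u10 c10.
- transitivity ((a1 - a2) * (c3 * u3 ^+ 2) / (c1 * u1 ^+ 2)); last by field; rewrite a13 u10 c10.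
  by rewrite F3; field; rewrite u10 c10.
- transitivity ((a1 - a3) * (c1 * c3 * u2 ^+ 2) / (c1 * u1 ^+ 2)); last by field; rewrite u10 c10.
  by rewrite F2; field; rewrite u10 c10.
Qed.
End CoveringClosure.

(** * Square classes of rationals *)

Lemma even_logn_sqr (n : nat) : (0 < n)%N -> (forall l, prime l -> ~~ odd (logn l n)) ->
  exists k, n = (k ^ 2)%N.
Proof.
have [N] := ubnP n; elim: N n => // N IHN n le_nN n0 H.
have [n1|n1] := leqP n 1; first by exists 1%N; apply/eqP; rewrite exp1n eqn_leq n1 n0.
have l_pr := pdiv_prime n1; set l := pdiv n in l_pr.
have l2 : (l ^ 2 %| n)%N.
  rewrite pfactor_dvdn //; have := H l l_pr.
  have : (0 < logn l n)%N by rewrite logn_gt0 mem_primes l_pr n0 pdiv_dvd.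
  by case: (logn l n) => [|[|]].
have Dn := divnK l2; set n' := (n %/ l ^ 2)%N in Dn.
have l20 : (0 < l ^ 2)%N by rewrite expn_gt0 prime_gt0.
have n'0 : (0 < n')%N by rewrite divn_gt0 // dvdn_leq.
have [||k Dk] := IHN n' _ n'0.
- apply: (@leq_trans n) => //.
  by apply: ltn_Pdiv => //; rewrite -(exp1n 2) ltn_exp2r // prime_gt1.
- move=> r r_pr; have := H r r_pr; rewrite -Dn lognM // lognX oddD oddM /= addbF //.
by exists (k * l)%N; rewrite expnMn -Dk Dn.
Qed.

Definition same_class (d d' : rat) := exists2 r : rat, r != 0 & d = d' * r ^+ 2.

Lemma same_class_refl d : same_class d d.
Proof. by exists 1; rewrite ?oner_eq0 ?expr1n ?mulr1. Qed.

Lemma same_class_trans d d' d'' : same_class d d' -> same_class d' d'' -> same_class d d''.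
Proof.
move=> [r r0 ->] [s s0 ->]; exists (s * r); first by rewrite mulf_neq0.
ring.
Qed.

Lemma same_class_int (d : rat) : d != 0 ->
  exists2 N : int, N != 0 & same_class d N%:~R.
Proof.
move=> d0; exists (numq d * denq d); first by rewrite mulf_neq0 ?numq_eq0 ?denq_neq0.
exists (denq d)%:~R^-1; first by rewrite invr_eq0 intr_eq0 denq_neq0.
rewrite -{1}[d]divq_num_den rmorphM /=; field.
by rewrite intr_eq0 denq_neq0.
Qed.

Lemma same_class_even (N : int) (d : rat) (l : nat) : prime l -> N != 0 ->
  N%:~R = d ^+ 2 -> ~~ odd (logn l `|N|%N).
Proof.
move=> l_pr N0 e.
have d0 : d != 0 by apply: contraNneq N0 => z; rewrite -(intr_eq0 rat) e z expr0n.
have : N * denq d ^+ 2 = numq d ^+ 2.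
  apply: (@intr_inj rat); rewrite rmorphM !rmorphXn /= e numqE; ring.
move/(congr1 (fun z : int => logn l `|z|%N)).
rewrite abszM !abszX lognM ?absz_gt0 // ?expn_gt0 ?absz_gt0 ?denq_neq0 //.
rewrite !lognX => h; have := congr1 odd h.
by rewrite oddD !oddM /= addbF => ->.
Qed.

Lemma squarefree_class2 (N : int) (l1 l2 : nat) : N != 0 -> prime l1 -> prime l2 -> l1 != l2 ->
  (forall l, prime l -> l != l1 -> l != l2 -> ~~ odd (logn l `|N|%N)) ->
  exists s a b : bool, same_class N%:~R ((-1) ^+ s * l1%:R ^+ a * l2%:R ^+ b).
Proof.
move=> N0 p1 p2 l12 H.
pose a := odd (logn l1 `|N|); pose b := odd (logn l2 `|N|).
exists (N < 0), a, b.
have n0 : (0 < `|N|)%N by rewrite absz_gt0.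
have a0 : (0 < l1 ^ a)%N by rewrite expn_gt0 prime_gt0.
have b0 : (0 < l2 ^ b)%N by rewrite expn_gt0 prime_gt0.
have [||k Dk] := @even_logn_sqr (`|N| * (l1 ^ a * l2 ^ b)).
- by rewrite !muln_gt0 n0 a0 b0.
- move=> l l_pr; rewrite lognM ?muln_gt0 ?a0 // lognM // !lognX !oddD !oddM (logn_prime l p1) (logn_prime l p2) !oddb.
  have [->|n1] := eqVneq l l1.
    by rewrite (negPf l12) andbT andbF addbF addbb.
  have [->|n2] := eqVneq l l2; first by rewrite andbF andbT addFb addbb.
  by rewrite !andbF !addbF H.
have l10 : (l1%:R : rat) != 0 by rewrite pnatr_eq0 -lt0n prime_gt0.
have l20 : (l2%:R : rat) != 0 by rewrite pnatr_eq0 -lt0n prime_gt0.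
have A0 : (l1%:R ^+ a : rat) != 0 by rewrite expf_neq0.
have B0 : (l2%:R ^+ b : rat) != 0 by rewrite expf_neq0.
have E : (`|N|%N)%:R * (l1%:R ^+ a * l2%:R ^+ b) = k%:R ^+ 2 :> rat.
  by rewrite -!natrX -!natrM Dk.
have k0 : (k%:R : rat) != 0.
  apply: contra_eq_neq E => ->; rewrite expr0n /= !mulf_neq0 //.
  by rewrite pnatr_eq0 -lt0n.
exists (k%:R / (l1%:R ^+ a * l2%:R ^+ b)).
  by rewrite mulf_neq0 ?invr_eq0 ?mulf_neq0.
rewrite exprMn -E {1}[N]intEsign rmorphM rmorph_sign /= -pmulrn; field.
by rewrite A0 B0.
Qed.

(** * The curve *)

Lemma legendre_qr (a q : nat) : legendre a q = 1 -> ~~ (q %| a)%N /\ qr q a.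
Proof.
rewrite /legendre; case: ifP => // /negbT qa; case: ifP => // /existsP[x /eqP e] _; split=> //.
exists (nat_of_ord x).
rewrite -eqz_mod_dvd (_ : (nat_of_ord x : int) ^+ 2 = Posz (x ^ 2)%N); last first.
  by rewrite expnS expn1 PoszM expr2.
by rewrite !modz_nat e.
Qed.

(** Squares are 0, 1 or 4 modulo 5. As -4 is 1, the congruences give [C = 2 B], which forces
    [B = C = 0] because 2 is a nonsquare. Then [2 A = - P], while [P] is 1 or 4, so [A] would be a
    nonsquare. *)
Lemma mod5_squares (A B C W P k1 k2 k3 k4 j1 j2 j3 : int) :
  [\/ A = 5 * k1, A = 5 * k1 + 1 | A = 5 * k1 + 4] ->
  [\/ B = 5 * k2, B = 5 * k2 + 1 | B = 5 * k2 + 4] ->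
  [\/ C = 5 * k3, C = 5 * k3 + 1 | C = 5 * k3 + 4] ->
  [\/ W = 5 * k4, W = 5 * k4 + 1 | W = 5 * k4 + 4] ->
  W - P = j1 * 5 -> 2 * A - 4 * P - 2 * B = j2 * 5 -> 2 * A + P - C = j3 * 5 ->
  P <> 5 * (k4 - j1) -> False.
Proof.
move=> hA hB hC hW H1 H2 H3 N.
have E : C - 2 * B = 5 * (P + j2 - j3) by lia.
have {hC E C H3} B5 : B = 5 * k2.
  by case: hB => hB //; case: hC => hC; lia.
have {H1 W hW N} [z [Pz|Pz]] : exists z, P = 5 * z + 1 \/ P = 5 * z + 4.
  exists (k4 - j1); case: hW => hW; lia.
all: case: hA => hA; lia.
Qed.

Lemma sqrK_odd (l : nat) (l_pr : prime l) (K : completion (Defs.Finite l_pr)) (n : int) :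
  odd l -> ~~ (l%:Z %| n)%Z -> qr l n -> sqrK K n%:~R.
Proof.
move=> l_odd ln [w Hw]; have [u Hu] := padic_sqrt_odd K l_odd ln Hw; exists u => //.
apply: contraNneq ln => u0; move: Hu; rewrite u0 expr0n => /eqP.
by rewrite ratr_compl_eq0 intr_eq0 => /eqP ->; rewrite dvdz0.
Qed.

Lemma sqrK_two (l_pr : prime 2) (K : completion (Defs.Finite l_pr)) (n : int) :
  n != 0 -> (8 %| 1 - n)%Z -> sqrK K n%:~R.
Proof.
move=> n0 n8; have [u Hu] := padic_sqrt_two K erefl n8; exists u => //.
apply: contraNneq n0 => u0; move: Hu; rewrite u0 expr0n => /eqP.
by rewrite ratr_compl_eq0 intr_eq0.
Qed.

Lemma sqrK_real (K : completion Infinite) (r : rat) : 0 < r -> sqrK K r.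
Proof.
move=> r0; have [u Hu] := real_sqrt K (ltW r0); exists u => //.
by apply: contra_eq_neq Hu => ->; rewrite expr0n ratr_compl_eq0 gt_eqF.
Qed.

Lemma sqrK1 (v : place) (K : completion v) : sqrK K 1.
Proof. by rewrite -(expr1n _ 2); apply: sqrK_sqr; exact: oner_neq0. Qed.

Lemma card_finType (T : finType) : ([set: T] #= `I_#|T|)%card.
Proof.
pose f (x : T) := nat_of_ord (enum_rank x).
have finj : {in [set: T]%classic &, injective f}.
  by move=> x y _ _ /ord_inj /enum_rank_inj.
have -> : `I_#|T| = (f @` [set: T])%classic.
  apply/seteqP; split=> [i /= ilt|_ [x _ <-] /=]; last exact: ltn_ord.
  by exists (enum_val (Ordinal ilt)) => //; rewrite /f enum_valK.
exact/card_esym/inj_card_eq.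
Qed.

(** Two representatives in one class have a square as product; a sum of two bits is even only if
    they agree. *)
Lemma sqr_class_bits (l1 l2 : nat) (k : nat) (x x' y y' : bool) (d : rat) :
  prime l1 -> prime l2 -> l1 != l2 ->
  (-1) ^+ k * l1%:R ^+ (x + x') * l2%:R ^+ (y + y') = d ^+ 2 -> x = x' /\ y = y'.
Proof.
move=> p1 p2 l12 e.
pose N : int := (-1) ^+ k * (l1%:Z ^+ (x + x') * l2%:Z ^+ (y + y')).
have NE : N%:~R = d ^+ 2.
  by rewrite -e /N !rmorphM !rmorphXn /= mulrA.
have aN : `|N|%N = (l1 ^ (x + x') * l2 ^ (y + y'))%N.
  by rewrite /N abszMsign abszM !abszX.
have a0 : (0 < l1 ^ (x + x'))%N by rewrite expn_gt0 prime_gt0.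
have b0 : (0 < l2 ^ (y + y'))%N by rewrite expn_gt0 prime_gt0.
have N0 : N != 0 by rewrite -absz_eq0 aN muln_eq0 negb_or -!lt0n a0.
have := same_class_even p1 N0 NE; have := same_class_even p2 N0 NE.
rewrite !aN !lognM // !lognX !logn_prime // eqxx (negPf l12) eq_sym (negPf l12) !eqxx.
rewrite !muln0 !muln1 addn0 add0n !oddD !oddb => h2 h1.
by split; [move: h1; case: (x); case: (x') | move: h2; case: (y); case: (y')].
Qed.

Section Curve.
Variables (m p q : nat).
Hypotheses (m_gt0 : (0 < m)%N) (p_pr : prime p) (p8 : p = 7 %[mod 8]).
Hypotheses (Dq : q = (4 ^ m + 1)%N) (q_pr : prime q) (pq1 : legendre p q = 1).

Lemma p_mod8 : exists k, p = (8 * k + 7)%N.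
Proof. by exists (p %/ 8)%N; rewrite {1}(divn_eq p 8) p8 mulnC. Qed.

Lemma p_odd : odd p. Proof. by have [k ->] := p_mod8; rewrite oddD oddM. Qed.

Lemma p_mod4 : p = 3 %[mod 4].
Proof.
have [k ->] := p_mod8; have -> : (8 * k + 7 = (2 * k + 1) * 4 + 3)%N by lia.
by rewrite modnMDl.
Qed.

Lemma q_odd : odd q.
Proof. by rewrite Dq oddD oddX /=; case: (m) m_gt0. Qed.

Lemma q_neq_p : p != q.
Proof. by have [h _] := legendre_qr pq1; apply: contraNneq h => ->. Qed.

Lemma qr_q_p : qr q p. Proof. by have [] := legendre_qr pq1. Qed.

Lemma qr_q_opp1 : qr q (-1).
Proof.
exists (2 ^+ m); rewrite opprK exprAC -[2 ^+ 2]/(4%:Z) Dq PoszD; apply/dvdzP; exists 1.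
by rewrite mul1r; congr (_ + _); elim: (m) => [|k IH]; rewrite ?expr0 // exprS expnS PoszM IH.
Qed.

Lemma qr_p_q : qr p q.
Proof.
exact: (qr_reciprocity p_pr q_pr q_neq_p p_odd q_odd qr_q_opp1 qr_q_p).
Qed.

Lemma qr_p_2 : qr p 2. Proof. exact: qr_two. Qed.

Lemma nqr_p_opp1 : ~ qr p (-1). Proof. exact: nqr_opp1 p_mod4. Qed.

Lemma four_expE : ((4 ^ m)%N%:Z : int) = (2 ^+ m) ^+ 2.
Proof. by rewrite exprAC; elim: (m) => [|k IH]; rewrite ?expr0 // exprS expnS PoszM IH. Qed.

(* [q] is prime, so [m] is even, and [1 + 2^m] squares to [2 * 2^m] modulo [q]. *)
Lemma qr_q_2 : (1 < m)%N -> qr q 2.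
Proof.
move=> m1.
have m_even : ~~ odd m.
  apply/negP => om; have d5 : (5 %| q)%N.
    have [k Dk] : exists k, m = (2 * k + 1)%N.
      by exists m./2; rewrite -{1}(odd_double_half m) om -mul2n addnC.
    rewrite Dq Dk expnD expnM expn1 /dvdn.
    by rewrite -modnDml -modnMml -modnXm exp1n.
  move: d5; rewrite dvdn_prime2 // Dq => /eqP e.
  have h : (4 ^ 2 <= 4 ^ m)%N by rewrite leq_pexp2l.
  move: h e; rewrite -[(4 ^ 2)%N]/(16%N); set X := (4 ^ m)%N. lia.
pose A : int := 2 ^+ m./2.
have Eq : (q%:Z : int) = A ^+ 4 + 1.
  rewrite Dq PoszD four_expE -{1}(even_halfK m_even) -mul2n mulnC exprM -/A; ring.
(* Since [A ^+ 4 = -1] modulo [q], the square of [1 + A ^+ 2] is [2 * A ^+ 2]; the factor [A ^+ 3]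
   completes this to [2 * A ^+ 8], congruent to 2. *)
exists ((1 + A ^+ 2) * A ^+ 3); apply/dvdzP; exists (A ^+ 6 + 2 * (A ^+ 4 - 1)).
by rewrite Eq; ring.
Qed.

Lemma q_five : m = 1%N -> q = 5%N. Proof. by move=> m1; rewrite Dq m1. Qed.

Let e2 : rat := (4 ^ m * p)%N%:R.
Let e3 : rat := - p%:R.

Definition selmer_sol (d1 d3 : rat) (v : place) (K : completion v) : Prop :=
  covering_soluble 0 e2 e3 d1 d3 K.

Lemma E_cubicE : E_cubic m p = cubic 0 e2 e3.
Proof. by rewrite /E_cubic /cubic /e3 polyC0 subr0 polyCN opprK. Qed.

Let pQ : (p%:R : rat) != 0. Proof. by rewrite pnatr_eq0 -lt0n prime_gt0. Qed.
Let qQ : (q%:R : rat) != 0. Proof. by rewrite pnatr_eq0 -lt0n prime_gt0. Qed.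
Let E2 : e2 = 2 ^+ m ^+ 2 * p%:R.
Proof. by rewrite /e2 natrM natrX -exprM mulnC exprM -natrX. Qed.
Let tQ : (2 ^+ m : rat) != 0. Proof. by rewrite expf_neq0. Qed.
Let Q2 : (q%:R : rat) = 2 ^+ m ^+ 2 + 1.
Proof. by rewrite Dq natrD natrX -exprM mulnC exprM -natrX. Qed.

Lemma e12 : 0 != e2. Proof. by rewrite eq_sym E2 mulf_neq0 // expf_neq0. Qed.
Lemma e13 : 0 != e3. Proof. by rewrite eq_sym oppr_eq0. Qed.
Lemma e23 : e2 != e3.
Proof.
rewrite -subr_eq0 /e3 E2 opprK; have -> : 2 ^+ m ^+ 2 * p%:R + p%:R = p%:R * q%:R :> rat.
  by rewrite Q2; ring.
by rewrite mulf_neq0.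
Qed.

(** * Translation by the 2-torsion of the curve *)

Section Local.
Variables (v : place) (K : completion v).
Local Notation sol d1 d3 := (selmer_sol d1 d3 K).

Lemma sol_class d1 d3 d1' d3' : same_class d1 d1' -> same_class d3 d3' ->
  sol d1 d3 <-> sol d1' d3'.
Proof.
by move=> [r r0 ->] [s s0 ->]; apply: covering_sqrP; exact: sqrK_sqr.
Qed.

(** The image of [(0, 0)] is (-1, p), because [(0 - e2)(0 - e3)] is -1 times a square. *)
Lemma sol_T1 d1 d3 : d1 != 0 -> d3 != 0 -> sol d1 d3 -> sol (- d1) (d3 * p%:R).
Proof.
move=> d10 d30 /(covering_translate e12 e13 d10 d30) h.
rewrite -(@sol_class (d1 * ((0 - e2) * (0 - e3))) (d3 * (0 - e3))) //.
  exists (2 ^+ m * p%:R); first by rewrite mulf_neq0.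
  by rewrite /e3 E2; ring.
exists 1; first exact: oner_neq0.
by rewrite /e3; ring.
Qed.

(** The image of [(e3, 0)] is (-p, q): here [(e3 - e2) * e3 = p ^+ 2 * q]. *)
Lemma sol_T3 d1 d3 : d1 != 0 -> d3 != 0 -> sol d1 d3 -> sol (d1 * - p%:R) (d3 * q%:R).
Proof.
move=> d10 d30 /covering_swap h.
have e32 : e3 != e2 by rewrite eq_sym e23.
have e31 : e3 != 0 by rewrite eq_sym e13.
have /covering_swap := covering_translate e32 e31 d30 d10 h.
move=> {}h; rewrite -(@sol_class (d1 * (e3 - 0)) (d3 * ((e3 - e2) * (e3 - 0)))) //.
  exists 1; first exact: oner_neq0.
  by rewrite /e3; ring.
by exists p%:R => //; rewrite /e3 E2 Q2; ring.
Qed.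

(** For places where [q] is a square but [-p] is not, namely the real one and [p]: the trivially
    soluble pair (d, q) is translated by [(e3, 0)]. *)
Lemma sol_sqr_q d : d != 0 -> sqrK K d -> sqrK K q%:R -> sol (d * - p%:R) 1.
Proof.
move=> d0 sd sq.
have h : sol d q%:R by exact: covering_trivial.
rewrite -(@sol_class (d * - p%:R) (q%:R * q%:R)) //; first exact: sol_T3.
  exact: same_class_refl.
by exists q%:R => //; rewrite expr2 mul1r.
Qed.

(* Translating by the 2-torsion removes the primes [p] and [q] from [d3]. *)
Lemma sol_normalise (s a b t c d : bool) :
  sol ((-1) ^+ s * 2 ^+ a * p%:R ^+ b) ((-1) ^+ t * p%:R ^+ c * q%:R ^+ d) ->
  sol ((-1) ^+ (s (+) c (+) d) * 2 ^+ a * p%:R ^+ (b (+) d)) ((-1) ^+ t).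
Proof.
have two : (2 : rat) != 0 by [].
have sg (f : bool) : ((-1) ^+ f : rat) != 0 by rewrite signr_eq0.
have nz1 : (-1) ^+ s * 2 ^+ a * p%:R ^+ b != 0 :> rat.
  by rewrite !mulf_neq0 ?expf_neq0.
have nz3 : (-1) ^+ t * p%:R ^+ c * q%:R ^+ d != 0 :> rat.
  by rewrite !mulf_neq0 ?expf_neq0.
move=> h.
pose d1 : rat := if d then (-1) ^+ s * 2 ^+ a * p%:R ^+ b * - p%:R else (-1) ^+ s * 2 ^+ a * p%:R ^+ b.
pose d3 : rat := if d then (-1) ^+ t * p%:R ^+ c * q%:R ^+ d * q%:R else (-1) ^+ t * p%:R ^+ c * q%:R ^+ d.
have h1 : sol d1 d3 by rewrite /d1 /d3; case: (d) h nz3 => h nz3 //; exact: sol_T3.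
have d10 : d1 != 0 by rewrite /d1; case: (d) => //; rewrite mulf_neq0 // oppr_eq0.
have d30 : d3 != 0 by rewrite /d3; case: (d) nz3 => nz3 //; rewrite mulf_neq0.
have {h1} : sol (if c then - d1 else d1) (if c then d3 * p%:R else d3).
  by case: (c) => //; exact: sol_T1.
apply: (iffLR (sol_class _ _)).
  exists (p%:R ^+ (b && d)); first by rewrite expf_neq0.
  by rewrite /d1; case: (s); case: (b); case: (c); case: (d) => /=; ring.
exists (p%:R ^+ c * q%:R ^+ d); first by rewrite mulf_neq0 ?expf_neq0.
by rewrite /d3; case: (c); case: (d) => /=; ring.
Qed.
End Local.

(** * The condition at p *)

Section AtP.
Variable K : completion (Defs.Finite p_pr).
Local Notation sol d1 d3 := (selmer_sol d1 d3 K).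
Local Notation abs := (@compl_abs _ K).
Let P : K := p%:R.

Let absP : abs P = p%:R^-1.
Proof.
have := @padic_int p p_pr p%:Z; rewrite -lt0n prime_gt0 // => /(_ isT).
by rewrite (_ : P = p%:Z%:~R) // compl_abs_int => ->; rewrite /= logn_prime // eqxx expr1.
Qed.

Let P0 : P != 0.
Proof. by rewrite /P completion_char0 -lt0n prime_gt0. Qed.

Let pV0 : 0 < (p%:R^-1 : R). Proof. by rewrite invr_gt0 ltr0n prime_gt0. Qed.
Let pV1 : (p%:R^-1 : R) < 1. Proof. by rewrite invf_lt1 ?ltr1n ?prime_gt1 // ltr0n prime_gt0. Qed.

Let not_opp1 (u : K) : ~ abs (u ^+ 2 + 1) < 1.
Proof.
move=> h; apply: nqr_p_opp1; apply: (@compl_sqr_residue p p_pr K u).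
by rewrite mulrN1z opprK.
Qed.

Let sign_one (u : K) (t : bool) : abs (u ^+ 2 - (-1) ^+ t) < 1 -> t = false.
Proof. by case: t => //; rewrite expr1 opprK => /not_opp1. Qed.

Let abs_sign (t : bool) : abs ((-1) ^+ t) = 1.
Proof. by rewrite compl_absXn compl_absN compl_abs1 expr1n. Qed.

Let abs_signM (t : bool) x : abs ((-1) ^+ t * x) = abs x.
Proof. by rewrite compl_absM abs_sign mul1r. Qed.

Let absE2 (n : nat) : abs (n%:R * P) <= p%:R^-1.
Proof.
rewrite compl_absM absP -[X in _ <= X]mul1r ler_wpM2r ?(ltW pV0) //.
exact: (@compl_abs_int_le1 p p_pr K n%:Z).
Qed.

Let ratr_e2 : ratr e2 = (4 ^ m)%N%:R * P.
Proof. by rewrite /e2 ratr_nat natrM. Qed.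
Let ratr_e3 : ratr e3 = - P.
Proof. by rewrite /e3 -[LHS]/(rat_compl K (- p%:R)) rmorphN rat_complE ratr_nat. Qed.

(** Modulo [p], 2 and [q] are squares and -1 is not, so any unit that is at once a square and a sign
    times a square determines that sign. The factor [2 ^+ a] is removed first. *)
Lemma sol_at_p (s a b t : bool) :
  sol ((-1) ^+ s * 2 ^+ a * p%:R ^+ b) ((-1) ^+ t) -> t = false /\ s = b.
Proof.
have sq2 : sqrK K (2 ^+ a).
  case: (a); last by rewrite expr0 -(expr1n _ 2); apply: sqrK_sqr; exact: oner_neq0.
  have p2 : ~~ (p%:Z %| 2)%Z.
    rewrite dvdzE /= gtnNdvd //; have [k ->] := p_mod8; lia.
  have [w Hw] := qr_p_2; have [u Hu] := padic_sqrt_odd K p_odd p2 Hw.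
  exists u; last by rewrite expr1.
  apply: contra_eq_neq Hu => ->.
  by rewrite expr0n ratr_int completion_char0.
have one : sqrK K 1 by rewrite -(expr1n _ 2); apply: sqrK_sqr; exact: oner_neq0.
have -> : (-1) ^+ s * 2 ^+ a * p%:R ^+ b = (-1) ^+ s * p%:R ^+ b * 2 ^+ a :> rat by ring.
rewrite -[(-1) ^+ t]mulr1 => /(iffLR (covering_sqrP _ _ _ _ _ sq2 one)).
have R1 : ratr ((-1) ^+ s * p%:R ^+ b) = (-1) ^+ s * P ^+ b :> K.
  rewrite ratr_complM [X in _ * X]ratr_complXn ratr_nat; congr (_ * _).
  exact: (rmorph_sign (rat_compl K)).
have R3 : ratr ((-1) ^+ t) = (-1) ^+ t :> K.
  exact: (rmorph_sign (rat_compl K)).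
rewrite /covering_soluble R1 R3 -[ratr 0]/(rat_compl K 0) rmorph0 ratr_e2 ratr_e3 opprK.
case=> [[[u1 E1] [u3 E3]]|[X [u1 [u2 [u3 [E1 E2' E3]]]]]].
  have b0 : b = false.
    case: (b) E1 => // E1; have := compl_abs_sqr_neq u1.
    by rewrite -compl_absXn -E1 abs_signM expr1 absP eqxx.
  have s0 : s = false.
    by apply: (@sign_one u1); rewrite -E1 b0 expr0 mulr1 subrr compl_abs0.
  by rewrite s0 b0 (@sign_one u3 t) // -E3 subrr compl_abs0.
rewrite subr0 in E1.
(* If [p] does not divide [X], then [e2] and [e3] are negligible: the three differences agree up to
   factors congruent to 1, so parity gives [b = 0] and comparing signs gives [s = t = 0]. *)
have [X1|X1] := leP 1 (abs X).
  have X0 : X != 0 by rewrite -compl_abs_gt0 (lt_le_trans ltr01).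
  have u10 : u1 != 0 by apply: contraNneq X0 => z; rewrite E1 z expr0n mulr0.
  have au1 : abs u1 != 0 by rewrite compl_abs_eq0P.
  have small x : abs x <= p%:R^-1 -> abs (x / X) < 1.
    move=> h; rewrite compl_absM compl_absV; apply: le_lt_trans pV1.
    rewrite ler_pdivrMr ?(lt_le_trans ltr01) //; apply: le_trans h _.
    by rewrite -[X in X <= _]mulr1 ler_wpM2l // ltW.
  have b0 : b = false.
    case: (b) E1 E2' => // E1 E2'; rewrite expr1 in E1.
    have h : abs (X + P) = abs X.
      by rewrite addrC compl_ultra_eq // absP (lt_le_trans pV1).
    have := compl_abs_sqr_neq (u3 / u1); case/eqP.
    rewrite compl_absM compl_absV exprMn exprVn -!compl_absXn.
    have -> : abs (u3 ^+ 2) = abs X by rewrite -h E3 abs_signM.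
    rewrite E1 -mulrA abs_signM compl_absM absP.
    by rewrite mulfK // compl_abs_eq0P expf_neq0.
  rewrite b0 expr0 mulr1 in E1 E2'.
  have ts : t = s.
    suff : t (+) s = false by case: (t); case: (s).
    apply: (@sign_one (u3 / u1)); rewrite signr_addb.
    have -> : (u3 / u1) ^+ 2 - (-1) ^+ t * (-1) ^+ s = (-1) ^+ t * (-1) ^+ s * (P / X).
      have u3E : u3 ^+ 2 = (-1) ^+ t * (X + P) by rewrite E3 mulrA -expr2 sqrr_sign mul1r.
      by rewrite expr_div_n u3E E1; field; rewrite u10 signr_eq0.
    by rewrite -mulrA !abs_signM; apply: small; rewrite absP.
  have s0 : s = false.
    apply: (@sign_one (u2 / u1)).
    have u2E : u2 ^+ 2 = X - (4 ^ m)%N%:R * P.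
      by rewrite E2' ts -[_ * (-1) ^+ s]expr2 sqrr_sign mul1r.
    have -> : (u2 / u1) ^+ 2 - (-1) ^+ s = - ((-1) ^+ s * ((4 ^ m)%N%:R * P / X)).
      rewrite expr_div_n u2E E1; field; rewrite u10 signr_eq0 //.
    by rewrite compl_absN abs_signM; apply: small; exact: absE2.
  by rewrite ts s0.
(* Now [p] divides [X]. Since [X + p] has even valuation, [Y] is congruent to -1; the first equation
   then forces [d1] to be [-p] up to squares. *)
pose Y := X / P.
have XE : X = P * Y by rewrite /Y mulrC mulfVK.
have Y1 : abs Y <= 1.
  rewrite /Y compl_absM compl_absV absP invrK -ler_pdivlMr ?ltr0n ?prime_gt0 // mul1r.
  exact: compl_abs_lt1.
have Yn1 : abs (Y + 1) < 1.
  have le1 : abs (Y + 1) <= 1 by apply: compl_ultra_le; rewrite ?compl_abs1.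
  rewrite lt_neqAle le1 andbT; apply/eqP => h.
  have := compl_abs_sqr_neq u3; rewrite -compl_absXn -(abs_signM t) -E3 XE.
  by rewrite -[P in _ + P]mulr1 -mulrDr compl_absM h mulr1 absP eqxx.
have aY : abs Y = 1.
  have := @compl_ultra_eq p p_pr K (Y + 1) (-1); rewrite compl_absN compl_abs1 addrK; exact.
have b1 : b = true.
  case: (b) E1 => // E1; have := compl_abs_sqr_neq u1.
  by rewrite -compl_absXn -(abs_signM s) -[_ ^+ s]mulr1 -(expr0 P) -E1 XE compl_absM aY mulr1 absP eqxx.
rewrite b1 expr1 in E1 E2' *.
have sY : Y = (-1) ^+ s * u1 ^+ 2.
  by apply: (mulfI P0); rewrite -XE E1; ring.
have s1 : s = true.
  case: (s) sY => //; rewrite expr0 mul1r => sY.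
  by case: (@not_opp1 u1); rewrite -sY.
split=> //; rewrite s1 expr1 in E2'.
(* Dividing the second equation by [-p] leaves [4^m - Y], congruent to [4^m + 1 = q]. As [q] is a
   square modulo [p], the sign of [d3] is trivial. *)
have {}E2' : (-1) ^+ t * u2 ^+ 2 - q%:R = - (Y + 1).
  apply: (mulfI P0).
  transitivity (- (-1 * P * (-1) ^+ t * u2 ^+ 2) - P * q%:R); first by ring.
  by rewrite -E2' XE Dq natrD; ring.
have [w Hw] := qr_p_q.
have w1 : abs (w%:~R : K) = 1.
  apply: compl_abs_int_unit; apply/negP => pw.
  have : (p%:Z %| q%:Z)%Z.
    have -> : q%:Z = w * w - (w ^+ 2 - q%:Z) by ring.
    by rewrite rpredB // dvdz_mull.
  by rewrite dvdzE /= dvdn_prime2 // (negPf q_neq_p).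
have w0 : (w%:~R : K) != 0 by rewrite -compl_abs_gt0 w1 ltr01.
apply: (@sign_one (u2 / w%:~R)).
have tt : (-1) ^+ t * (-1) ^+ t = 1 :> K by rewrite -expr2 sqrr_sign.
have -> : (u2 / w%:~R) ^+ 2 - (-1) ^+ t = (-1) ^+ t * ((((-1) ^+ t * u2 ^+ 2 - q%:R) - (w ^+ 2 - q%:Z)%:~R) / w%:~R ^+ 2).
  rewrite rmorphB rmorphXn /= -pmulrn.
  transitivity ((((-1) ^+ t * (-1) ^+ t) * u2 ^+ 2 - (-1) ^+ t * w%:~R ^+ 2) / w%:~R ^+ 2); last by field.
  by rewrite tt; field.
rewrite abs_signM compl_absM compl_absV compl_absXn w1 expr1n invr1 mulr1.
by apply: compl_ultra_lt; rewrite ?E2' compl_absN // compl_abs_int_lt1.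
Qed.
End AtP.

(** * The obstruction at 5 when m = 1 *)

Section AtQ.
Variable K : completion (Defs.Finite q_pr).
Local Notation sol d1 d3 := (selmer_sol d1 d3 K).
Local Notation abs := (@compl_abs _ K).

Lemma q_ndvd_p : ~~ (q%:Z %| p%:Z)%Z.
Proof. by rewrite dvdzE; have [] := legendre_qr pq1. Qed.

Lemma sqrK_opp_p_q : sqrK K (- p%:R).
Proof.
have := @sqrK_odd q q_pr K (-1 * p%:Z) q_odd; rewrite mulN1r rmorphN /=; apply.
  by rewrite rpredN q_ndvd_p.
by rewrite -mulN1r; exact: (qrM q_pr qr_q_opp1 qr_q_p).
Qed.

Lemma sqr_mod5 (a : int) : exists k, [\/ a ^+ 2 = 5 * k, a ^+ 2 = 5 * k + 1 | a ^+ 2 = 5 * k + 4].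
Proof.
have [k [r [Da r5]]] : exists k r : int, a = 5 * k + r /\ (0 <= r < 5).
  exists (a %/ 5)%Z, (a %% 5)%Z; rewrite {1}(divz_eq a 5) mulrC; split=> //.
  by rewrite modz_ge0 // ltz_mod.
have : r = 0 \/ r = 1 \/ r = 2 \/ r = 3 \/ r = 4 by lia.
case=> [r0|[r1|[r2|[r3|r4]]]]; rewrite Da.
- by exists (5 * k ^+ 2); apply: Or31; rewrite r0; ring.
- by exists (5 * k ^+ 2 + 2 * k); apply: Or32; rewrite r1; ring.
- by exists (5 * k ^+ 2 + 4 * k); apply: Or33; rewrite r2; ring.
- by exists (5 * k ^+ 2 + 6 * k + 1); apply: Or33; rewrite r3; ring.
- by exists (5 * k ^+ 2 + 8 * k + 3); apply: Or32; rewrite r4; ring.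
Qed.

(** As [-p] is a square here, only the pair (2, 1) has to be excluded. A nonintegral [X] would make
    2 a square modulo 5; an integral one is reduced modulo 5 and refuted by [mod5_squares]. *)
Lemma no_sol_at_5 (b : bool) : m = 1%N -> ~ sol ((- p%:R) ^+ b * 2) 1.
Proof.
move=> m1; have q5 := q_five m1.
have one : sqrK K 1 by rewrite -(expr1n _ 2); apply: sqrK_sqr; exact: oner_neq0.
have sp : sqrK K ((- p%:R) ^+ b).
  by case: (b); [rewrite expr1; exact: sqrK_opp_p_q | rewrite expr0].
rewrite [_ * 2]mulrC -[X in sol _ X](mulr1 1) => /(iffLR (covering_sqrP _ _ _ _ _ sp one)).
have nqr2 : ~ qr q 2.
  case=> a; rewrite q5 => /dvdzP[j]; have [k] := sqr_mod5 a; case=> ->; lia.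
have qr_small (u : K) (n : int) : abs (u ^+ 2 - n%:~R) < 1 -> qr q n.
  exact: compl_sqr_residue.
have r2 : ratr 2 = (2%:Z)%:~R :> K by rewrite ratr_nat.
have rp : ratr e2 = (4 * p%:Z)%:~R :> K by rewrite /e2 m1 ratr_nat.
have re3 : ratr e3 = - (p%:Z)%:~R :> K.
  by rewrite /e3 -[LHS]/(rat_compl K (- p%:R)) rmorphN rat_complE ratr_nat.
have abs2 : abs (2%:Z)%:~R = 1 by apply: compl_abs_int_unit; rewrite q5.
have two0 : (2%:Z)%:~R != 0 :> K by rewrite -compl_abs_gt0 abs2 ltr01.
rewrite /covering_soluble -[ratr 1]/(rat_compl K 1) -[ratr 0]/(rat_compl K 0) rmorph0 rmorph1 r2 rp re3 opprK.
case=> [[[u1 E1] _]|[X [u1 [u2 [u3 [E1 E2' E3]]]]]].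
  by apply: nqr2; apply: (@qr_small u1); rewrite E1 subrr compl_abs0.
rewrite subr0 in E1; rewrite mul1r in E3; rewrite mulr1 in E2'.
have [X1|X1] := ltP 1 (abs X).
  have X0 : X != 0 by rewrite -compl_abs_gt0 (lt_trans ltr01).
  have u10 : u1 != 0 by apply: contraNneq X0 => z; rewrite E1 z expr0n mulr0.
  apply: nqr2; apply: (@qr_small (u3 / u1)).
  have -> : (u3 / u1) ^+ 2 - (2%:Z)%:~R = (2%:Z)%:~R * ((p%:Z)%:~R / X).
    by rewrite expr_div_n -E3 E1; field; rewrite u10 two0.
  rewrite !compl_absM abs2 mul1r compl_absV ltr_pdivrMr ?(lt_trans ltr01) // mul1r.
  by apply: le_lt_trans X1; exact: compl_abs_int_le1.
have small (u : K) : abs (u ^+ 2) <= 1 -> abs u <= 1.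
  by rewrite compl_absXn !leNgt; apply: contra => h; rewrite exprn_egt1.
have l1 : abs u1 <= 1.
  apply: small; have -> : abs (u1 ^+ 2) = abs X by rewrite E1 [RHS]compl_absM abs2 mul1r.
  exact: X1.
have l2 : abs u2 <= 1.
  apply: small; have -> : abs (u2 ^+ 2) = abs (X - (4 * p%:Z)%:~R).
    by rewrite E2' [RHS]compl_absM abs2 mul1r.
  by apply: compl_ultra_le => //; rewrite compl_absN; exact: compl_abs_int_le1.
have l3 : abs u3 <= 1.
  by apply: small; rewrite -E3; apply: compl_ultra_le => //; exact: compl_abs_int_le1.
have res (u : K) : abs u <= 1 -> exists a : int, abs (u ^+ 2 - (a ^+ 2)%:~R) < 1.
  move=> h; have [a Ha] := compl_residue h; exists a.
  rewrite rmorphXn /= subr_sqr compl_absM.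
  have h1 : abs (u + a%:~R) <= 1 by apply: compl_ultra_le => //; exact: compl_abs_int_le1.
  by apply: (le_lt_trans (ler_wpM2l (compl_abs_ge0 _) h1)); rewrite mulr1.
have [a Ha] := res _ l1; have [b' Hb] := res _ l2; have [c Hc] := res _ l3.
have D1 : (q%:Z %| 2 * a ^+ 2 - 4 * p%:Z - 2 * b' ^+ 2)%Z.
  rewrite -(compl_abs_int_lt1 K).
  have -> : (2 * a ^+ 2 - 4 * p%:Z - 2 * b' ^+ 2)%:~R =
     (2%:Z)%:~R * (u2 ^+ 2 - (b' ^+ 2)%:~R) - (2%:Z)%:~R * (u1 ^+ 2 - (a ^+ 2)%:~R) :> K.
    transitivity (((2%:Z)%:~R * u2 ^+ 2 - 2 * (b' ^+ 2)%:~R) - ((2%:Z)%:~R * u1 ^+ 2 - 2 * (a ^+ 2)%:~R)); last by ring.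
    by rewrite -E2' -E1 !rmorphB !rmorphM /=; ring.
  by apply: compl_ultra_lt; rewrite ?compl_absN compl_absM abs2 mul1r.
have D2 : (q%:Z %| 2 * a ^+ 2 + p%:Z - c ^+ 2)%Z.
  rewrite -(compl_abs_int_lt1 K).
  have -> : (2 * a ^+ 2 + p%:Z - c ^+ 2)%:~R =
     (u3 ^+ 2 - (c ^+ 2)%:~R) - (2%:Z)%:~R * (u1 ^+ 2 - (a ^+ 2)%:~R) :> K.
    transitivity ((u3 ^+ 2 - (c ^+ 2)%:~R) - ((2%:Z)%:~R * u1 ^+ 2 - 2 * (a ^+ 2)%:~R)); last by ring.
    by rewrite -E3 -E1 rmorphB rmorphD rmorphM /=; ring.
  by apply: compl_ultra_lt; rewrite ?compl_absN // compl_absM abs2 mul1r.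
have [w Hw] := qr_q_p; have qp := q_ndvd_p.
have [k1 h1] := sqr_mod5 a; have [k2 h2] := sqr_mod5 b'.
have [k3 h3] := sqr_mod5 c; have [k4 h4] := sqr_mod5 w.
move: Hw D1 D2 qp; rewrite q5 => /dvdzP[j1 H1] /dvdzP[j2 H2] /dvdzP[j3 H3] qp.
have {}qp : forall z, p%:Z <> 5 * z by move=> z pz; case/negP: qp; rewrite pz dvdz_mulr.
have N1 := qp (k4 - j1).
exact: (mod5_squares h1 h2 h3 h4 H1 H2 H3 N1).
Qed.
End AtQ.

(** * Solubility at every place *)

Lemma sqrK_expb (v : place) (K : completion v) (r : rat) (b : bool) :
  (b -> sqrK K r) -> sqrK K (r ^+ b).
Proof. by case: b => h; [rewrite expr1; exact: h | rewrite expr0; exact: sqrK1]. Qed.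

Lemma sol_oppp (b c : bool) (v : place) (K : completion v) :
  (c -> sqrK K 2) -> sqrK K q%:R -> selmer_sol ((- p%:R) ^+ b * 2 ^+ c) 1 K.
Proof.
move=> s2 sq; have s2c := sqrK_expb s2.
case: b; last by rewrite expr0 mul1r; apply: covering_trivial s2c (sqrK1 K).
by rewrite expr1 mulrC; apply: sol_sqr_q => //; exact: sqrK_neq0 s2c.
Qed.

Lemma p_ndvd (l : nat) (z : int) : prime l -> l != p -> ~~ (l%:Z %| z)%Z ->
  ~~ (l%:Z %| z * p%:Z)%Z.
Proof.
move=> l_pr lp; rewrite !dvdzE abszM Euclid_dvdM // negb_or => -> /=.
by rewrite dvdn_prime2.
Qed.

(** If [D] is a square modulo [l], the covering is trivial. Otherwise the three roots are distinct
    modulo [l], and [integer_triple] gives an integral [X] whose first two differences are [D] times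
    squares and whose third is a square. *)
Lemma sol_good (l : nat) (l_pr : prime l) (K : completion (Defs.Finite l_pr)) (b c : bool) :
  l != 2%N -> l != p -> l != q -> selmer_sol ((- p%:R) ^+ b * 2 ^+ c) 1 K.
Proof.
move=> l2 lp lq.
have l_odd : odd l by case: (even_prime l_pr) => // e; rewrite e in l2.
pose D : int := (- p%:Z) ^+ b * 2 ^+ c.
have DQ : (- p%:R) ^+ b * 2 ^+ c = D%:~R :> rat.
  by rewrite rmorphM !rmorphXn /= rmorphN.
have l1 : ~~ (l%:Z %| 1)%Z by rewrite dvdzE /= dvdn1; apply/eqP => e; have := prime_gt1 l_pr; rewrite e.
have l2' : ~~ (l%:Z %| 2)%Z by rewrite dvdzE /= dvdn_prime2.
have lp1 : ~~ (l%:Z %| p%:Z)%Z by rewrite dvdzE /= dvdn_prime2.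
have lD : ~~ (l%:Z %| D)%Z.
  rewrite /D; case: b {D DQ}; case: c; rewrite ?expr0 ?expr1 ?mul1r ?mulr1 // ?rpredN //.
  by rewrite mulNr rpredN mulrC p_ndvd.
have l4 k : ~~ (l%:Z %| 2 ^+ k)%Z by rewrite dvdzE abszX Euclid_dvdX // -dvdzE (negPf l2').
pose a : int := (2 ^+ m) ^+ 2 * p%:Z.
have aQ : e2 = a%:~R by rewrite E2 rmorphM !rmorphXn.
rewrite DQ; have [qD|nqD] := pselect (qr l D).
  by apply: covering_trivial; [exact: sqrK_odd | exact: sqrK1].
have [||||x [h1 h2 h3]] := @integer_triple l l_pr 0 a (- p%:Z) D => //.
- by rewrite sub0r rpredN /a -exprM p_ndvd.
- by rewrite sub0r opprK.
- rewrite /a opprK -[X in _ + X]mul1r -mulrDl.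
  have -> : (2 ^+ m) ^+ 2 + 1 = q%:Z :> int by rewrite Dq PoszD four_expE.
  by rewrite p_ndvd // dvdzE /= dvdn_prime2.
have DK : (D%:~R : K) != 0.
  by rewrite -(ratr_int K) ratr_compl_eq0 intr_eq0; apply: contraNneq lD => ->; rewrite dvdz0.
have rD : ratr D%:~R = D%:~R :> K by exact: ratr_int.
have twist (e : int) : x = e \/ ~~ (l%:Z %| x - e)%Z /\ qr l ((x - e) * D) ->
    exists u : K, x%:~R - e%:~R = D%:~R * u ^+ 2.
  case=> [->|[n sq]]; first by exists 0; rewrite subrr expr0n mulr0.
  have nD : ~~ (l%:Z %| (x - e) * D)%Z.
    by move: n lD; rewrite !dvdzE abszM Euclid_dvdM // => /negPf -> /negPf ->.
  have [s s0 Hs] := sqrK_odd K l_odd nD sq; exists (s / D%:~R).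
  move: Hs; rewrite ratr_int rmorphM rmorphB /= => Hs.
  by rewrite expr_div_n -Hs; field.
have [u1 U1] := twist _ h1; have [u2 U2] := twist _ h2.
have [u3 U3] : exists u : K, x%:~R - (- p%:Z)%:~R = u ^+ 2.
  case: h3 => [->|[n sq]]; first by exists 0; rewrite subrr expr0n.
  have [s s0 Hs] := sqrK_odd K l_odd n sq; exists s.
  by move: Hs; rewrite ratr_int rmorphB.
right; exists x%:~R, u1, u2, u3.
have r1 : ratr 1 = 1 :> K by exact: (rmorph1 (rat_compl K)).
have r0 : ratr 0 = 0 :> K by exact: (rmorph0 (rat_compl K)).
have re3 : ratr e3 = (- p%:Z)%:~R :> K.
  have -> : e3 = (- p%:Z)%:~R by rewrite /e3 rmorphN.
  exact: ratr_int.
rewrite rD r1 r0 re3 aQ ratr_int mulr1 mul1r; split=> //.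
Qed.

(** Since [p = 7] modulo 8, [-p = s ^+ 2] in Q_2. For the pair (2, 1) take [X = 2 s^2]: then
    [X - e3 = s^2] and [X - e2 = 2 s^2 (1 + 2^(2m-1))], where the last factor is 1 modulo 8, hence a
    square, because [m >= 2]. *)
Lemma sol_two (l_pr : prime 2) (K : completion (Defs.Finite l_pr)) (b c : bool) :
  (c -> (1 < m)%N) -> selmer_sol ((- p%:R) ^+ b * 2 ^+ c) 1 K.
Proof.
move=> hc.
have sp : sqrK K (- p%:R).
  have -> : - p%:R = (- p%:Z)%:~R :> rat by rewrite rmorphN.
  apply: sqrK_two; first by rewrite oppr_eq0 eqz_nat -lt0n prime_gt0.
  rewrite opprK; have [k ->] := p_mod8.
  by apply/dvdzP; exists (k%:Z + 1); rewrite PoszD PoszM; ring.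
have spb := sqrK_expb (b := b) (fun=> sp).
rewrite [_ * _]mulrC -[X in selmer_sol _ X](mulr1 1).
apply/(covering_sqrP _ _ _ _ _ spb (sqrK1 K)).
case: c hc => [/(_ isT) m1|_]; last by rewrite expr0; apply: covering_trivial; exact: sqrK1.
have [s s0 Hs] := sp.
have [w w0 Hw] : sqrK K (1 + 2 ^+ (2 * m - 1)).
  have -> : 1 + 2 ^+ (2 * m - 1) = (1 + 2 ^+ (2 * m - 1))%:~R :> rat.
    by rewrite rmorphD rmorphXn.
  apply: sqrK_two.
    have : 0 < 1 + 2 ^+ (2 * m - 1) :> int by rewrite addr_gt0 // exprn_gt0.
    by move/gt_eqF ->.
  have -> : (2 * m - 1 = 3 + (2 * m - 4))%N by move: m1; lia.
  by rewrite opprD addrA subrr add0r rpredN exprD dvdz_mulr.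
have r1 : ratr 1 = 1 :> K by exact: (rmorph1 (rat_compl K)).
have r0 : ratr 0 = 0 :> K by exact: (rmorph0 (rat_compl K)).
have r2 : ratr 2 = 2 :> K by rewrite ratr_nat.
have re3 : ratr e3 = s ^+ 2 by rewrite -Hs.
have re2 : ratr e2 = - 2 ^+ (2 * m) * s ^+ 2.
  rewrite -Hs; have -> : e2 = - 2 ^+ (2 * m) * - p%:R.
    by rewrite E2 -exprM mulnC; ring.
  by rewrite ratr_complM; congr (_ * _); rewrite -[LHS]/(rat_compl K _) rmorphN rmorphXn /= r2.
have rw : 1 + 2 ^+ (2 * m - 1) = w ^+ 2.
  by rewrite -Hw ratr_complD r1 ratr_complXn r2.
right; exists (2 * s ^+ 2), s, (s * w), s; rewrite r0 r1 r2 re3 re2; split; first by ring.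
- have [k Dk] : exists k, (2 * m = k.+1)%N by exists (2 * m - 1)%N; move: m1; lia.
  by rewrite exprMn -rw Dk subn1 /= [2 ^+ k.+1]exprS; ring.
- by rewrite mul1r mulr_natl mulr2n addrK.
Qed.

(** At the real place and at [p], both 2 and [q] are squares and [sol_oppp] applies; at [q], [-p] is
    a square, and so is 2 when [m >= 2]. *)
Lemma sol_base (b c : bool) (v : place) (K : completion v) :
  (c -> (1 < m)%N) -> selmer_sol ((- p%:R) ^+ b * 2 ^+ c) 1 K.
Proof.
case: v K => [|l l_pr] K hc.
  by apply: sol_oppp => [_|]; apply: sqrK_real => //; rewrite ltr0n prime_gt0.
have [l2|l2] := eqVneq l 2%N; first by subst l; exact: sol_two.
have [lp|lp] := eqVneq l p.
  subst l; apply: sol_oppp => [_|].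
    apply: (@sqrK_odd p l_pr K 2) => //; [exact: p_odd | | exact: qr_p_2].
    by rewrite dvdzE /= dvdn_prime2.
  apply: (@sqrK_odd p l_pr K q) => //; [exact: p_odd | | exact: qr_p_q].
  by rewrite dvdzE /= dvdn_prime2 // (negPf q_neq_p).
have [lq|lq] := eqVneq l q; last exact: sol_good.
subst l; apply: covering_trivial; last exact: sqrK1.
rewrite (bool_irrelevance l_pr q_pr) in K *.
apply: sqrKM; apply: sqrK_expb; first by move=> _; exact: sqrK_opp_p_q.
move=> /hc m1.
apply: (@sqrK_odd q q_pr K 2); [exact: q_odd | | exact: qr_q_2].
by rewrite dvdzE /= dvdn_prime2.
Qed.

(** * The Selmer group *)

Definition rep1 (x y b c : bool) : rat :=
  (-1) ^+ x * (- p%:R) ^+ y * ((- p%:R) ^+ b * 2 ^+ c).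
(** In the pair formed by [rep1] and [rep3], the bits [x] and [y] run over the image (-1, p), (-p,
    q) of E[2], while [b] and [c] account for the Selmer rank. *)
Definition rep3 (x y : bool) : rat := p%:R ^+ x * q%:R ^+ y.

Lemma rep1_neq0 (x y b c : bool) : rep1 x y b c != 0.
Proof. by rewrite /rep1 !mulf_neq0 ?expf_neq0 ?oppr_eq0. Qed.

Lemma rep3_neq0 (x y : bool) : rep3 x y != 0.
Proof. by rewrite /rep3 mulf_neq0 ?expf_neq0. Qed.

Lemma sol_rep (x y b c : bool) (v : place) (K : completion v) :
  (c -> (1 < m)%N) -> selmer_sol (rep1 x y b c) (rep3 x y) K.
Proof.
move=> hc; have h := sol_base b K hc.
have d0 : (- p%:R) ^+ b * 2 ^+ c != 0 :> rat by rewrite mulf_neq0 ?expf_neq0 ?oppr_eq0.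
have {h} h : selmer_sol ((- p%:R) ^+ y * ((- p%:R) ^+ b * 2 ^+ c)) (q%:R ^+ y) K.
  case: y; rewrite ?expr1 ?expr0 ?mul1r //.
  by rewrite mulrC -[q%:R]mul1r; apply: sol_T3 => //; exact: oner_neq0.
rewrite /rep1 /rep3; case: x; rewrite ?expr1 ?expr0 ?mul1r //.
rewrite mulN1r mulNr mulrC -/(p%:R) [p%:R * _]mulrC [_ * (- p%:R) ^+ y]mulrC.
apply: sol_T1 => //; last by rewrite expf_neq0.
by rewrite mulf_neq0 // expf_neq0 // oppr_eq0.
Qed.

Definition fam (x y b c : bool) : galQ -> ecpoint algC :=
  kummer_cocycle 0 e2 e3 (sqrtQ (rep1 x y b c)) (sqrtQ (rep3 x y)).

Lemma fam_selmer (x y b c : bool) : (c -> (1 < m)%N) ->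
  cocycle2 (E_cubic m p) (fam x y b c) /\
  forall v, locally_trivial (E_cubic m p) v (fam x y b c).
Proof.
move=> hc; rewrite E_cubicE; split.
  exact: (kummer_cocycleP e12 e13 e23 (rep1_neq0 _ _ _ _) (rep3_neq0 _ _) (sqrtQK _) (sqrtQK _)).
move=> v; apply: (locally_trivial_kummer e12 e13 e23 (rep1_neq0 _ _ _ _) (rep3_neq0 _ _) (sqrtQK _) (sqrtQK _)).
by move=> K; exact: sol_rep.
Qed.

Lemma fam_inj (x y b c x' y' b' c' : bool) : fam x y b c = fam x' y' b' c' ->
  [/\ x = x', y = y', b = b' & c = c'].
Proof.
move=> /(kummer_cocycle_inj e12 e13 e23 (rep1_neq0 _ _ _ _) (rep3_neq0 _ _) (rep1_neq0 _ _ _ _) (rep3_neq0 _ _)).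
move=> [[r1 h1] [r3 h3]].
have [ex ey] : x = x' /\ y = y'.
  apply: (@sqr_class_bits p q 0 x x' y y' (rep3 x' y' * r3)) => //; first exact: q_neq_p.
  by rewrite exprMn -mulrA -/(rep3 x' y') expr2 -mulrA -h3 /rep3 !exprD; ring.
have [eb ec] : b = b' /\ c = c'.
  have nz : (-1) ^+ x' * (- p%:R) ^+ y' != 0 :> rat by rewrite mulf_neq0 ?expf_neq0 ?oppr_eq0.
  apply: (@sqr_class_bits p 2 (b + b') b b' c c' ((- p%:R) ^+ b' * 2 ^+ c' * r1)) => //.
    by have [k ->] := p_mod8; rewrite addnC.
  rewrite /rep1 ex ey -!mulrA in h1; rewrite !mulrA in h1.
  have {}h1 : (- p%:R) ^+ b * 2 ^+ c = (- p%:R) ^+ b' * 2 ^+ c' * r1 ^+ 2 :> rat.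
    by apply: (mulfI nz); rewrite !mulrA.
  transitivity ((- p%:R) ^+ b' * 2 ^+ c' * ((- p%:R) ^+ b' * 2 ^+ c' * r1 ^+ 2) :> rat); last by ring.
  by rewrite -h1 !exprD; case: (b); case: (b') => /=; ring.
by split.
Qed.

(** [even_val_first] at the root 0, whose differences with the other roots are [4^m p] and [p] up to
    sign, both units at [l]. *)
Lemma sol_parity1 (l : nat) (l_pr : prime l) (K : completion (Defs.Finite l_pr)) (N1 N3 : int) :
  N1 != 0 -> N3 != 0 -> l != 2%N -> l != p -> selmer_sol N1%:~R N3%:~R K ->
  ~~ odd (logn l `|N1|%N).
Proof.
move=> N10 N30 l2 lp h; apply: (@even_val_int l l_pr K) => //.
have n1 : (N1%:~R : K) != 0 by rewrite -(ratr_int K) ratr_compl_eq0 intr_eq0.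
have n3 : (N3%:~R : K) != 0 by rewrite -(ratr_int K) ratr_compl_eq0 intr_eq0.
have lp1 : ~~ (l%:Z %| p%:Z)%Z by rewrite dvdzE /= dvdn_prime2.
move: h; rewrite /selmer_sol /covering_soluble !ratr_int.
case=> [[[u1 E1] _]|[X [u1 [u2 [u3 [E1 E2' E3]]]]]].
  by rewrite E1; apply: even_val_sqr; apply: contraNneq n1 => z; rewrite E1 z expr0n.
apply: (even_val_first _ _ _ n1 (mulf_neq0 n1 n3) n3 _ E1 E2' E3).
- by rewrite -[ratr 0]/(rat_compl K 0) rmorph0 compl_abs0.
- rewrite -ratr_complB sub0r.
  have -> : - e2 = (- ((2 ^+ m) ^+ 2 * p%:Z))%:~R by rewrite E2 rmorphN rmorphM !rmorphXn.
  rewrite ratr_int; apply: compl_abs_int_unit; rewrite rpredN p_ndvd // dvdzE !abszX !Euclid_dvdX //=.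
  by rewrite dvdn_prime2 // (negPf l2).
- rewrite -ratr_complB sub0r /e3 opprK ratr_nat.
  exact: (@compl_abs_int_unit l l_pr K p%:Z).
- have -> : N1%:~R * (N1%:~R * N3%:~R) * N3%:~R = (N1%:~R * N3%:~R) ^+ 2 :> K by ring.
  by apply: even_val_sqr; rewrite mulf_neq0.
Qed.

(** The same at the root [e3], whose differences are [p q] and [p] up to sign; this covers [l = 2]
    as well. *)
Lemma sol_parity3 (l : nat) (l_pr : prime l) (K : completion (Defs.Finite l_pr)) (N1 N3 : int) :
  N1 != 0 -> N3 != 0 -> l != p -> l != q -> selmer_sol N1%:~R N3%:~R K ->
  ~~ odd (logn l `|N3|%N).
Proof.
move=> N10 N30 lp lq h; apply: (@even_val_int l l_pr K) => //.
have n1 : (N1%:~R : K) != 0 by rewrite -(ratr_int K) ratr_compl_eq0 intr_eq0.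
have n3 : (N3%:~R : K) != 0 by rewrite -(ratr_int K) ratr_compl_eq0 intr_eq0.
have lp1 : ~~ (l%:Z %| p%:Z)%Z by rewrite dvdzE /= dvdn_prime2.
have lq1 : ~~ (l%:Z %| q%:Z)%Z by rewrite dvdzE /= dvdn_prime2.
move: h; rewrite /selmer_sol /covering_soluble !ratr_int.
case=> [[_ [u3 D3]]|[X [u1 [u2 [u3 [E1 E2' E3]]]]]].
  by rewrite D3; apply: even_val_sqr; apply: contraNneq n3 => z; rewrite D3 z expr0n.
apply: (even_val_first _ _ _ n3 (mulf_neq0 n1 n3) n1 _ E3 E2' E1).
- have -> : e3 = (- p%:Z)%:~R by rewrite /e3 rmorphN.
  by rewrite ratr_int; exact: compl_abs_int_le1.
- rewrite -ratr_complB.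
  have -> : e3 - e2 = (- (q%:Z * p%:Z))%:~R.
    by rewrite rmorphN rmorphM /= /e3 E2 -!pmulrn Q2; ring.
  by rewrite ratr_int; apply: compl_abs_int_unit; rewrite rpredN p_ndvd.
- rewrite -ratr_complB subr0.
  have -> : e3 = (- p%:Z)%:~R by rewrite /e3 rmorphN.
  by rewrite ratr_int; apply: compl_abs_int_unit; rewrite rpredN.
- have -> : N3%:~R * (N1%:~R * N3%:~R) * N1%:~R = (N1%:~R * N3%:~R) ^+ 2 :> K by ring.
  by apply: even_val_sqr; rewrite mulf_neq0.
Qed.

Lemma fam_complete (c : galQ -> ecpoint algC) :
  cocycle2 (E_cubic m p) c -> (forall v, locally_trivial (E_cubic m p) v c) ->
  exists x y b a : bool, (m = 1%N -> a = false) /\ c = fam x y b a.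
Proof.
rewrite E_cubicE => /(cocycle2_kummer e12 e13 e23)[d1 [d3 [b1 [b3 [d10 d30 Db1 Db3 ->]]]]] lt.
have loc (l : nat) (l_pr : prime l) := kummer_locally_trivial e12 e13 e23 d10 d30 Db1 Db3 (lt (Defs.Finite l_pr)).
have [N1 N10 c1] := same_class_int d10; have [N3 N30 c3] := same_class_int d30.
have p2 : 2%N != p by have [k ->] := p_mod8; rewrite addnC.
have [s [a [b cs1]]] : exists s a b : bool, same_class N1%:~R ((-1) ^+ s * 2%:R ^+ a * p%:R ^+ b).
  apply: squarefree_class2 => // l l_pr l2 lp; have [K HK] := loc l l_pr.
  by apply: (sol_parity1 N10 N30 l2 lp); apply: (iffLR (sol_class K c1 c3) HK).
have [t [e [d cs3]]] : exists t e d : bool, same_class N3%:~R ((-1) ^+ t * p%:R ^+ e * q%:R ^+ d).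
  apply: squarefree_class2 => //; first exact: q_neq_p.
  move=> l l_pr lp lq; have [K HK] := loc l l_pr.
  by apply: (sol_parity3 N10 N30 lp lq); apply: (iffLR (sol_class K c1 c3) HK).
have cc1 := same_class_trans c1 cs1; have cc3 := same_class_trans c3 cs3.
have norm (l : nat) (l_pr : prime l) : exists K : completion (Defs.Finite l_pr),
    selmer_sol ((-1) ^+ (s (+) e (+) d) * 2 ^+ a * p%:R ^+ (b (+) d)) ((-1) ^+ t) K.
  have [K HK] := loc l l_pr; exists K; apply: sol_normalise.
  exact: (iffLR (sol_class K cc1 cc3) HK).
have [Kp /sol_at_p[t0 sb]] := norm p p_pr.
(* The exponents [e] of [p] and [d] of [q] in [d3] tell which torsion point was used for the
   translation. *)
exists e, d, (b (+) d), a; split.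
  move=> m1; have [Kq] := norm q q_pr; rewrite t0 expr0 sb.
  case: (a) => // h; case: (@no_sol_at_5 Kq (b (+) d) m1).
  have -> : (- p%:R) ^+ (b (+) d) * 2 = (-1) ^+ (b (+) d) * 2 ^+ true * p%:R ^+ (b (+) d) :> rat.
    by case: (b (+) d); rewrite ?expr0 ?expr1; ring.
  exact: h.
have [r1 r10 h1] := cc1; have [r3 r30 h3] := cc3.
(* In [rep1] the power of [p] has exponent [d + (b (+) d)], which equals [b] except that it is 2
   when [b = 0] and [d = 1]; there the extra [p ^+ 2] is absorbed into [r1]. *)
rewrite /fam; apply: (@kummer_cocycle_class _ _ _ _ _ (r1 / p%:R ^+ (~~ b && d)) r3 _ _ _ _ Db1 Db3) => //.
- rewrite h1 expr_div_n /rep1; move: sb.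
  case: (s); case: (e); case: (d); case: (b) => //= _; by field.
- by rewrite h3 t0 expr0 mul1r.
- by rewrite mulf_neq0 // invr_eq0 expf_neq0.
Qed.

Lemma Sel2E : Sel2 (E_cubic m p) =
  [set [set fam t.1.1.1 t.1.1.2 t.1.2 t.2]%classic | t in
     [set t : bool * bool * bool * bool | t.2 -> (1 < m)%N]]%classic.
Proof.
rewrite E_cubicE; apply/seteqP; split=> [_ [c [cc lt] <-]|_ [[[[x y] b] a] /= ha <-]].
  have [x [y [b [a [ha Dc]]]]] : exists x y b a : bool, (m = 1%N -> a = false) /\ c = fam x y b a.
    by apply: fam_complete; rewrite E_cubicE.
  exists (x, y, b, a) => /=; last by rewrite H1_class_set1 // Dc.
  case: (a) ha => // ha _; case: (m) m_gt0 ha => [|[|k]] // _ /(_ erefl).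
  by [].
have := fam_selmer x y b ha; rewrite E_cubicE => -[cc lt]; exists (fam x y b a) => //.
by rewrite H1_class_set1.
Qed.

Lemma Selmer_rank_one : m = 1%N -> Selmer_rank (E_cubic m p) 1.
Proof.
move=> m1; rewrite /Selmer_rank Sel2E.
have -> : [set [set fam t.1.1.1 t.1.1.2 t.1.2 t.2]%classic | t in
     [set t : bool * bool * bool * bool | t.2 -> (1 < m)%N]]%classic =
   [set [set fam t.1.1 t.1.2 t.2 false]%classic | t in [set: bool * bool * bool]]%classic.
  apply/seteqP; split=> [_ [[[[x y] b] a] /= ha <-]|_ [[[x y] b] _ <-]].
    exists (x, y, b) => //=; case: (a) ha => // /(_ isT).
    by rewrite m1.
  by exists (x, y, b, false).
have c8 := card_finType (bool * bool * bool)%type.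
rewrite !card_prod card_bool in c8.
apply: card_eq_trans c8; apply: inj_card_eq => -[[x y] b] [[x' y'] b'] _ _ /= e.
have : [set fam x y b false]%classic (fam x' y' b' false) by rewrite e.
by move=> /= /fam_inj[-> -> -> _].
Qed.

Lemma Selmer_rank_two : (1 < m)%N -> Selmer_rank (E_cubic m p) 2.
Proof.
move=> m1; rewrite /Selmer_rank Sel2E.
have -> : [set t : bool * bool * bool * bool | t.2 -> (1 < m)%N]%classic = [set: bool * bool * bool * bool]%classic.
  by apply/eq_set => t; apply/propext; split=> [|_].
have c16 := card_finType (bool * bool * bool * bool)%type.
rewrite !card_prod card_bool in c16.
apply: card_eq_trans c16; apply: inj_card_eq => -[[[x y] b] a] [[[x' y'] b'] a'] _ _ /= e.
have : [set fam x y b a]%classic (fam x' y' b' a') by rewrite e.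
by move=> /= /fam_inj[-> -> -> ->].
Qed.
End Curve.

Theorem theorem1p1 (m p q : nat)
    (hm : (0 < m)%N)
    (hp : prime p) (hp8 : p = 7 %[mod 8])
    (hqE : q = (4 ^ m + 1)%N) (hq : prime q)
    (hpq : legendre p q = 1%R) :
  (m = 1%N -> Selmer_rank (E_cubic m p) 1) /\
  ((2 <= m)%N ->
     exists2 s : nat, Selmer_rank (E_cubic m p) s & (1 <= s <= 3)%N).
Proof.
split=> [m1|m2].
  exact: (Selmer_rank_one hm hp hp8 hqE hq hpq m1).
by exists 2%N => //; exact: (Selmer_rank_two hm hp hp8 hqE hq hpq m2).
Qed.
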